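(* Let $(X^i_k)_{0\le k\le i}$ be an admissible monotone quotiented inverse system. Then the spaces $X^i_k$ are doubling and satisfy a $(1,1)$-Poincaré inequality locally at unit scale, uniformly: there are constants $D,C_{PI},\tau$, independent of $i$ and $k$, such that for all $0\le k\le i$, all $x\in X^i_k$ and all $0<r<1$, writing $\mu=\mu^i_k$ and $B=B(x,r)$, one has $\mu(B(x,2r))\le D\,\mu(B(x,r))$, and for every Lipschitz $f\colon X^i_k\to\mathbb{R}$, $$\frac1{\mu(B)}\int_B|f-f_B|\,d\mu\le C_{PI}\,r\,\frac1{\mu(\tau B)}\int_{\tau B}\operatorname{Lip}[f]\,d\mu .$$
   Context: Notation: $f_B=\frac1{\mu(B)}\int_B f\,d\mu$, $\tau B=B(x,\tau r)$, $\operatorname{Lip}[f](x)=\limsup_{y\to x,\,y\ne x}\frac{|f(x)-f(y)|}{d(x,y)}$; $\varphi_*\mu$ denotes push-forward. For a graph $G$ with edges of length $s$, $G^{/m}$ is the graph obtained by subdividing each edge into $m$ edges of length $s/m$. $\mathrm{Str}_v$ is the closed star of a vertex $v$: $v$ together with all edges adjacent to it. $A\asymp_C B$ means $A\le CB$ and $B\le CA$. Fix integers $3\le m_i\le M$ ($i\ge1$), $s_0=1$, $s_i=\prod_{j=1}^i\frac1{m_j}$. A monotone quotiented inverse system consists, for integers $0\le k\le i$, of graphs $X^i_k$ with path metric, all edges of length $s_i$, with a measure $\mu^i_k$ which on each edge is a constant multiple of arclength; maps $\pi^i_k\colon X^{i+1}_k\to X^i_k$; maps $q^i_k\colon X^i_{k-1}\to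 X^i_k$ ($1\le k\le i$); and maps $h^i_k\colon X^i_k\to T$ that are isometric on each edge, where $T$ is either $\mathbb{R}$ or the circle of length $4$; such that $q^i_k\circ\pi^i_{k-1}=\pi^i_k\circ q^{i+1}_k$. Write $q^i_{lk}=q^i_k\circ\cdots\circ q^i_{l+1}\colon X^i_l\to X^i_k$. The system is admissible if, with constants uniform over all indices: (1) $\pi^i_k$ and $q^i_k$ are simplicial, where $\pi^i_k$ is regarded as a map to $(X^i_k)^{/m_{i+1}}$; (2) all $X^i_k$ are connected; (3) all $X^i_k$ have degree at most $C$, and $\mu^i_k(e)\asymp_C\mu^i_k(f)$ for adjacent edges $e,f$; (4) $(q^i_k)_*\mu^i_{k-1}=\mu^i_k$ and $(\pi^i_k)_*\mu^{i+1}_k=\mu^i_k$; (5) $h^i_k\circ\pi^i_k=h^{i+1}_k$ and $h^i_k\circ q^i_k=h^i_{k-1}$; (6) $\operatorname{diam}((\pi^i_k)^{-1}(p))\le Cs_i$ for all $p\in X^i_k$; (7) $\pi^i_k$ is open; (8) $\pi^i_k,q^i_k$ are surjective; (9) for each vertex $v$ of $(X^i_k)^{/m_{i+1}}$ and each vertex $v'\in(\pi^i_k)^{-1}(v)$ of $X^{i+1}_k$ there is a constant $c_{v',v}$ with $(\pi^i_k)_*(\mu^{i+1}_k|_{\mathrm{Str}_{v'}})=c_{v',v}\,\mu^i_k|_{\mathrm{Str}_v}$, where $\mathrm{Str}_v$ is the star in $(X^i_k)^{/m_{i+1}}$; (10) there are $\delta,C>0$ such that for $l\le k\le i$, $x\in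 X^i_k$, $r\in(0,\delta s_l)$: $\operatorname{diam}\big((q^i_{lk})^{-1}(B(x,r))\big)\le Cs_l$. *)

(* Defs.v *)
From HB Require Import structures.
From mathcomp Require Import all_boot all_order all_algebra.
From mathcomp Require Import all_classical all_reals all_analysis.
From mathcomp Require Import lra.

Set Implicit Arguments.
Unset Strict Implicit.
Unset Printing Implicit Defensive.

Import Order.TTheory GRing.Theory Num.Theory.
Import numFieldNormedType.Exports.

Local Open Scope classical_set_scope.
Local Open Scope ring_scope.

#[short(type="pmetricType")]
HB.structure Definition PMetric (K : numDomainType) :=
  {M of Metric K M & isPointed M}.

(* The circle of length 4, as R/4Z with representatives in [0, 4[. *)
Definition circle4 (R : realType) := {x : R | (0 <= x) && (x < 4)}.

Section Circle.
Variable R : realType.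

HB.instance Definition _ := Choice.on (circle4 R).

Definition circle4_dist (x y : circle4 R) : R :=
  Num.min `|val x - val y| (4 - `|val x - val y|).

Let minP (a b : R) :
  (Num.min a b = a /\ a <= b) \/ (Num.min a b = b /\ b <= a).
Proof. by case: (lerP a b) => ab; [left | right; split=> //; exact: ltW]. Qed.

Let dist_xx x : circle4_dist x x = 0.
Proof. by rewrite /circle4_dist subrr normr0 subr0 minEle ler0n. Qed.

Let dist_pos x y : circle4_dist x y = 0 -> x = y.
Proof.
case: x y => [x xP] [y yP]; rewrite /circle4_dist /= => h.
apply: val_inj => /=; move: h xP yP => + /andP[x0 x4] /andP[y0 y4].
by case: (minP `|x - y| (4 - `|x - y|)) => -[-> _];
  case: (ger0P (x - y)) => ? ?; lra.
Qed.

Let dist_sym x y : circle4_dist x y = circle4_dist y x.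
Proof. by rewrite /circle4_dist distrC. Qed.

Let dist_triangle y x z :
  circle4_dist x z <= circle4_dist x y + circle4_dist y z.
Proof.
case: x y z => [x xP] [y yP] [z zP]; rewrite /circle4_dist /=.
move: xP yP zP => /andP[x0 x4] /andP[y0 y4] /andP[z0 z4].
case: (minP `|x - y| (4 - `|x - y|)) => -[-> +];
case: (minP `|y - z| (4 - `|y - z|)) => -[-> +];
case: (minP `|x - z| (4 - `|x - z|)) => -[-> +];
by case: (ger0P (x - y)) => ?; case: (ger0P (y - z)) => ?;
  case: (ger0P (x - z)) => ? ? ? ?; lra.
Qed.

HB.instance Definition _ := isMetric.Build R (circle4 R)
  dist_xx dist_pos dist_sym dist_triangle.

End Circle.

Inductive target := Line | Circle.

Definition target_space (R : realType) (T : target) : metricType R :=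
  match T with Line => R^o : metricType R | Circle => circle4 R end.

Section MetricSpaces.
Variable R : realType.

Definition diam (X : metricType R) (A : set X) : \bar R :=
  ereal_sup [set (mdist p.1 p.2)%:E | p in A `*` A].

Definition metric_lipschitz (X : metricType R) (f : X -> R) :=
  exists L : R, forall x y, `|f x - f y| <= L * mdist x y.

(* The maximum with 0 only matters at isolated points x, where the limsup over
   the empty punctured neighbourhood would be -oo instead of 0. *)
Definition Lip (X : metricType R) (f : X -> R) (x : X) : \bar R :=
  maxe 0%:E (limf_esup (fun y => (`|f x - f y| / mdist x y)%:E) x^').

Definition borel (X : pmetricType R) := g_sigma_algebraType (@open X).

Definition mean (X : pmetricType R)
    (mu : {measure set (borel X) -> \bar R}) (B : set X) (g : X -> \bar R) :
    \bar R :=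
  (((fine (mu B))^-1)%:E * \int[mu]_(x in (B : set (borel X))) g x)%E.

End MetricSpaces.

(* A multigraph drawn in X, all edges having the same length. Each edge is
   parametrised with constant speed by [0, 1]; the orientation is arbitrary and
   the values of [arc e] outside [0, 1] are irrelevant. *)
Record graph (R : realType) (X : Type) := Graph {
  vertex : set X ;
  edge : Type ;
  arc : edge -> R -> X ;
  len : R
}.
Arguments vertex {R X} g.
Arguments edge {R X} g.
Arguments arc {R X} g.
Arguments len {R X} g.

Section Graphs.
Variable R : realType.

Section Plain.
Variable X : Type.
Implicit Types (G : graph R X).

Definition subdivide G (n : nat) : graph R X := {|
  vertex := vertex G `|`
    [set x | exists e (j : nat), (j <= n)%N /\ x = arc G e (j%:R / n%:R)] ;
  edge := (edge G * 'I_n)%type ;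
  arc := fun p t => arc G p.1 ((p.2%:R + t) / n%:R) ;
  len := len G / n%:R
|}.

Definition cell G (e : edge G) : set X := arc G e @` `[0, 1].

Definition incident G (v : X) (e : edge G) := arc G e 0 = v \/ arc G e 1 = v.

Definition adjacent G (e f : edge G) :=
  exists2 v, incident v e & incident v f.

(* A loop at v contributes two ends. *)
Definition edge_ends G (v : X) : set (edge G * bool) :=
  [set p | arc G p.1 (nat_of_bool p.2)%:R = v].

Definition star G (v : X) : set X :=
  [set v] `|` \bigcup_(e in [set e : edge G | incident v e]) cell e.

(* [chain G x y l]: there is a concatenation of segments of edges, of total
   length l, from x to y. *)
Inductive chain G : X -> X -> R -> Prop :=
| chain_nil x : chain G x x 0
| chain_cons e t t' y l : 0 <= t <= 1 -> 0 <= t' <= 1 ->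
    chain G (arc G e t') y l ->
    chain G (arc G e t) y (len G * `|t - t'| + l).

End Plain.

Arguments chain {X} G _ _ _.

Record is_metric_graph (X : metricType R) (G : graph R X) : Prop := {
  len_gt0 : 0 < len G ;
  arc_ends : forall e, vertex G (arc G e 0) /\ vertex G (arc G e 1) ;
  arc_interior : forall e t, 0 < t < 1 -> ~ vertex G (arc G e t) ;
  arc_inj : forall e e' t t', 0 < t < 1 -> 0 < t' < 1 ->
    arc G e t = arc G e' t' -> e = e' /\ t = t' ;
  arc_cover : forall x, vertex G x \/
    exists e t, 0 < t < 1 /\ x = arc G e t ;
  path_metric : forall x y,
    (mdist x y)%:E = ereal_inf [set l%:E | l in chain G x y]
}.

Definition simplicial (X Y : Type) (G : graph R X) (H : graph R Y)
    (phi : X -> Y) :=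
  (forall v, vertex G v -> vertex H (phi v)) /\
  (forall e, [\/
      exists e', forall t, 0 <= t <= 1 -> phi (arc G e t) = arc H e' t,
      exists e', forall t, 0 <= t <= 1 -> phi (arc G e t) = arc H e' (1 - t) |
      exists2 v, vertex H v & forall t, 0 <= t <= 1 -> phi (arc G e t) = v]).

Definition arclength (X : Type) (G : graph R X) (e : edge G) (A : set X) :
    \bar R :=
  ((len G)%:E *
   @lebesgue_measure R [set t : R | (0 <= t <= 1)%R /\ A (arc G e t)])%E.

Definition multiple_of_arclength (X : pmetricType R) (G : graph R X)
    (mu : {measure set (borel X) -> \bar R}) :=
  forall e : edge G, exists2 c : R, 0 <= c &
    forall A : set (borel X), measurable A -> A `<=` cell e ->
      mu A = (c%:E * arclength e A)%E.

End Graphs.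

Arguments edge_ends {R X} G v.
Arguments star {R X} G v.

Section Systems.
Variables (R : realType) (m : nat -> nat) (T : target).

Definition scale (i : nat) : R := \prod_(1 <= j < i.+1) (m j)%:R^-1.

(* [Xsp i k], ..., [height i k] are X^i_k, mu^i_k, pi^i_k, h^i_k, while
   [quotn i k] is q^i_(k+1). Only the indices k <= i (k < i for [quotn]) are
   meaningful. *)
Record qsystem := QSystem {
  Xsp : nat -> nat -> pmetricType R ;
  gr : forall i k, graph R (Xsp i k) ;
  meas : forall i k, {measure set (borel (Xsp i k)) -> \bar R} ;
  projn : forall i k, Xsp i.+1 k -> Xsp i k ;
  quotn : forall i k, Xsp i k -> Xsp i k.+1 ;
  height : forall i k, Xsp i k -> target_space R T ;
  graphP : forall i k, (k <= i)%N -> is_metric_graph (gr i k) ;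
  len_scale : forall i k, (k <= i)%N -> len (gr i k) = scale i ;
  mu_arclength : forall i k, (k <= i)%N ->
    multiple_of_arclength (gr i k) (meas i k) ;
  h_isometric : forall i k, (k <= i)%N -> forall (e : edge (gr i k)) x y,
    cell e x -> cell e y -> mdist (height x) (height y) = mdist x y ;
  pi_q_comm : forall i k, (k < i)%N -> forall x : Xsp i.+1 k,
    quotn (projn x) = projn (quotn x)
}.

Variable S : qsystem.

(* The composition X^i_l -> X^i_(n+l) of n consecutive q-maps. *)
Fixpoint qcomp (i l n : nat) : Xsp S i l -> Xsp S i (n + l) :=
  match n with
  | 0 => fun x => x
  | n'.+1 => fun x => @quotn S i (n' + l) (@qcomp i l n' x)
  end.

Record admissible_with (C delta : R) : Prop := {
  adm_pi_simplicial : forall i k, (k <= i)%N ->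
    simplicial (gr S i.+1 k) (subdivide (gr S i k) (m i.+1)) (@projn S i k) ;
  adm_q_simplicial : forall i k, (k < i)%N ->
    simplicial (gr S i k) (gr S i k.+1) (@quotn S i k) ;
  adm_connected : forall i k, (k <= i)%N -> connected [set: Xsp S i k] ;
  adm_degree : forall i k, (k <= i)%N -> forall v, vertex (gr S i k) v ->
    exists2 n : nat, n%:R <= C & (edge_ends (gr S i k) v #<= `I_n)%card ;
  adm_adjacent : forall i k, (k <= i)%N -> forall e f : edge (gr S i k),
    adjacent e f -> (meas S i k (cell e) <= C%:E * meas S i k (cell f))%E ;
  adm_q_measure : forall i k, (k < i)%N ->
    forall A : set (borel (Xsp S i k.+1)), measurable A ->
    pushforward (meas S i k) (@quotn S i k : borel _ -> borel _) A =
      meas S i k.+1 A ;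
  adm_pi_measure : forall i k, (k <= i)%N ->
    forall A : set (borel (Xsp S i k)), measurable A ->
    pushforward (meas S i.+1 k) (@projn S i k : borel _ -> borel _) A =
      meas S i k A ;
  adm_h_pi : forall i k, (k <= i)%N -> forall x : Xsp S i.+1 k,
    height (projn x) = height x ;
  adm_h_q : forall i k, (k < i)%N -> forall x : Xsp S i k,
    height (quotn x) = height x ;
  adm_pi_fiber : forall i k, (k <= i)%N -> forall p : Xsp S i k,
    (diam (@projn S i k @^-1` [set p]) <= (C * scale i)%:E)%E ;
  adm_pi_open : forall i k, (k <= i)%N -> forall U : set (Xsp S i.+1 k),
    open U -> open (@projn S i k @` U) ;
  adm_pi_surj : forall i k, (k <= i)%N -> set_surj setT setT (@projn S i k) ;
  adm_q_surj : forall i k, (k < i)%N -> set_surj setT setT (@quotn S i k) ;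
  adm_star : forall i k, (k <= i)%N ->
    forall (v : Xsp S i k) (v' : Xsp S i.+1 k),
    vertex (subdivide (gr S i k) (m i.+1)) v -> vertex (gr S i.+1 k) v' ->
    projn v' = v ->
    exists c : R, forall A : set (borel (Xsp S i k)), measurable A ->
      meas S i.+1 k (@projn S i k @^-1` A `&` star (gr S i.+1 k) v') =
      (c%:E * meas S i k (A `&` star (subdivide (gr S i k) (m i.+1)) v))%E ;
  adm_q_fiber : forall i l n, (n + l <= i)%N ->
    forall (x : Xsp S i (n + l)) (r : R), 0 < r < delta * scale l ->
    (diam (@qcomp i l n @^-1` ball x r) <= (C * scale l)%:E)%E
}.

Definition admissible :=
  exists C delta : R, [/\ 0 < C, 0 < delta & admissible_with C delta].

End Systems.

(* Main.v *)
(* A ball of radius r in X^i_k is compared with the graph X^l_j, where s_l is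
   comparable to r and j = min(l, k), through the maps X^i_k <- X^i_j -> X^l_j.
   Since the maps pi are open, paths lift through them; together with the fibre
   bounds (6) and (10) this shows that both maps preserve distances up to a
   factor and an error O(s_l). So a ball corresponds to boundedly many edges of
   X^l_j, which have comparable measures, and the measure is doubling.

   For the Poincare inequality, a Lipschitz function f is pulled back to X^i_j
   and pushed down, level by level, to functions on the vertices of X^a_j for
   a = i, i - 1, ..., l, by averaging over the fibres. By the star condition (9)
   the average over the fibre of a vertex can be computed along any edge at this
   vertex, so the difference of the averages at the two ends of an edge is
   controlled by the integral of Lip f over the preimage of the edge. The L^1
   error made at level a is O(s_a) times the integral of Lip f, and these errors
   sum up to O(s_l). On X^l_j it remains to join boundedly many edges.

   Balls of radius O(s_i) meet boundedly many edges of X^i_k and are treated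
   directly. *)
From mathcomp Require Import all_boot all_order all_algebra.
From mathcomp Require Import all_classical all_reals all_analysis measurable_realfun.
From mathcomp Require Import lra ring.
Require Import Defs.

Set Implicit Arguments.
Unset Strict Implicit.
Unset Printing Implicit Defensive.

Import Order.TTheory GRing.Theory Num.Theory.
Import numFieldNormedType.Exports.

Local Open Scope classical_set_scope.
Local Open Scope ring_scope.

(** * Paths in metric graphs *)

(** All levels are compared on one measure space [Om], in the end X^i_j, by integrating over
    preimages of open edges; the averaged functions are always measured against the same [F]. The
    invariant carried down ([approximable]) has two parts: the discrete gradient is bounded with
    constant exactly 1, which both telescoping along an edge and averaging over a fibre preserve,
    and the L^1 error is at most kappa times the edge length. Averaging adds a fixed amount to
    kappa; passing from a subdivision to the graph divides kappa by m >= 3 and adds 1. Hence a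
    single kappa survives any number of levels. The comparison also stays local: a fibre spans at
    most n edges, and n-neighbourhoods of edges project into n-neighbourhoods, so the same n serves
    on every level. Averages divide by weights of edges, which may vanish; comparability of adjacent
    edges makes them vanish all together or not at all. Subdividing also removes loops, so that the
    end of a lifted edge over a given end of its image is determined. *)

Section MetricGraph.
Variables (R : realType) (X : metricType R) (G : graph R X).
Hypothesis GP : is_metric_graph G.
Implicit Types (x y z : X) (e f : edge G) (t : R).

Lemma end_in (b : bool) : 0 <= (b%:R : R) <= 1.
Proof. by rewrite ler0n lern1 leq_b1. Qed.

Lemma vertex_end e (b : bool) : vertex G (arc G e b%:R).
Proof. by case: (arc_ends GP e) => ? ?; case: b. Qed.

Lemma unit_cases t : 0 <= t <= 1 -> 0 < t < 1 \/ exists b : bool, t = b%:R.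
Proof.
move=> /andP[t0 t1]; case: (eqVneq t 0) => [->|tn0]; first by right; exists false.
case: (eqVneq t 1) => [->|tn1]; first by right; exists true.
by left; rewrite !lt_def tn0 t0 eq_sym tn1 t1.
Qed.

(** [arc_inj] asks for two interior parameters; if only [t] is interior, an end at [t'] would be a
    vertex inside an edge. *)
Lemma arc_interior_eq e e' t t' : 0 < t < 1 -> 0 <= t' <= 1 ->
  arc G e t = arc G e' t' -> e = e' /\ t = t'.
Proof.
move=> tP t'P E; case: (unit_cases t'P) => [|[b bE]]; first by move=> ?; exact: (arc_inj GP tP _ E).
by exfalso; apply: (arc_interior GP tP (e := e)); rewrite E bE; exact: vertex_end.
Qed.

Lemma chain_cat x y z l l' : chain G x y l -> chain G y z l' -> chain G x z (l + l').
Proof.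
elim=> [u|e t t' u k t01 t'01 _ IH] c; first by rewrite add0r.
by rewrite -addrA; apply: chain_cons => //; exact: IH.
Qed.

Lemma chain_arc e t t' : 0 <= t <= 1 -> 0 <= t' <= 1 ->
  chain G (arc G e t) (arc G e t') (len G * `|t - t'|).
Proof.
move=> t01 t'01; rewrite -[X in chain _ _ _ X]addr0.
by apply: chain_cons => //; exact: chain_nil.
Qed.

Lemma chain_sym x y l : chain G x y l -> chain G y x l.
Proof.
elim=> [u|e t t' u k t01 t'01 _ IH]; first exact: chain_nil.
by rewrite addrC; apply: chain_cat IH _; rewrite distrC; exact: chain_arc.
Qed.

Lemma chain_ge0 x y l : chain G x y l -> 0 <= l.
Proof.
elim=> // e t t' u k _ _ _ k0; apply: addr_ge0 => //.
by rewrite mulr_ge0 ?normr_ge0 // ltW ?(len_gt0 GP).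
Qed.

Lemma chain_split x y l a : chain G x y l -> 0 <= a <= l ->
  exists z, chain G x z a /\ chain G z y (l - a).
Proof.
move=> c; elim: c a => [u|e t t' u k t01 t'01 c IH] a aP.
  have -> : a = 0 by apply/eqP; rewrite eq_le andbC.
  by exists u; rewrite subr0; split; exact: chain_nil.
have L0 := len_gt0 GP; case: (lerP a (len G * `|t - t'|)) => h; last first.
  have [|z [c1 c2]] := IH (a - len G * `|t - t'|); first by lra.
  exists z; split; last by move: c2; congr (chain _ _ _ _); ring.
  by have := chain_cons t01 t'01 c1; congr (chain _ _ _ _); ring.
have [E0|En0] := eqVneq t t'.
  exists (arc G e t); have a0 : a = 0 by move: h; rewrite E0 subrr normr0 mulr0; lra.
  rewrite a0 subr0; split; [exact: chain_nil|exact: chain_cons].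
have N0 : 0 < `|t - t'| by rewrite normr_gt0 subr_eq0.
(* The fraction of the first segment at which the length [a] is used up; the case [t = t'], where it
   makes no sense, has been split off. *)
pose s := a / (len G * `|t - t'|).
have s01 : 0 <= s <= 1.
  rewrite /s; apply/andP; split; first by apply: divr_ge0; [lra|apply: mulr_ge0; lra].
  by rewrite ler_pdivrMr ?mul1r// mulr_gt0.
have aE : a = s * (len G * `|t - t'|) by rewrite /s divfK// mulf_neq0 ?gt_eqF.
pose t2 := t + s * (t' - t).
have t201 : 0 <= t2 <= 1.
  rewrite /t2 (_ : t + _ = (1 - s) * t + s * t'); last by ring.
  apply/andP; split; first by apply: addr_ge0; apply: mulr_ge0; lra.
  have ? : (1 - s) * t <= (1 - s) * 1 by apply: ler_wpM2l; lra.
  have ? : s * t' <= s * 1 by apply: ler_wpM2l; lra.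
  by lra.
exists (arc G e t2); split.
  have := chain_arc e t01 t201; congr (chain _ _ _ _).
  rewrite aE /t2 opprD addrA subrr sub0r normrN normrM distrC.
  by rewrite (ger0_norm (andP s01).1); ring.
have := chain_cons t201 t'01 c; congr (chain _ _ _ _).
have -> : t2 - t' = (1 - s) * (t - t') by rewrite /t2; ring.
by rewrite normrM ger0_norm ?[in RHS]aE; [ring|lra].
Qed.

Lemma mdist_chain x y l : chain G x y l -> mdist x y <= l.
Proof.
move=> c; rewrite -lee_fin (path_metric GP); apply: ereal_inf_lbound.
by exists l.
Qed.

Lemma chain_mdist x y r : mdist x y < r -> exists2 l, chain G x y l & l < r.
Proof.
rewrite -lte_fin (path_metric GP) => /ereal_inf_lt[_ [l c <-]].
by rewrite lte_fin => h; exists l.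
Qed.

Lemma mdist_arc e t t' : 0 <= t <= 1 -> 0 <= t' <= 1 ->
  mdist (arc G e t) (arc G e t') <= len G * `|t - t'|.
Proof. by move=> ? ?; apply: mdist_chain; exact: chain_arc. Qed.

(** A graph with a single point may have no edges. A second point is at finite distance, hence
    joined to [x] by a chain, and a nontrivial chain starts on an edge. *)
Lemma on_arc x y : y <> x -> exists e t, 0 <= t <= 1 /\ x = arc G e t.
Proof.
move=> yx; have /chain_mdist[l c _] : mdist x y < mdist x y + 1 by lra.
by case: c yx => [//|e t t' z k t01 _ _ _]; exists e, t.
Qed.

Inductive walk : nat -> X -> X -> Prop :=
| walk_nil x : walk 0 x x
| walk_cons n e (b : bool) y :
    walk n (arc G e (~~ b)%:R) y -> walk n.+1 (arc G e b%:R) y.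

(** Normal form of a path starting at a vertex: only its last edge may be run through partially. *)
Definition vreach x y (l : R) := exists n e (b : bool) t,
  [/\ walk n x (arc G e b%:R), 0 <= t <= 1, y = arc G e t
    & len G * (n%:R + `|t - b%:R|) <= l].

Lemma vreach_le x y l l' : l <= l' -> vreach x y l -> vreach x y l'.
Proof. by move=> ll [n [e [b [t [? ? ? h]]]]]; exists n, e, b, t; split => //; exact: le_trans ll. Qed.

Lemma dist_end (b : bool) t : 0 <= t <= 1 -> `|t - b%:R| = if b then 1 - t else t.
Proof. move=> /andP[t0 t1]; case: b; rewrite /= ?subr0; last by rewrite ger0_norm.
by rewrite distrC ger0_norm// subr_ge0. Qed.

(* A path leaving the edge of its starting point does so through an end of that
   edge, and it is then no shorter than a walk along full edges. *)
Lemma chain_normal x y l e t : chain G x y l -> x = arc G e t -> 0 <= t <= 1 ->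
  (exists t', [/\ 0 <= t' <= 1, y = arc G e t' & len G * `|t - t'| <= l]) \/
  exists b : bool, vreach (arc G e b%:R) y (l - len G * `|t - b%:R|).
Proof.
have L0 := len_gt0 GP.
move=> c; elim: c e t => [u|f s s' u k s01 s'01 c IH] e t E t01.
  by left; exists t; rewrite subrr normr0 mulr0.
have [[t' [t'01 uE h]]|[b h]] := IH _ _ erefl s'01.
  case: (unit_cases s01) => [sI|[b bE]].
    have [<- <-] := arc_interior_eq sI t01 E; left; exists t'; split => //.
    apply: le_trans (_ : len G * (`|s - s'| + `|s' - t'|) <= _); last by lra.
    by rewrite ler_pM2l// ler_distD.
  case: (unit_cases t01) => [tI|[b' b'E]].
    have [eE tE] := arc_interior_eq tI s01 (esym E).
    left; exists t'; rewrite eE tE; split => //.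
    apply: le_trans (_ : len G * (`|s - s'| + `|s' - t'|) <= _); last by lra.
    by rewrite ler_pM2l// ler_distD.
  (* The starting point is a vertex common to [e] and [f]: an empty walk followed by a part of
     [f]. *)
  right; exists b'; rewrite b'E subrr normr0 mulr0 subr0 -b'E -E bE.
  exists 0%N, f, b, t'; split => //; first exact: walk_nil.
  rewrite add0r -bE distrC.
  apply: le_trans (_ : len G * (`|s - s'| + `|s' - t'|) <= _); last by lra.
  by rewrite ler_pM2l// ler_distD.
have key b0 : k - len G * `|s' - b0%:R| <= len G * `|s - s'| + k - len G * `|s - b0%:R|.
  suff : len G * `|s - b0%:R| <= len G * (`|s - s'| + `|s' - b0%:R|) by lra.
  by rewrite ler_pM2l// ler_distD.
case: (unit_cases s01) => [sI|[b1 b1E]].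
  have [<- <-] := arc_interior_eq sI t01 E.
  by right; exists b; apply: vreach_le (key b) h.
case: (unit_cases t01) => [tI|[b' b'E]].
  have [eE tE] := arc_interior_eq tI s01 (esym E).
  by right; exists b; rewrite eE tE; apply: vreach_le (key b) h.
right; exists b'; rewrite b'E subrr normr0 mulr0 subr0 -b'E -E b1E.
have [bb|nb] := eqVneq b b1.
  by rewrite -bb; apply: vreach_le h; have := key b; rewrite b1E bb subrr normr0; lra.
have {nb}bE : b = ~~ b1 by case: b b1 nb {h b1E} => [] [].
case: h => n [f' [b2 [t' [w t'01 uE h]]]]; exists n.+1, f', b2, t'; split => //.
  by apply: walk_cons; rewrite -bE.
have := key b; rewrite b1E bE; have -> : `|b1%:R - (~~ b1)%:R| = 1 :> R.
  by case: (b1); rewrite /= ?subr0 ?sub0r ?normrN normr1.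
rewrite -natr1 => ?; move: h; rewrite bE !mulrDr; lra.
Qed.

Lemma mdist_normal x y r e t : mdist x y < r -> x = arc G e t -> 0 <= t <= 1 ->
  (exists t', [/\ 0 <= t' <= 1, y = arc G e t' & len G * `|t - t'| < r]) \/
  exists b : bool, exists2 l, l < r & vreach (arc G e b%:R) y (l - len G * `|t - b%:R|).
Proof.
move=> /chain_mdist[l c lr] xE t01; case: (chain_normal c xE t01) => [[t' [? ? ?]]|[b h]].
  by left; exists t'; split => //; exact: le_lt_trans lr.
by right; exists b, l.
Qed.

Lemma lipschitz_from_graph (Y : metricType R) (phi : X -> Y) :
  (forall e t t', 0 <= t <= 1 -> 0 <= t' <= 1 ->
     mdist (phi (arc G e t)) (phi (arc G e t')) <= len G * `|t - t'|) ->
  forall x y, mdist (phi x) (phi y) <= mdist x y.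
Proof.
move=> h x y; apply/ler_addgt0Pr => eps eps0.
have /chain_mdist[l c /ltW lr] : mdist x y < mdist x y + eps by lra.
apply: le_trans lr; elim: c => [u|e t t' u k t01 t'01 _ IH]; first by rewrite mdistxx.
apply: le_trans (metric_triangle _ (phi (arc G e t')) _) _.
by apply: lerD => //; exact: h.
Qed.

End MetricGraph.

(** * Measures on graphs *)

Section BorelMetric.
Variables (R : realType) (X : pmetricType R).
Implicit Types (A : set (borel X)).

Lemma borel_open A : open (A : set X) -> measurable A.
Proof. by move=> oA; apply: sub_sigma_algebra. Qed.

Lemma borel_closed A : closed (A : set X) -> measurable A.
Proof. by move=> cA; rewrite -(setCK A); apply: measurableC; apply: borel_open; exact: closed_openC. Qed.

Lemma borel_set1 (x : X) : measurable ([set x] : set (borel X)).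
Proof. by apply: borel_closed; apply: accessible_closed_set1; apply: hausdorff_accessible; exact: metric_hausdorff. Qed.

Lemma open_mball (x : X) r : open (ball x r).
Proof.
rewrite openE => y; rewrite ballEmdist /= => xy.
apply/nbhs_ballP; exists (r - mdist x y) => /=; first by rewrite subr_gt0.
move=> z; rewrite !ballEmdist /= => yz.
by apply: le_lt_trans (metric_triangle _ y _) _; lra.
Qed.

Lemma borel_ball (x : X) r : measurable (ball x r : set (borel X)).
Proof. by apply: borel_open; exact: open_mball. Qed.

Lemma borel_measurable_fun d (T : measurableType d) (phi : T -> borel X) :
  (forall A, open (A : set X) -> measurable (phi @^-1` A)) ->
  measurable_fun [set: T] phi.
Proof.
move=> h; apply: (@measurability _ _ T (borel X) setT phi (@open X)) => //.
by move=> _ [A oA <-]; rewrite setTI; exact: h.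
Qed.

End BorelMetric.

Lemma lipschitz_continuous (R : realType) (Y Z : metricType R) (L : R) (phi : Y -> Z) :
  (forall x y, mdist (phi x) (phi y) <= L * mdist x y) -> continuous phi.
Proof.
move=> h x; apply/metricType_numDomainType.cvgrPdist_lt => eps eps0.
near=> y; apply: le_lt_trans (h _ _) _.
have L0 : 0 < `|L| + 1 by apply: ltr_pwDr.
apply: le_lt_trans (_ : (`|L| + 1) * mdist x y < _).
  by apply: ler_wpM2r; [exact: mdist_ge0|rewrite ler_wpDr// ler_norm].
rewrite mulrC -ltr_pdivlMr//.
near: y; apply/metricType_numDomainType.nbhs_mdistP; exists (eps / (`|L| + 1)) => //=.
by rewrite divr_gt0.
Unshelve. all: by end_near. Qed.

Lemma lipschitz_borel (R : realType) (Y Z : pmetricType R) (L : R) (phi : Y -> Z) :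
  (forall x y, mdist (phi x) (phi y) <= L * mdist x y) ->
  measurable_fun [set: borel Y] (phi : borel Y -> borel Z).
Proof.
move=> h; apply: borel_measurable_fun => A oA; apply: borel_open.
by apply: open_comp => // x _; exact: lipschitz_continuous h x.
Qed.

Section ArcMeasure.
Variables (R : realType) (X : pmetricType R) (G : graph R X).
Variable mu : {measure set (borel X) -> \bar R}.
Hypothesis GP : is_metric_graph G.
Implicit Types (x y z : X) (e f : edge G) (s t : R).

Definition oarc e s t : set (borel X) := arc G e @` `]s, t[.
Definition carc e s t : set (borel X) := arc G e @` `[s, t].
Definition icell e : set (borel X) := oarc e 0 1.
Definition weight e : R := fine (mu (icell e)).

Lemma measurable_carc e s t : 0 <= s -> t <= 1 -> measurable (carc e s t).
Proof.
move=> s0 t1; apply: borel_closed; apply: compact_closed; first exact: metric_hausdorff.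
(* [arc] is arbitrary outside [0, 1]; composed with the projection onto [0, 1] it becomes Lipschitz
   on the whole line, so that compactness of the segment applies. *)
pose clamp u : R := Num.max 0 (Num.min 1 u).
have clampP u : 0 <= clamp u <= 1.
  by rewrite /clamp le_max lexx /= ge_max ler01 ge_min lexx.
have -> : carc e s t = (arc G e \o clamp) @` `[s, t].
  apply/seteqP; split=> x [u /=]; rewrite in_itv /= => /andP[su ut] <-;
    exists u; rewrite /= ?in_itv /= ?su ?ut// /clamp.
    by rewrite min_r ?max_r// ; lra.
  by rewrite min_r ?max_r// ; lra.
have clampE u : [\/ u <= 0 /\ clamp u = 0, 0 <= u <= 1 /\ clamp u = u | 1 <= u /\ clamp u = 1].
  rewrite /clamp; case: (leP 1 u) => u1; first by apply: Or33; rewrite max_r.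
  by case: (leP 0 u) => u0; [apply: Or32|apply: Or31]; split => //; rewrite ?u0 ltW.
have clampB u v : u <= v -> `|clamp u - clamp v| <= `|u - v|.
  move=> uv; rewrite distrC [leRHS]distrC.
  rewrite (ger0_norm (_ : 0 <= v - u)); last by rewrite subr_ge0.
  rewrite ler_norml; move: (clampE u) (clampE v).
  by move=> [[? ->]|[? ->]|[? ->]] [[? ->]|[? ->]|[? ->]]; lra.
apply: continuous_compact; last exact: segment_compact.
apply: continuous_subspaceT.
apply: (@lipschitz_continuous R R^o X (len G)) => u v /=.
apply: le_trans (mdist_arc GP _ (clampP u) (clampP v)) _.
rewrite ler_pM2l ?(len_gt0 GP)// /mdist /=.
by case: (leP u v) => [/clampB //|/ltW/clampB]; rewrite distrC [leRHS]distrC.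
Qed.

Lemma oarcE e s t : 0 <= s -> t <= 1 ->
  oarc e s t = carc e s t `\` [set arc G e s; arc G e t].
Proof.
move=> s0 t1; apply/seteqP; split=> x [].
  move=> u /=; rewrite in_itv /= => /andP[su ut] <-; split.
    by exists u; rewrite //= in_itv /= !ltW.
  have u01 : 0 < u < 1 by lra.
  by case=> /(arc_interior_eq GP u01) []; [lra|move=> _ uE; move: su; rewrite uE ltxx|lra|move=> _ uE; move: ut; rewrite uE ltxx].
move=> [u /=]; rewrite in_itv /= => /andP[su ut] <- /not_orP [ns nt].
exists u => //=; rewrite in_itv /= !lt_neqAle su ut !andbT.
by apply/andP; split; apply/eqP => uE; [apply: ns|apply: nt]; rewrite uE.
Qed.

Lemma measurable_oarc e s t : 0 <= s -> t <= 1 -> measurable (oarc e s t).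
Proof.
move=> s0 t1; rewrite oarcE//; apply: measurableD; first exact: measurable_carc.
by apply: measurableU; exact: borel_set1.
Qed.

Lemma measurable_icell e : measurable (icell e).
Proof. exact: measurable_oarc. Qed.

Lemma cellE e : cell e = carc e 0 1. Proof. by []. Qed.

Lemma arc_cell e t : 0 <= t <= 1 -> cell e (arc G e t).
Proof. by move=> t01; exists t => //=; rewrite in_itv. Qed.

Lemma cell_arc e x : cell e x -> exists2 t, 0 <= t <= 1 & x = arc G e t.
Proof. by case=> t /=; rewrite in_itv /= => t01 <-; exists t. Qed.

Lemma oarc_cell e s t : 0 <= s -> t <= 1 -> oarc e s t `<=` cell e.
Proof.
move=> s0 t1 x [u /=]; rewrite in_itv /= => /andP[su ut] <-; apply: arc_cell.
by rewrite (le_trans s0 (ltW su)) (le_trans (ltW ut) t1).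
Qed.

(** Besides [t], only the parameters 0 and 1 can be mapped to the same point (when the edge is a
    loop), so a finite set of parameters is measured. *)
Lemma mu_point e t : multiple_of_arclength G mu -> 0 <= t <= 1 -> mu [set arc G e t] = 0%E.
Proof.
move=> muP t01; have [c c0 ->] := muP e; last 2 first.
- exact: borel_set1.
- by move=> x ->; exact: arc_cell.
rewrite /arclength countable_lebesgue_measure0 ?mule0//.
apply: (@sub_countable _ _ _ [set t; 0; 1]); last first.
  by apply: finite_set_countable; rewrite !finite_setU; repeat split; exact: finite_set1.
apply: subset_card_le => u /= [u01 E].
case: (unit_cases u01) => [uI|[[] ->]]; [|by right|by left; right].
by left; left; have [_ ->] := arc_interior_eq GP uI t01 E.
Qed.

Lemma density e : multiple_of_arclength G mu -> exists2 c : R, 0 <= c &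
  forall s t, 0 <= s -> s <= t -> t <= 1 -> mu (oarc e s t) = (c * (t - s))%:E.
Proof.
move=> muP; have [c c0 cE] := muP e; exists (c * len G); first by rewrite mulr_ge0// ltW// (len_gt0 GP).
move=> s t s0 st t1; rewrite cE; [|exact: measurable_oarc|exact: oarc_cell].
rewrite /arclength.
have -> : [set u : R | 0 <= u <= 1 /\ oarc e s t (arc G e u)] = [set` `]s, t[].
  apply/seteqP; split=> u /=.
    move=> [u01 [v /=]]; rewrite !in_itv /= => vP E.
    have vI : 0 < v < 1 by lra.
    by have [_ <-] := arc_interior_eq GP vI u01 E.
  rewrite in_itv /= => uP; split; first by lra.
  by exists u.
rewrite lebesgue_measure_itv /= lte_fin; case: ltP => [h|h].
  by rewrite -!EFinM; congr EFin; ring.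
have -> : t - s = 0 by apply/eqP; rewrite subr_eq0 eq_le h st.
by rewrite mulr0 !mule0.
Qed.

Lemma weight_ge0 e : 0 <= weight e.
Proof. by rewrite /weight fine_ge0. Qed.

(** The form in which proportionality to arclength is used: it passes directly to subdivisions and
    includes the finiteness of the measure on edges. *)
Definition uniform_on_arcs :=
  (forall e s t, 0 <= s -> s <= t -> t <= 1 ->
     mu (oarc e s t) = (weight e * (t - s))%:E) /\
  (forall e t, 0 <= t <= 1 -> mu [set arc G e t] = 0%E).

Lemma arclength_uniform : multiple_of_arclength G mu -> uniform_on_arcs.
Proof.
move=> muP; split=> [e s t s0 st t1|e t]; last exact: mu_point.
have [c c0 cE] := density e muP.
rewrite /weight /icell !cE// ?ler01//=; congr (_ %:E); ring.
Qed.

Hypothesis muU : uniform_on_arcs.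

Lemma mu_icell e : mu (icell e) = (weight e)%:E.
Proof. by rewrite /icell muU.1// ?ler01// subr0 mulr1. Qed.

Lemma mu_carc e s t : 0 <= s -> s <= t -> t <= 1 ->
  mu (carc e s t) = (weight e * (t - s))%:E.
Proof.
move=> s0 st t1; rewrite -muU.1// oarcE//.
have P u : 0 <= u <= 1 -> mu [set arc G e u] = 0%E by exact: muU.2.
have m1 u : measurable [set arc G e u : borel X] by exact: borel_set1.
have n0 : mu ([set arc G e s] `|` [set arc G e t]) = 0%E.
  by apply: null_set_setU => //; apply: P; lra.
rewrite (measureDI mu (measurable_carc e s0 t1) (measurableU _ _ (m1 s) (m1 t))).
set I := (X in (_ + mu X)%E); suff -> : mu I = 0%E by rewrite adde0.
apply: (subset_measure0 _ _ _ n0); [|exact: measurableU|exact: subIsetr].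
by apply: measurableI; [exact: measurable_carc|exact: measurableU].
Qed.

Lemma mu_cell e : mu (cell e) = (weight e)%:E.
Proof. by rewrite cellE mu_carc// ?ler01// subr0 mulr1. Qed.

Lemma icell_inj e f x : icell e x -> cell f x -> e = f.
Proof.
by move=> [t /=]; rewrite in_itv /= => tI <- /cell_arc[s s01 /(arc_interior_eq GP tI s01)[]].
Qed.

End ArcMeasure.

(** * Neighbourhoods of edges *)

Section Tame.
Variables (R : realType) (X : pmetricType R) (G : graph R X).
Variable mu : {measure set (borel X) -> \bar R}.
Variables (B : nat) (C : R).
Local Notation E := {classic edge G}.

(** The part of admissibility that concerns a single graph, in a form inherited by subdivisions.
    With [1 <= C] the powers of [C] in later bounds are monotone. *)
Record tame : Prop := {
  tame_graph : is_metric_graph G ;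
  tame_arc : uniform_on_arcs G mu ;
  tame_finite : forall e : edge G, exists s : seq E,
    (size s <= B)%N /\ forall f : E, adjacent e f -> f \in s ;
  tame_adjacent : forall e f : edge G,
    adjacent e f -> weight mu e <= C * weight mu f ;
  tame_ge1 : 1 <= C }.

Hypothesis GT : tame.
Let GP := tame_graph GT.
Implicit Types (e f g : edge G) (n : nat).

(** Distance at most [n] in the adjacency graph of the edges: adjacency is reflexive, so shorter
    chains are included. *)
Fixpoint near n e f : Prop :=
  if n is n'.+1 then exists2 g, near n' e g & adjacent g f else e = f.

Lemma adjacent_refl e : adjacent e e.
Proof. by exists (arc G e 0); left. Qed.

Lemma adjacent_sym e f : adjacent e f -> adjacent f e.
Proof. by case=> v ? ?; exists v. Qed.

Lemma near_S n e f : near n e f -> near n.+1 e f.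
Proof. by move=> h; exists f => //; exact: adjacent_refl. Qed.

Lemma near_le n n' e f : (n <= n')%N -> near n e f -> near n' e f.
Proof. by move=> /subnK <-; elim: (n' - n)%N => // k IH /IH; exact: near_S. Qed.

Lemma near_refl n e : near n e e.
Proof. exact: (@near_le 0). Qed.

Lemma near_add n n' e f g : near n e f -> near n' f g -> near (n' + n) e g.
Proof.
move=> h; elim: n' g => [g <-//|n' IH g [k /IH ? ?]].
by exists k.
Qed.

Lemma near_adj e f : adjacent e f -> near 1 e f.
Proof. by exists e. Qed.

Lemma near_sym n e f : near n e f -> near n f e.
Proof.
elim: n f => [//|n IH f [g /IH h /adjacent_sym/near_adj gf]].
by rewrite -addn1; exact: near_add gf h.
Qed.

Lemma nbh_ex n e : exists s : seq E,
  [/\ uniq s, (size s <= B ^ n)%N & forall f : E, f \in s <-> near n e f].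
Proof.
elim: n => [|n [s [us ss sP]]].
  by exists [:: (e : E)]; split => // f; rewrite inE; split => [/eqP|<-].
have /choice[adj adjP] := tame_finite GT.
exists (undup [seq f : E <- flatten [seq (adj g : seq E) | g : E <- s] | `[< near n.+1 e f >]]).
split; first exact: undup_uniq.
  apply: leq_trans (size_undup _) _; rewrite size_filter.
  apply: leq_trans (count_size _ _) _.
  rewrite size_flatten /shape -map_comp sumnE big_map expnSr.
  apply: leq_trans (_ : \sum_(g <- s) B <= _)%N.
    by apply: leq_sum => g _; have [] := adjP g.
  by rewrite big_const_seq iter_addn_0 count_predT mulnC leq_mul.
move=> f; rewrite mem_undup mem_filter; split => [/andP[/asboolP//]|h].
rewrite asboolT//=; case: h => g /sP gs gf.
apply/flattenP; exists (adj g); first exact: map_f.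
by have [_] := adjP g; exact.
Qed.

Definition nbh n e : seq E := sval (cid (nbh_ex n e)).

Lemma nbhP n e (f : E) : f \in nbh n e <-> near n e f.
Proof. by rewrite /nbh; case: cid => s [/= _ _]. Qed.

Lemma nbh_uniq n e : uniq (nbh n e).
Proof. by rewrite /nbh; case: cid => s []. Qed.

Lemma nbh_size n e : (size (nbh n e) <= B ^ n)%N.
Proof. by rewrite /nbh; case: cid => s []. Qed.

Let C0 : 0 < C. Proof. exact: lt_le_trans ltr01 (tame_ge1 GT). Qed.

Lemma weight_near n e f : near n e f -> weight mu e <= C ^+ n * weight mu f.
Proof.
elim: n f => [f ->|n IH f [g /IH h /(tame_adjacent GT) k]]; first by rewrite expr0 mul1r.
apply: le_trans h _; rewrite exprSr -mulrA ler_wpM2l// exprn_ge0//.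
by rewrite ltW.
Qed.

Lemma incident_cell e v : incident v e -> cell e v.
Proof. by case=> <-; apply: arc_cell; lra. Qed.

Lemma incident_end e (b : bool) : incident (arc G e b%:R) e.
Proof. by case: b; [right|left]. Qed.

Lemma incidentP e v : incident v e -> exists b : bool, v = arc G e b%:R.
Proof. by case=> <-; [exists false|exists true]. Qed.

Lemma cell_adjacent e f x : cell e x -> cell f x -> adjacent e f.
Proof.
move=> /cell_arc[t t01 ->] /cell_arc[s s01].
case: (unit_cases t01) => [tI|[b ->]].
  by move=> /(arc_interior_eq GP tI s01)[-> _]; exact: adjacent_refl.
case: (unit_cases s01) => [sI|[b' ->]] h.
  have [-> _] := arc_interior_eq GP sI (end_in R b) (esym h).
  exact: adjacent_refl.
exists (arc G e b%:R); first exact: incident_end.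
by rewrite h; exact: incident_end.
Qed.

Lemma walk_near n v w e f :
  walk G n v w -> incident v e -> incident w f -> near n.+1 e f.
Proof.
move=> wk; elim: wk e => [x|k g b y wk IH] e eP fP; first by apply: near_adj; exists x.
have h : near 1 e g by apply: near_adj; exists (arc G g b%:R) => //; exact: incident_end.
by have := near_add h (IH _ (incident_end g (~~ b)) fP); rewrite addn1.
Qed.

(** In normal form the path leaves [e] and walks along fewer than [n] full edges; one adjacency step
    leads from [e] to the walk, and one from its last edge to [f], which shares the point [y]. *)
Lemma mdist_near n e f x y :
  cell e x -> cell f y -> mdist x y < n%:R * len G -> near n.+1 e f.
Proof.
move=> /cell_arc[t t01 xE] yf d; have L0 := len_gt0 GP.
case: (mdist_normal GP d xE t01) => [[t' [t'01 yE _]]|[b [l ln [k [e' [b' [u [wk u01 yE h]]]]]]]].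
  apply: (@near_le 1) => //; apply: near_adj; apply: cell_adjacent yf.
  by rewrite yE; exact: arc_cell.
have kn : (k < n)%N.
  rewrite -(ltr_nat R) -(ltr_pM2r L0); apply: le_lt_trans ln.
  have : 0 <= len G * `|t - b%:R| by rewrite mulr_ge0// ltW.
  have : 0 <= len G * `|u - b'%:R| by rewrite mulr_ge0// ltW.
  by rewrite mulrDr in h; move=> ? ?; lra.
have h1 := walk_near wk (incident_end e b) (incident_end e' b').
apply: (@near_le k.+2) => //; exists e' => //.
by apply: cell_adjacent yf; rewrite yE; exact: arc_cell.
Qed.

Lemma near_mdist n e f x y :
  near n e f -> cell e x -> cell f y -> mdist x y <= n.+1%:R * len G.
Proof.
have L0 := len_gt0 GP.
have same g u v : cell g u -> cell g v -> mdist u v <= len G.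
  move=> /cell_arc[t t01 ->] /cell_arc[s s01 ->].
  apply: le_trans (mdist_arc GP _ t01 s01) _.
  by rewrite ler_piMr ?(ltW L0)// ler_norml; lra.
elim: n f y => [f y <- ex ey|n IH f y [g eg [v vg vf]] ex fy].
  by rewrite mul1r; exact: same ex ey.
apply: le_trans (metric_triangle _ v _) _; rewrite -[n.+2]addn1 natrD mulrDl mul1r.
apply: lerD; first by apply: IH eg ex _; exact: incident_cell.
by apply: same fy; exact: incident_cell.
Qed.

Lemma near_connected e f : exists n, near n e f.
Proof.
have L0 := len_gt0 GP.
pose x := arc G e 0; pose y := arc G f 0.
exists (Num.truncn (mdist x y / len G)).+2; apply: (@mdist_near _ _ _ x y).
- by apply: arc_cell; lra.
- by apply: arc_cell; lra.
- by rewrite -ltr_pdivrMr// truncnS_gt.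
Qed.

(** Any two edges are joined by a chain of adjacent edges because distances are finite. So averages
    with respect to weights are undefined only if the measure of every edge is zero. *)
Lemma weight_eq0 e f : weight mu e = 0 -> weight mu f = 0.
Proof.
have [n nf] := near_connected f e; move=> e0.
apply/eqP; rewrite eq_le weight_ge0 andbT.
by apply: le_trans (weight_near nf) _; rewrite e0 mulr0.
Qed.

End Tame.

(** * Subdivision *)

Section Subdivision.
Variables (R : realType) (X : pmetricType R) (G : graph R X) (m : nat).
Hypothesis m_gt0 : (0 < m)%N.
Let Sub := subdivide G m.
Implicit Types (e f : edge G) (s t : R) (i j : 'I_m).

Let M0 : 0 < m%:R :> R. Proof. by rewrite ltr0n. Qed.

Definition sub_edge e j : edge Sub := (e, j).

Lemma arc_sub e j t : arc Sub (sub_edge e j) t = arc G e ((j%:R + t) / m%:R).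
Proof. by []. Qed.

Lemma sub_param j t : 0 <= t <= 1 -> 0 <= (j%:R + t) / m%:R <= 1.
Proof.
move=> t01; have jm : j%:R + 1 <= m%:R :> R by rewrite natr1 ler_nat.
have j0 : 0 <= j%:R :> R by [].
by rewrite divr_ge0 ?ler_pdivrMr ?mul1r //=; lra.
Qed.

Lemma sub_paramI j t : 0 < t < 1 -> 0 < (j%:R + t) / m%:R < 1.
Proof.
move=> t01; have jm : j%:R + 1 <= m%:R :> R by rewrite natr1 ler_nat.
have j0 : 0 <= j%:R :> R by [].
by rewrite divr_gt0 ?ltr_pdivrMr ?mul1r //=; lra.
Qed.

Lemma sub_cell t : 0 <= t <= 1 -> exists j, j%:R <= t * m%:R <= j%:R + 1.
Proof.
(* For [t = 1] the integer part of [t * m] is [m], which is not the index of a piece; the last piece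
   is taken instead. *)
case/andP=> t0 t1; have [->|tn1] := eqVneq t 1.
  have h : (m.-1 < m)%N by rewrite prednK.
  by exists (Ordinal h); rewrite /= mul1r natr1 prednK// ler_nat leq_pred lexx.
have tm0 : 0 <= t * m%:R by rewrite mulr_ge0// ltW.
have h : (Num.truncn (t * m%:R) < m)%N.
  rewrite -(ltr_nat R); have /andP[/le_lt_trans + _] := truncn_itv tm0; apply.
  by rewrite gtr_pMl// lt_neqAle tn1.
exists (Ordinal h) => /=; rewrite truncn_le tm0/= natr1; exact: ltW (truncnS_gt _).
Qed.

Lemma sub_arc e j t : arc G e t = arc Sub (sub_edge e j) (t * m%:R - j%:R).
Proof. by rewrite arc_sub addrC subrK mulfK// gt_eqF. Qed.

Lemma chain_sub_segment e t t' : 0 <= t <= 1 -> 0 <= t' <= 1 ->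
  chain Sub (arc G e t) (arc G e t') (len G * `|t - t'|).
Proof.
have same j s s' : j%:R <= s * m%:R <= j%:R + 1 -> j%:R <= s' * m%:R <= j%:R + 1 ->
    chain Sub (arc G e s) (arc G e s') (len G * `|s - s'|).
  move=> sj s'j; rewrite !(sub_arc e j).
  have -> : len G * `|s - s'| = len Sub * `|(s * m%:R - j%:R) - (s' * m%:R - j%:R)|.
    have -> : (s * m%:R - j%:R) - (s' * m%:R - j%:R) = (s - s') * m%:R by ring.
    by rewrite normrM (gtr0_norm M0) /=; field; rewrite gt_eqF.
  by apply: chain_arc; lra.
(* Induction on the number of division points separating the two pieces; [u] is the right end of the
   piece of [s]. *)
have up n : forall i j s s', j = (i + n)%N :> nat -> i%:R <= s * m%:R <= i%:R + 1 ->
    j%:R <= s' * m%:R <= j%:R + 1 -> s <= s' ->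
    chain Sub (arc G e s) (arc G e s') (len G * `|s - s'|).
  elim: n => [|n IH] i j s s' ij si s'j ss.
    by apply: (same i) => //; move: s'j; rewrite ij addn0.
  have h : (i.+1 < m)%N by apply: leq_ltn_trans (ltn_ord j); rewrite ij addnS ltnS leq_addr.
  pose u : R := i.+1%:R / m%:R.
  have um : u * m%:R = i%:R + 1 by rewrite /u divfK ?gt_eqF// natr1.
  have su : s <= u by rewrite -(ler_pM2r M0) um; lra.
  have us' : u <= s'.
    rewrite -(ler_pM2r M0) um; apply: le_trans (andP s'j).1.
    by rewrite natr1 ler_nat ij addnS ltnS leq_addr.
  have -> : len G * `|s - s'| = len G * `|s - u| + len G * `|u - s'|.
    by rewrite (ler0_norm (_ : s - s' <= 0)) ?(ler0_norm (_ : s - u <= 0)) ?(ler0_norm (_ : u - s' <= 0)); lra.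
  apply: (chain_cat (y := arc G e u)); first by apply: (same i) => //; lra.
  apply: (IH (Ordinal h) j) => //=; first by rewrite ij addnS.
  by rewrite um natr1 lexx -natr1; lra.
move=> t01 t'01; wlog tt : t t' t01 t'01 / t <= t' => [H|].
  case: (leP t t') => [|/ltW] h; first exact: H.
  by apply: chain_sym; rewrite distrC; exact: H.
have [[i iP] [j jP]] := (sub_cell t01, sub_cell t'01).
case: (leqP i j) => ij; first by apply: (up (j - i)%N i j) => //; rewrite subnKC.
(* With [j < i], the parameters coincide at a division point shared by the two pieces. *)
apply: (same i) => //; have {}ij : j%:R + 1 <= i%:R :> R by rewrite natr1 ler_nat.
have : t * m%:R <= t' * m%:R by rewrite ler_pM2r.
by lra.
Qed.

Lemma chain_sub x y l : chain Sub x y l <-> chain G x y l.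
Proof.
split=> c; elim: c => [u|e t t' u k t01 t'01 _ IH]; try exact: chain_nil.
  have -> : len Sub * `|t - t'| + k =
      len G * `|(e.2%:R + t) / m%:R - (e.2%:R + t') / m%:R| + k.
    have -> : (e.2%:R + t) / m%:R - (e.2%:R + t') / m%:R = (t - t') / m%:R.
      by field; rewrite gt_eqF.
    by rewrite normrM normfV (gtr0_norm M0) /=; field; rewrite gt_eqF.
  by apply: chain_cons => //; exact: sub_param.
by apply: chain_cat IH; exact: chain_sub_segment.
Qed.

Lemma sub_nat_eq (i j : nat) s t : 0 < s < 1 -> 0 <= t < 1 -> i%:R + s = j%:R + t -> i = j.
Proof.
move=> sP tP E; case: (ltngtP i j) => // ij; exfalso.
  by have : i%:R + 1 <= j%:R :> R; [rewrite natr1 ler_nat|lra].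
by have : j%:R + 1 <= i%:R :> R; [rewrite natr1 ler_nat|lra].
Qed.

Lemma sub_metric_graph : is_metric_graph G -> is_metric_graph Sub.
Proof.
move=> GP; have sub01 (k : nat) : (k <= m)%N -> 0 <= (k%:R / m%:R : R) <= 1.
  by move=> km; rewrite divr_ge0 ?ler_pdivrMr ?mul1r ?ler_nat// ltW.
have divI a b : a / m%:R = b / m%:R -> a = b :> R.
  by move=> /(congr1 (fun z => z * m%:R)); rewrite !divfK// gt_eqF.
split => [|[e j]|[e j] t t01|[e j] [e' j'] t t' t01 t'01 E|x|x y].
- by rewrite /= divr_gt0// (len_gt0 GP).
- split; right; exists e; [exists j|exists j.+1].
    by rewrite (ltnW (ltn_ord j)) /= addr0.
  by rewrite ltn_ord /= natr1.
- case=> [|[e' [k [km]]]] /=; first exact: (arc_interior GP (sub_paramI j t01)).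
  move/(arc_interior_eq GP (sub_paramI j t01) (sub01 _ km)) => [_ /divI] h.
  have jk : j = k :> nat by apply: (@sub_nat_eq _ _ t 0); rewrite ?addr0//; lra.
  by move: h; rewrite jk; lra.
- have [/= -> /divI h] := arc_inj GP (sub_paramI j t01) (sub_paramI j' t'01) E.
  have jj : j = j' :> nat by apply: sub_nat_eq h => //; lra.
  split; first by congr pair; exact: val_inj.
  by move: h; rewrite jj; lra.
- have [|[e [t [t01 ->]]]] := arc_cover GP x; first by left; left.
  have [|j /andP[j1 j2]] := @sub_cell t; first by lra.
  have [E|n1] := eqVneq (t * m%:R) j%:R.
    left; right; exists e, j; split; first exact: ltnW.
    by rewrite -E mulfK// gt_eqF.
  have [E|n2] := eqVneq (t * m%:R) (j%:R + 1).
    left; right; exists e, j.+1; split=> //.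
    by rewrite -natr1 -E mulfK// gt_eqF.
  right; exists (sub_edge e j), (t * m%:R - j%:R); split; last exact: sub_arc.
  have ? : j%:R < t * m%:R by rewrite lt_neqAle eq_sym n1.
  have ? : t * m%:R < j%:R + 1 by rewrite lt_neqAle n2.
  by lra.
- rewrite (path_metric GP); congr ereal_inf; apply/seteqP.
  by split=> _ [l /chain_sub c <-]; exists l.
Qed.

Lemma oarc_sub e j s t :
  oarc (G := Sub) (sub_edge e j) s t = oarc e ((j%:R + s) / m%:R) ((j%:R + t) / m%:R).
Proof.
apply/seteqP; split=> x [u /=]; rewrite in_itv /= => /andP[su ut] <-.
  exists ((j%:R + u) / m%:R) => //=; rewrite in_itv /=.
  by rewrite !ltr_pM2r ?invr_gt0// !ltrD2l su.
exists (u * m%:R - j%:R); last by rewrite -sub_arc.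
move: su ut; rewrite ltr_pdivrMr// ltr_pdivlMr// => su ut.
by rewrite /= in_itv /=; lra.
Qed.

Lemma cell_sub e j : cell (G := Sub) (sub_edge e j) `<=` cell e.
Proof.
move=> x /cell_arc[u /(sub_param j) h ->]; exact: arc_cell h.
Qed.

Variables (mu : {measure set (borel X) -> \bar R}) (B : nat) (C : R).
Hypothesis GT : tame G mu B C.
Let GP := tame_graph GT.

Lemma weight_sub e j : weight mu (sub_edge e j) = weight mu e / m%:R.
Proof.
rewrite {1}/weight /icell oarc_sub (tame_arc GT).1.
- by rewrite /= addr0; field; rewrite gt_eqF.
- by have /andP[] : 0 <= (j%:R + 0 : R) / m%:R <= 1 by apply: sub_param; lra.
- by rewrite ler_pM2r ?invr_gt0// lerD2l.
- by have /andP[] : 0 <= (j%:R + 1 : R) / m%:R <= 1 by apply: sub_param; lra.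
Qed.

Lemma sub_uniform : uniform_on_arcs Sub mu.
Proof.
split=> [[e j] s t s0 st t1|[e j] t t01]; last first.
  by apply: (tame_arc GT).2; exact: sub_param.
rewrite oarc_sub (tame_arc GT).1.
- by rewrite (weight_sub e j); congr EFin; field; rewrite gt_eqF.
- by have /andP[] : 0 <= (j%:R + s : R) / m%:R <= 1 by apply: sub_param; lra.
- by rewrite ler_pM2r ?invr_gt0// lerD2l.
- by have /andP[] : 0 <= (j%:R + t : R) / m%:R <= 1 by apply: sub_param; lra.
Qed.

Lemma sub_adjacent (p q : edge Sub) : adjacent p q -> adjacent p.1 q.1.
Proof.
case: p q => [e i] [f j] [v ve vf] /=.
apply: (@cell_adjacent _ _ _ _ _ _ GT _ _ v).
  by apply: (cell_sub (j := i)); exact: incident_cell.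
by apply: (cell_sub (j := j)); exact: incident_cell.
Qed.

Lemma sub_near n (p q : edge Sub) : near n p q -> near n p.1 q.1.
Proof.
elim: n q => [q -> //|n IH q [g /IH ? /sub_adjacent ?]].
by exists g.1.
Qed.

(** All weights are divided by [m], so their ratios are unchanged; a piece is adjacent only to
    pieces of edges adjacent to its own edge, and each of these has [m] pieces. *)
Lemma sub_tame : tame Sub mu (B * m) C.
Proof.
split; first exact: sub_metric_graph.
- exact: sub_uniform.
- move=> [e i]; have [s [ss sP]] := tame_finite GT e.
  exists [seq ((f, j) : {classic edge Sub}) | f : {classic edge G} <- s, j <- enum 'I_m].
  rewrite size_allpairs size_enum_ord leq_mul2r ss orbT; split=> // -[f j] h.
  by apply: allpairs_f; [apply: sP; exact: (sub_adjacent h)|rewrite mem_enum].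
- move=> [e i] [f j] /sub_adjacent /(tame_adjacent GT) h.
  by rewrite (weight_sub e i) (weight_sub f j) mulrA ler_pM2r// invr_gt0.
- exact: tame_ge1 GT.
Qed.

(** When there are at least two pieces, one end of each piece is interior to the original edge and
    therefore differs from the other end. *)
Lemma sub_noloop (p : edge Sub) : (1 < m)%N -> arc Sub p 0 <> arc Sub p 1.
Proof.
case: p => e j m1; rewrite !(arc_sub e j) => E.
have [j0|j0] := posnP j.
  have u01 : 0 < ((j%:R + 1) / m%:R : R) < 1.
    by rewrite j0 add0r mul1r invr_gt0 M0 invf_lt1// ltr1n.
  have [] := arc_interior_eq GP u01 _ (esym E); rewrite ?j0 ?addr0 ?mul0r ?lexx ?ler01//.
  by move=> _ h; move: u01; rewrite j0 h ltxx.
have u01 : 0 < ((j%:R + 0) / m%:R : R) < 1.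
  by rewrite addr0 divr_gt0 ?ltr0n//= ltr_pdivrMr// mul1r ltr_nat.
have [] := arc_interior_eq GP u01 _ E; first by apply: sub_param; lra.
move=> _ /(congr1 (fun z => z * m%:R)); rewrite !divfK ?gt_eqF//; lra.
Qed.

End Subdivision.

(** * Finite sums of extended reals *)

Section ExtendedSums.
Variables (R : realType) (I : eqType).
Implicit Types (s t : seq I) (H : I -> \bar R).
Local Open Scope ereal_scope.

Lemma lee_sum_mem s H H' : (forall i, i \in s -> H i <= H' i) ->
  \sum_(i <- s) H i <= \sum_(i <- s) H' i.
Proof. by move=> h; rewrite big_seq [leRHS]big_seq; apply: lee_sum. Qed.

Lemma sum_filter_mem s t H : uniq s -> uniq t -> {subset s <= t} ->
  \sum_(i <- s) H i = \sum_(i <- t | i \in s) H i.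
Proof.
move=> us ut st; rewrite -[RHS]big_filter; apply: perm_big.
apply: uniq_perm; rewrite ?filter_uniq// => i; rewrite mem_filter.
by case: (boolP (i \in s)) => // /st ->.
Qed.

Lemma sum_subset s t H : uniq s -> uniq t -> {subset s <= t} ->
  (forall i, 0 <= H i) -> \sum_(i <- s) H i <= \sum_(i <- t) H i.
Proof.
by move=> us ut st H0; rewrite (sum_filter_mem H us ut st); exact: lee_sum_nneg_subset.
Qed.

Lemma sum_const s (c : \bar R) : 0 <= c -> \sum_(i <- s) c = (size s)%:R%:E * c.
Proof.
move=> c0; elim: s => [|i s IH]; first by rewrite big_nil mul0e.
by rewrite big_cons IH /= -natr1 EFinD ge0_muleDl ?lee_fin// mul1e addeC.
Qed.

(** Double counting: by the symmetry of [nb], the term at [j] occurs at most [size (nb j)] times.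
    Applied to neighbourhoods of edges. *)
Lemma sum_overlap s t (nb : I -> seq I) (K : nat) H :
  uniq s -> uniq t -> (forall i, uniq (nb i)) ->
  (forall i j, i \in s -> j \in nb i -> j \in t) ->
  (forall i j, j \in nb i -> i \in nb j) ->
  (forall i, (size (nb i) <= K)%N) -> (forall i, 0 <= H i) ->
  \sum_(i <- s) \sum_(j <- nb i) H j <= K%:R%:E * \sum_(j <- t) H j.
Proof.
move=> us ut unb st sym sz H0.
have -> : \sum_(i <- s) \sum_(j <- nb i) H j =
    \sum_(j <- t) \sum_(i <- s | j \in nb i) H j.
  rewrite [RHS](exchange_big_dep xpredT) //= big_seq [RHS]big_seq.
  by apply: eq_bigr => i si; rewrite (sum_filter_mem H (unb i) ut)// => j; exact: st.
rewrite ge0_sume_distrr//; apply: lee_sum => j _.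
rewrite -big_filter sum_const//; apply: lee_wpmul2r => //.
rewrite lee_fin ler_nat; apply: leq_trans (sz j); apply: uniq_leq_size.
  exact: filter_uniq.
by move=> i; rewrite mem_filter => /andP[/sym].
Qed.

End ExtendedSums.

(** * Approximation by functions on vertices *)

Section Mass.
Variables (R : realType) (d : measure_display) (Om : measurableType d).
Variables (P : {measure set Om -> \bar R}) (F : Om -> R) (g : Om -> \bar R).
Hypothesis mF : measurable_fun setT F.
Hypothesis mg : measurable_fun setT g.
Hypothesis g0 : forall z, (0 <= g z)%E.

Definition pushes (X : pmetricType R) (mu : {measure set (borel X) -> \bar R})
    (Q : Om -> X) :=
  measurable_fun setT (Q : Om -> borel X) /\
  forall A : set (borel X), measurable A -> P (Q @^-1` A) = mu A.

(** Integration takes place on [Om] for every graph, so that quantities at different levels add up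
    under subdivision and projection. *)
Definition mass (X : pmetricType R) (G : graph R X) (Q : Om -> X)
    (phi : Om -> \bar R) (e : edge G) : \bar R :=
  \int[P]_(z in Q @^-1` (icell e)) phi z.

Definition dev (c : R) (z : Om) : \bar R := (`|F z - c|)%:E.

Lemma dev_ge0 c z : (0 <= dev c z)%E.
Proof. by rewrite lee_fin. Qed.

Lemma measurable_dev c : measurable_fun setT (dev c).
Proof.
apply/measurable_EFinP; apply: (@measurableT_comp _ _ _ _ _ _ (@Num.norm R R)) => //.
by apply: measurable_funB.
Qed.

Section OneSpace.
Variables (X : pmetricType R) (G : graph R X) (mu : {measure set (borel X) -> \bar R}).
Variables (B : nat) (C : R) (Q : Om -> X).
Hypothesis GT : tame G mu B C.
Hypothesis QP : pushes mu Q.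
Let GP := tame_graph GT.

Lemma measurable_pre (A : set (borel X)) : measurable A -> measurable (Q @^-1` A).
Proof. by move=> mA; rewrite -[X in measurable X]setTI; exact: QP.1. Qed.

Lemma measurable_pre_icell e : measurable (Q @^-1` (icell (G := G) e)).
Proof. by apply: measurable_pre; exact: measurable_icell. Qed.

Lemma mass_ge0 phi e : (forall z, 0 <= phi z)%E -> (0 <= mass (G := G) Q phi e)%E.
Proof. by move=> h; apply: integral_ge0. Qed.

Lemma mass_cst c e : mass (G := G) Q (cst c%:E) e = (c * weight mu e)%:E.
Proof.
rewrite /mass integral_cst; last exact: measurable_pre_icell.
rewrite QP.2; last exact: measurable_icell.
by rewrite (mu_icell (tame_arc GT)).
Qed.

Lemma mass_dev c c' e :
  (mass (G := G) Q (dev c) e <= mass Q (dev c') e + (weight mu e * `|c' - c|)%:E)%E.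
Proof.
have mD := measurable_pre_icell e.
have md a : measurable_fun (Q @^-1` icell (G := G) e) (dev a).
  by apply: measurable_funS (measurable_dev a).
rewrite mulrC -(mass_cst _ e) /mass -ge0_integralD//; last first.
- by move=> z _; rewrite lee_fin.
- by move=> z _; exact: dev_ge0.
apply: ge0_le_integral => //; first by move=> z _; exact: dev_ge0.
  by apply: emeasurable_funD.
move=> z _; rewrite /dev -EFinD lee_fin.
by rewrite (_ : F z - c = (F z - c') + (c' - c)) ?ler_normD//; ring.
Qed.

(** Open edges are pairwise disjoint but miss the vertices; the points they fail to cover go into
    the null set [N]. *)
Lemma integral_bigcells (s : seq {classic edge G}) (A : set (borel X)) phi :
  uniq s -> measurable A -> measurable_fun setT phi -> (forall z, 0 <= phi z)%E ->
  (forall e : {classic edge G}, e \in s -> icell (G := G) e `<=` A) ->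
  (exists2 N : set (borel X), measurable N /\ mu N = 0%E &
     forall x, A x -> ~ N x -> exists2 e : {classic edge G}, e \in s & icell (G := G) e x) ->
  (\int[P]_(z in Q @^-1` A) phi z = \sum_(e <- s) mass (G := G) Q phi e)%E.
Proof.
move=> us mA mphi phi0 sA [N [mN N0] AN].
pose Fe (e : {classic edge G}) : set Om := Q @^-1` (icell (G := G) e).
pose D := \big[setU/set0]_(e <- s) Fe e.
have mFe e : measurable (Fe e) by exact: measurable_pre_icell.
have mD : measurable D by exact: bigsetU_measurable.
have DP z : D z <-> exists2 e : {classic edge G}, e \in s & Fe e z.
  by rewrite /D -bigcup_seq; split=> -[e es h]; exists e.
have tD : trivIset [set` s] Fe.
  by move=> e f _ _ [z [ze zf]]; apply: (icell_inj GP ze); exact: oarc_cell zf.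
rewrite /mass -ge0_integral_bigsetU//; last exact: measurable_funTS.
have mQA := measurable_pre mA.
have DA : D `<=` Q @^-1` A by move=> z /DP[e /sA h /h].
rewrite -/D (_ : Q @^-1` A = D `|` (Q @^-1` A `\` D)); last first.
  by rewrite setDUK.
have mDD : measurable (Q @^-1` A `\` D) by exact: measurableD.
rewrite ge0_integral_setU//; last 2 first.
- exact: measurable_funTS.
- by rewrite disj_set2E; apply/eqP; rewrite setIDA -subset0 => z [[]].
rewrite [X in (_ + X)%E](_ : _ = 0%E) ?adde0//.
apply: null_set_integral => //; first exact: measurable_funTS.
apply: (@subset_measure0 _ _ _ P _ (Q @^-1` N)) => //; first exact: measurable_pre.
  move=> z [Az nDz]; apply: contrapT => nN; apply: nDz; apply/DP.
  exact: AN Az nN.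
by rewrite -N0; exact: QP.2.
Qed.

End OneSpace.

(* At the scale of G, F is approximated by a function u on the vertices of G:
   u has discrete gradient controlled by g, and F is close to u in L^1. *)
Definition approximable (n : nat) (kappa : R) (X : pmetricType R) (G : graph R X)
    (mu : {measure set (borel X) -> \bar R}) (Q : Om -> X) := exists u : X -> R,
  (forall e : edge G, ((weight mu e * `|u (arc G e 0) - u (arc G e 1)|)%:E <=
     (len G)%:E * mass Q g e)%E) /\
  forall Es Ns : seq {classic edge G}, uniq Es -> uniq Ns ->
    (forall e f : {classic edge G}, e \in Es -> near (G := G) n e f -> f \in Ns) ->
    (\sum_(e <- Es) mass (G := G) Q (dev (u (arc G e 0))) e <=
      (kappa * len G)%:E * \sum_(f <- Ns) mass (G := G) Q g f)%E.

Lemma approximable_le n k k' (X : pmetricType R) (G : graph R X) mu Q : 0 <= len G -> k <= k' ->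
  approximable n k G mu Q -> approximable n k' G mu Q.
Proof.
move=> L0 kk [u [u1 u2]]; exists u; split=> // Es Ns uE uN h.
apply: le_trans (u2 _ _ uE uN h) _; apply: lee_wpmul2r.
  by apply: sume_ge0 => f _; exact: mass_ge0.
by rewrite lee_fin ler_wpM2r.
Qed.

Lemma telescope_le (a : nat -> R) k m : (k <= m)%N ->
  `|a 0%N - a k| <= \sum_(j < m) `|a j - a j.+1|.
Proof.
move=> km; apply: le_trans (_ : \sum_(j < k) `|a j - a j.+1| <= _).
  elim: k {km} => [|k IH]; first by rewrite subrr normr0 big_ord0.
  rewrite big_ord_recr /= (_ : a 0%N - a k.+1 = (a 0%N - a k) + (a k - a k.+1)).
    by apply: le_trans (ler_normD _ _) _; rewrite lerD2r.
  by ring.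
rewrite -(big_mkord xpredT (fun j => `|a j - a j.+1|)) -(big_mkord xpredT (fun j => `|a j - a j.+1|)).
by rewrite [leRHS](big_cat_nat (leq0n k) km) /= lerDl sumr_ge0.
Qed.

(** * From a subdivision to the graph itself *)

Section SubdivisionStep.
Variables (X : pmetricType R) (G : graph R X) (mu : {measure set (borel X) -> \bar R}).
Variables (B : nat) (C : R) (Q : Om -> X) (m : nat).
Hypothesis m_gt0 : (0 < m)%N.
Hypothesis GT : tame G mu B C.
Hypothesis QP : pushes mu Q.
Let GP := tame_graph GT.
Let Sub := subdivide G m.
Let ST : tame Sub mu (B * m) C := sub_tame m_gt0 GT.
Let M0 : 0 < m%:R :> R. Proof. by rewrite ltr0n. Qed.

Lemma mass_sub (phi : Om -> \bar R) (e : edge G) :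
  measurable_fun setT phi -> (forall z, 0 <= phi z)%E ->
  mass (G := G) Q phi e = (\sum_(j < m) mass (G := Sub) Q phi (sub_edge e j))%E.
Proof.
move=> mphi phi0.
pose s : seq {classic edge Sub} := [seq sub_edge e j | j <- enum 'I_m].
rewrite -big_enum -(big_map (fun j => sub_edge e j : {classic edge Sub}) xpredT (mass (G := Sub) Q phi)).
rewrite {1}/mass (@integral_bigcells X Sub mu (B * m) C Q ST QP s)//.
- by rewrite map_inj_uniq ?enum_uniq// => i j [].
- exact: measurable_icell.
- move=> _ /mapP[j _ ->] x; rewrite /icell oarc_sub// => -[t].
  rewrite /= in_itv /= => /andP[t0 t1] <-; exists t => //=; rewrite in_itv /=.
  have /andP[h _] : 0 <= (j%:R + 0 : R) / m%:R <= 1 by apply: sub_param => //; lra.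
  have /andP[_ h'] : 0 <= (j%:R + 1 : R) / m%:R <= 1 by apply: sub_param => //; lra.
  by rewrite (le_lt_trans h t0) (lt_le_trans t1 h').
(* The division points, repeated beyond index [m] so as to form a countable union of null sets. *)
pose pts (k : nat) : X := arc G e ((minn k m)%:R / m%:R).
have pts01 k : 0 <= ((minn k m)%:R / m%:R : R) <= 1.
  by rewrite divr_ge0 ?ler_pdivrMr ?mul1r ?ler_nat ?geq_minr// ltW.
exists (\bigcup_k [set pts k]).
  split; first by apply: bigcup_measurable => k _; exact: borel_set1.
  apply: measure_negligible; first by apply: bigcup_measurable => k _; exact: borel_set1.
  apply: negligible_bigcup => k; apply/negligibleP; first exact: borel_set1.
  exact: (tame_arc GT).2.
move=> x [t /=]; rewrite in_itv /= => /andP[t0 t1] <- nN.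
have [|j /andP[j1 j2]] := @sub_cell R m m_gt0 t; first by rewrite !ltW.
have n1 : t * m%:R <> j%:R.
  move=> E; apply: nN; exists j => //=; rewrite /pts (minn_idPl (ltnW (ltn_ord j))) -E.
  by rewrite mulfK// gt_eqF.
have n2 : t * m%:R <> j%:R + 1.
  move=> E; apply: nN; exists j.+1 => //=; rewrite /pts (minn_idPl (ltn_ord j)) -natr1 -E.
  by rewrite mulfK// gt_eqF.
exists (sub_edge e j); first by apply/map_f; rewrite mem_enum.
rewrite /icell oarc_sub//; exists t => //=; rewrite in_itv /= addr0.
rewrite ltr_pdivrMr// ltr_pdivlMr// !lt_neqAle j1 j2 !andbT.
by apply/andP; split; apply/eqP => // /esym.
Qed.

(** The same [u] is kept. Replacing its value at the start of a piece by that at the start of the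
    edge costs the variation of [u] along the edge, whence the 1; the old error is measured in units
    of the pieces, whence the division by [m]. *)
Lemma approximable_sub n kappa : 0 <= kappa ->
  approximable n kappa Sub mu Q -> approximable n (1 + kappa / m%:R) G mu Q.
Proof.
move=> k0 [u [u1 u2]]; have L0 := len_gt0 GP; exists u.
pose a (e : edge G) (k : nat) := u (arc G e (k%:R / m%:R)).
pose T e := \sum_(j < m) `|a e j - a e j.+1|.
have aE e (j : 'I_m) : u (arc Sub (sub_edge e j) 0) = a e j by rewrite arc_sub addr0.
have aE' e (j : 'I_m) : u (arc Sub (sub_edge e j) 1) = a e j.+1 by rewrite arc_sub natr1.
have a0 e : u (arc G e 0) = a e 0%N by rewrite /a mul0r.
have am e : u (arc G e 1) = a e m by rewrite /a divff// gt_eqF.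
(* From a piece to its edge, weight and length grow by the same factor [m]; therefore the gradient
   bounds add up with constant 1. *)
have wT e : ((weight mu e * T e)%:E <= (len G)%:E * mass (G := G) Q g e)%E.
  rewrite mass_sub// ge0_sume_distrr; last by move=> j _; exact: mass_ge0.
  rewrite /T mulr_sumr -sumEFin; apply: lee_sum => j _.
  have := u1 (sub_edge e j); rewrite aE aE' (weight_sub m_gt0 GT) => h.
  have -> : weight mu e * `|a e j - a e j.+1| =
            m%:R * (weight mu e / m%:R * `|a e j - a e j.+1|).
    by field; rewrite gt_eqF.
  rewrite EFinM (_ : len G = m%:R * len Sub); last by rewrite /=; field; rewrite gt_eqF.
  by rewrite [X in (_ <= X * _)%E]EFinM -muleA; apply: lee_wpmul2l => //; rewrite lee_fin ltW.
split=> [e|Es Ns uE uN EN].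
  apply: le_trans (wT e); rewrite lee_fin ler_wpM2l ?weight_ge0//.
  by rewrite a0 am; exact: telescope_le.
pose sube (e : {classic edge G}) (j : 'I_m) : {classic edge Sub} := sub_edge e j.
pose up (s : seq {classic edge G}) := [seq sube e j | e <- s, j <- enum 'I_m].
have upP s (p : {classic edge Sub}) : p \in up s = ((p.1 : {classic edge G}) \in s).
  apply/allpairsPdep/idP => [[e [j [es _ ->]]]//|ps].
  by exists p.1, p.2; rewrite mem_enum; split => //; case: p {ps}.
have up_uniq s : uniq s -> uniq (up s).
  elim: s => // e s IH /= /andP[es us].
  rewrite /up /= cat_uniq map_inj_uniq ?enum_uniq; last by move=> i j [].
  rewrite IH// andbT; apply/hasPn => p; rewrite upP => ps.
  by apply/negP => /mapP[j _ pE]; move: es; move: ps; rewrite pE /= => ->.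
have sum_up s (H : edge Sub -> \bar R) :
    (\sum_(p <- up s) H p = \sum_(e <- s) \sum_(j < m) H (sub_edge e j))%E.
  rewrite /up big_flatten /= big_map; apply: eq_bigr => e _.
  by rewrite big_map big_enum.
have step e : (mass (G := G) Q (dev (u (arc G e 0))) e <=
    \sum_(j < m) mass (G := Sub) Q (dev (u (arc Sub (sub_edge e j) 0))) (sub_edge e j) +
    (len G)%:E * mass (G := G) Q g e)%E.
  rewrite mass_sub//; [|exact: measurable_dev|by move=> z; exact: dev_ge0].
  apply: (@le_trans _ _ (\sum_(j < m)
      (mass (G := Sub) Q (dev (u (arc Sub (sub_edge e j) 0))) (sub_edge e j) +
       (weight mu (sub_edge e j) * T e)%:E)))%E.
    apply: lee_sum => j _.
    apply: le_trans (mass_dev (G := Sub) ST QP _ (u (arc Sub (sub_edge e j) 0)) _) _.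
    apply: leeD => //; rewrite lee_fin ler_wpM2l ?weight_ge0//.
    by rewrite aE a0 distrC; apply: telescope_le; exact: ltnW.
  rewrite big_split /=; apply: leeD => //; apply: le_trans (wT e).
  rewrite sumEFin lee_fin -mulr_suml ler_wpM2r ?sumr_ge0//.
  rewrite (eq_bigr (fun=> weight mu e / m%:R)); last by move=> j _; rewrite (weight_sub m_gt0 GT).
  by rewrite big_const_ord iter_addr_0 -[leLHS]mulr_natr divfK// gt_eqF.
apply: le_trans (lee_sum _ (fun e _ => step e)) _.
rewrite big_split /= -(sum_up Es (fun p => mass (G := Sub) Q (dev (u (arc Sub p 0))) p)) addeC mulrDl mul1r EFinD.
have N0 : (0 <= \sum_(f <- Ns) mass (G := G) Q g f)%E.
  by apply: sume_ge0 => f _; exact: mass_ge0.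
rewrite ge0_muleDl ?lee_fin ?mulr_ge0 ?divr_ge0 ?(ltW L0) ?(ltW M0)//.
apply: leeD.
  rewrite -ge0_sume_distrr; last by move=> e _; exact: mass_ge0.
  apply: lee_wpmul2l; first by rewrite lee_fin ltW.
  apply: (@sum_subset R {classic edge G}) => // [e eE|e]; last exact: mass_ge0.
  by apply: (EN e) => //; exact: near_refl.
have -> : (\sum_(f <- Ns) mass (G := G) Q g f = \sum_(p <- up Ns) mass (G := Sub) Q g p)%E.
  by rewrite sum_up; apply: eq_bigr => f _; rewrite mass_sub.
rewrite (_ : kappa / m%:R * len G = kappa * len Sub); last by rewrite /=; ring.
apply: u2; [exact: up_uniq|exact: up_uniq|].
by move=> p q; rewrite !upP => /EN + /(sub_near m_gt0 GT); apply.
Qed.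

End SubdivisionStep.

(** * Averaging over the fibres of a projection *)

Section ProjectionStep.
Variables (X : pmetricType R) (G : graph R X) (mu : {measure set (borel X) -> \bar R}).
Variables (B : nat) (C : R).
Variables (X' : pmetricType R) (G' : graph R X') (mu' : {measure set (borel X') -> \bar R}).
Variables (B' : nat) (C' : R).
Variables (Q : Om -> X') (pi : X' -> X) (n : nat).
Variables (pe : edge G' -> edge G) (po : edge G' -> bool).
Hypothesis GT : tame G mu B C.
Hypothesis GT' : tame G' mu' B' C'.
Hypothesis QP : pushes mu' Q.
Hypothesis piQ : pushes mu (pi \o Q).
Hypothesis mpi : measurable_fun setT (pi : borel X' -> borel X).
Hypothesis lenE : len G' = len G.
Hypothesis piE : forall e t, 0 <= t <= 1 ->
  pi (arc G' e t) = arc G (pe e) (if po e then 1 - t else t).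
Hypothesis pi_vertex : forall v, vertex G' v -> vertex G (pi v).
Hypothesis noloop : forall p : edge G, arc G p 0 <> arc G p 1.
Hypothesis pi_star : forall (v : X) (v' : X'), vertex G v -> vertex G' v' -> pi v' = v ->
  exists c : R, forall A : set (borel X), measurable A ->
    mu' (pi @^-1` A `&` star G' v') = (c%:E * mu (A `&` star G v))%E.
Hypothesis pi_fiber : forall e f, pe e = pe f -> near n e f.
Let GP := tame_graph GT.
Let GP' := tame_graph GT'.
Local Notation E := {classic edge G}.
Local Notation E' := {classic edge G'}.

Lemma pi_icell e x : icell (G := G') e x -> icell (G := G) (pe e) (pi x).
Proof.
case=> t /=; rewrite in_itv /= => /andP[t0 t1] <-; rewrite piE ?ltW//.
exists (if po e then 1 - t else t) => //=; rewrite in_itv /=.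
by case: (po e); lra.
Qed.

Lemma icell_pi p x : icell (G := G) p (pi x) -> exists2 e, pe e = p & icell (G := G') e x.
Proof.
move=> px; case: (arc_cover GP' x) => [/pi_vertex pv|[e [t [t01 xE]]]].
  exfalso; case: px pv => t /=; rewrite in_itv /= => t01 <-.
  exact: (arc_interior GP).
have xe : icell (G := G') e x by exists t => //=; rewrite in_itv.
exists e => //; apply: (icell_inj GP (pi_icell xe)).
by apply: oarc_cell px; lra.
Qed.

(** By [pi_fiber] all lifts of [p] lie in the finite neighbourhood of any one of them. *)
Lemma lifts_ex (p : edge G) : exists s : seq E', uniq s /\ forall e : E', e \in s <-> pe e = p.
Proof.
have [[e0 e0p]|no] := pselect (exists e, pe e = p).
  exists [seq e : E' <- nbh GT' n e0 | `[< pe e = p >]]; split.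
    by apply: filter_uniq; exact: nbh_uniq.
  move=> e; rewrite mem_filter; split=> [/andP[/asboolP]//|ep].
  by rewrite asboolT//=; apply/nbhP; apply: pi_fiber; rewrite ep.
by exists [::]; split=> // e; split=> // ep; exfalso; apply: no; exists e.
Qed.

Definition lifts (p : E) : seq E' := sval (cid (lifts_ex p)).

Lemma liftsP p (e : E') : e \in lifts p <-> pe e = p.
Proof. by rewrite /lifts; case: cid => s [/= _ h]. Qed.

Lemma lifts_uniq p : uniq (lifts p).
Proof. by rewrite /lifts; case: cid => s [/= h _]. Qed.

Lemma mass_proj (phi : Om -> \bar R) p :
  measurable_fun setT phi -> (forall z, 0 <= phi z)%E ->
  mass (G := G) (pi \o Q) phi p = (\sum_(e <- lifts p) mass (G := G') Q phi e)%E.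
Proof.
move=> mphi phi0; rewrite {1}/mass comp_preimage.
rewrite (@integral_bigcells X' G' mu' B' C' Q GT' QP (lifts p))//.
- exact: lifts_uniq.
- by rewrite -[X in measurable X]setTI; apply: mpi => //; exact: measurable_icell.
- by move=> e /liftsP <- x /pi_icell.
- exists set0; first by split; [exact: measurable0|exact: measure0].
  by move=> x /icell_pi[e ep ex] _; exists e => //; apply/liftsP.
Qed.

Lemma weight_proj p : weight mu p = \sum_(e <- lifts p) weight mu' e.
Proof.
apply: EFin_inj; rewrite -sumEFin.
have := @mass_proj (cst 1%:E) p (measurable_cst _) (fun _ => lee01).
rewrite (mass_cst GT piQ) mul1r => ->; apply: eq_bigr => e _.
by rewrite (mass_cst GT' QP) mul1r.
Qed.

(* The end of e that lies over the end b of its image. *)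
Definition lift_end (b : bool) (e : E') : X' := arc G' e (b (+) po e)%:R.

Lemma lift_endP b e : pi (lift_end b e) = arc G (pe e) b%:R.
Proof.
rewrite /lift_end piE ?end_in//; congr arc.
by case: b; case: (po e) => /=; lra.
Qed.

Lemma vertex_lift_end b e : vertex G' (lift_end b e).
Proof. exact: vertex_end. Qed.

Lemma mu_bigcells (s : seq E') : uniq s ->
  mu' (\big[setU/set0]_(e <- s) icell (G := G') e) = (\sum_(e <- s) (weight mu' e)%:E)%E.
Proof.
move=> us; pose D := \big[setU/set0]_(e <- s) icell (G := G') e.
have mD : measurable D by apply: bigsetU_measurable => e _; exact: measurable_icell.
have DP x : D x <-> exists2 e : E', e \in s & icell (G := G') e x.
  by rewrite /D -bigcup_seq; split=> -[e es h]; exists e.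
rewrite -/D -QP.2// -[LHS]mul1e -integral_cst; last first.
  exact: (measurable_pre QP mD).
rewrite (@integral_bigcells X' G' mu' B' C' Q GT' QP s)//.
- by apply: eq_bigr => e _; rewrite (mass_cst GT' QP) mul1r.
- by move=> e es x ex; apply/DP; exists e.
- exists set0; first by split; [exact: measurable0|exact: measure0].
  by move=> x /DP.
Qed.

(* Restricted to the star of v', the projection scales the measure by a
   constant, so the edges at v' over p have total weight proportional to p. *)
Lemma star_weight (p : edge G) (b : bool) (v' : X') (c : R) :
  (forall A : set (borel X), measurable A ->
    mu' (pi @^-1` A `&` star G' v') = (c%:E * mu (A `&` star G (arc G p b%:R)))%E) ->
  vertex G' v' -> pi v' = arc G p b%:R ->
  \sum_(e <- lifts p | lift_end b e == v') weight mu' e = c * weight mu p.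
Proof.
move=> cP vv' v'E; apply: EFin_inj; have := cP _ (measurable_icell GP p).
have -> : icell (G := G) p `&` star G (arc G p b%:R) = icell p.
  apply/seteqP; split=> x; first by case.
  move=> px; split=> //; right; exists p; first exact: incident_end.
  by apply: oarc_cell px.
rewrite (mu_icell (tame_arc GT)) EFinM => <-; rewrite -sumEFin -big_filter.
set s := seq.filter _ _.
have us : uniq s by apply: filter_uniq; exact: lifts_uniq.
have sP (e : E') : e \in s -> pe e = p /\ lift_end b e = v'.
  by rewrite mem_filter => /andP[/eqP ? /liftsP].
(* The other end of [e] lies over the other end of [p], a different point because [p] is not a loop;
   so the end at [v'] is the one over [b]. *)
have Ps (e : E') : pe e = p -> incident v' e -> e \in s.
  move=> ep /incidentP[b' v'b]; rewrite mem_filter; apply/andP; split; last exact/liftsP.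
  apply/eqP; rewrite v'b /lift_end; suff -> : b' = b (+) po e by [].
  move: v'E; rewrite v'b piE ?end_in// ep.
  case: b b' (po e) {v'b s us sP cP} => [] [] [] //=; rewrite ?subr0 ?subrr => h;
    by [case: (noloop (esym h))|case: (noloop h)].
rewrite -mu_bigcells//; congr (mu' _).
rewrite -bigcup_seq; apply/seteqP; split=> x.
  case=> e /sP[ep eb] ex; split; first by rewrite /= -ep; exact: pi_icell.
  right; exists e; last by apply: oarc_cell ex.
  by rewrite -eb; exact: incident_end.
(* A point over the open edge is interior to a lift of [p], hence not the vertex [v']; the edge at
   [v'] that contains it can only be this lift. *)
case=> /= /icell_pi[e ep ex] [xv|[f /= fv fx]].
  case: ex => t /=; rewrite in_itv /= => t01 h.
  by case: (arc_interior GP' t01 (e := e)); rewrite h xv.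
by exists e => //; apply: Ps => //; rewrite (icell_inj GP' ex fx).
Qed.

Section Average.
Variable u : X' -> R.

Definition edge_avg (p : edge G) (b : bool) : R :=
  (weight mu p)^-1 * \sum_(e <- lifts p) weight mu' e * u (lift_end b e).

Hypothesis wt_neq0 : forall p : edge G, weight mu p != 0.

(** Grouping the lifts by their ends exhibits the coefficients of the values [u v]; [star_weight]
    identifies each of them with the constant of the star condition. *)
Lemma edge_avg_vertex (V : seq X') p b : uniq V ->
  (forall e, e \in lifts p -> lift_end b e \in V) ->
  edge_avg p b = \sum_(v <- V) u v *
    ((weight mu p)^-1 * \sum_(e <- lifts p | lift_end b e == v) weight mu' e).
Proof.
move=> uV pV; rewrite /edge_avg.
have -> : \sum_(e <- lifts p) weight mu' e * u (lift_end b e) =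
    \sum_(v <- V) \sum_(e <- lifts p | lift_end b e == v) weight mu' e * u v.
  rewrite (exchange_big_dep xpredT) //= big_seq [RHS]big_seq; apply: eq_bigr => e ep.
  rewrite big_mkcond (bigD1_seq (lift_end b e)) ?pV//= eqxx big1 ?addr0//.
  by move=> v; rewrite eq_sym => /negbTE ->.
rewrite mulr_sumr; apply: eq_bigr => v _.
by rewrite -mulr_suml mulrA [RHS]mulrC.
Qed.

(* The star condition makes the fibre average depend on the vertex only. *)
Lemma edge_avg_eq p (b : bool) p' (b' : bool) : arc G p b%:R = arc G p' b'%:R ->
  edge_avg p b = edge_avg p' b'.
Proof.
move=> vE.
(* Ends of lifts of both edges, so that the two averages become sums over the same vertices. *)
pose V := undup ([seq lift_end b e | e <- lifts p] ++ [seq lift_end b' e | e <- lifts p']).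
have uV : uniq V by exact: undup_uniq.
rewrite (@edge_avg_vertex V p b)//; last first.
  by move=> e ep; rewrite mem_undup mem_cat; apply/orP; left; exact: map_f.
rewrite (@edge_avg_vertex V p' b')//; last first.
  by move=> e ep; rewrite mem_undup mem_cat; apply/orP; right; exact: map_f.
rewrite big_seq [RHS]big_seq; apply: eq_bigr => v; rewrite mem_undup mem_cat => vV.
have [vv pv] : vertex G' v /\ pi v = arc G p b%:R.
  case/orP: vV => /mapP[e ep ->]; split; try exact: vertex_lift_end.
    by rewrite lift_endP; move/liftsP: ep => ->.
  by rewrite lift_endP vE; move/liftsP: ep => ->.
have [c cP] := pi_star (vertex_end GP p b) vv pv.
rewrite (star_weight cP)// (@star_weight p' b' v c)//; [|by rewrite -vE|by rewrite -vE].
by congr (_ * _); field; rewrite !wt_neq0.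
Qed.

Lemma average_ex : exists u' : X -> R, forall p (b : bool), u' (arc G p b%:R) = edge_avg p b.
Proof.
pose Pr (x : X) (r : R) := forall p (b : bool), x = arc G p b%:R -> r = edge_avg p b.
have /choice[u' u'P] : forall x, exists r, Pr x r.
  move=> x; have [[p [b xE]]|no] := pselect (exists p (b : bool), x = arc G p b%:R).
    by exists (edge_avg p b) => p' b' xE'; apply: edge_avg_eq; rewrite -xE.
  (* Points that are not an end of any edge get the default value 0. *)
  by exists 0 => p b xE; exfalso; apply: no; exists p, b.
by exists u' => p b; exact: u'P.
Qed.

End Average.

Lemma pe_adjacent e f : adjacent e f -> adjacent (pe e) (pe f).
Proof.
have inc h v : incident v h -> incident (pi v) (pe h).
  move=> /incidentP[b ->]; rewrite -(addbK (po h) b) -[arc _ _ _]/(lift_end (b (+) po h) h).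
  by rewrite lift_endP; exact: incident_end.
by case=> v ve vf; exists (pi v); exact: inc.
Qed.

(** Keeps the neighbourhood radius in [approximable] from growing with the number of levels. *)
Lemma pe_near k e f : near k e f -> near k (pe e) (pe f).
Proof.
elim: k f => [f -> //|k IH f [h /IH eh /pe_adjacent hf]].
by exists (pe h).
Qed.

(** Between the two ends one crosses at most [k + 1] edges of a chain, all in [s]; each crossing is
    bounded by the whole sum, since edges may be repeated. *)
Lemma osc_near (u : X' -> R) k e f (b b' : bool) (s : seq E') :
  (forall h : E', near k e h -> h \in s) -> near k e f ->
  `|u (arc G' e b%:R) - u (arc G' f b'%:R)| <=
  k.+1%:R * \sum_(h <- s) `|u (arc G' h 0) - u (arc G' h 1)|.
Proof.
move=> sP; set T := \sum_(h <- s) _.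
have osc h (c c' : bool) : near k e h -> `|u (arc G' h c%:R) - u (arc G' h c'%:R)| <= T.
  move=> /sP hs; apply: (@le_trans _ _ `|u (arc G' h 0) - u (arc G' h 1)|).
    by case: c c' => [] [] //=; rewrite ?subrr ?normr0// distrC.
  rewrite /T (big_rem (h : E') hs) /= lerDl; apply: sumr_ge0 => ? _ //.
suff : forall j, (j <= k)%N -> forall f (b' : bool), near j e f ->
    `|u (arc G' e b%:R) - u (arc G' f b'%:R)| <= j.+1%:R * T.
  by apply.
elim=> [_ f' c <-|j IH jk f' c ef'].
  by rewrite mul1r; apply: osc; exact: near_refl.
have [h eh [v /incidentP[c1 v1] /incidentP[c2 v2]]] := ef'.
rewrite (_ : u (arc G' e b%:R) - u (arc G' f' c%:R) =
  (u (arc G' e b%:R) - u (arc G' h c1%:R)) + (u (arc G' f' c2%:R) - u (arc G' f' c%:R))); last first.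
  by rewrite -v1 -v2; ring.
apply: le_trans (ler_normD _ _) _; rewrite -[j.+2%:R]natr1 mulrDl mul1r.
apply: lerD; first by apply: (IH (ltnW jk)).
by apply: osc; apply: near_le ef'.
Qed.

Lemma lifts_flatten_uniq (s : seq E) : uniq s -> uniq (flatten [seq lifts p | p <- s]).
Proof.
elim: s => //= p s IH /andP[ps us].
rewrite cat_uniq lifts_uniq IH// andbT; apply/hasPn => e /flattenP[_ /mapP[p' p's ->]].
by move=> /liftsP ep; apply/negP => /liftsP ep'; move: ps; rewrite -ep' ep p's.
Qed.

Lemma lifts_flattenP (s : seq E) (e : E') :
  (e \in flatten [seq lifts p | p <- s]) = ((pe e : E) \in s).
Proof.
apply/flattenP/idP => [[_ /mapP[p ps ->] /liftsP -> //]|es].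
by exists (lifts (pe e)); [exact: (map_f lifts)|exact/liftsP].
Qed.

Lemma sum_lifts (s : seq E) (H : E' -> \bar R) :
  (\sum_(p <- s) \sum_(e <- lifts p) H e = \sum_(e <- flatten [seq lifts p | p <- s]) H e)%E.
Proof. by rewrite big_flatten big_map. Qed.

Lemma mass_null (phi : Om -> \bar R) p : measurable_fun setT phi ->
  weight mu p = 0 -> mass (G := G) (pi \o Q) phi p = 0%E.
Proof.
move=> mphi p0; apply: null_set_integral.
- by apply: (measurable_pre piQ); exact: measurable_icell.
- exact: measurable_funTS.
- rewrite piQ.2; last exact: measurable_icell.
  by rewrite (mu_icell (tame_arc GT)) p0.
Qed.

(** The fibre average works: its increment over [p] is the average of the increments of [u] over the
    lifts of [p]. Its distance to [u] at a lift is an oscillation over [n]-near edges (factor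
    [n + 1]); comparing their weights costs [C' ^ n], and the overlap of neighbourhoods [B' ^ n]. *)
Lemma approximable_proj kappa : 0 <= kappa -> approximable n kappa G' mu' Q ->
  approximable n (kappa + n.+1%:R * C' ^+ n * (B' ^ n)%:R) G mu (pi \o Q).
Proof.
move=> k0 [u [u1 u2]]; have L0 := len_gt0 GP.
have C0 : 0 <= C' by exact: le_trans ler01 (tame_ge1 GT').
have K0 : 0 <= n.+1%:R * C' ^+ n * (B' ^ n)%:R :> R by rewrite !mulr_ge0 ?exprn_ge0.
(* Averages cannot be formed when a weight is zero, but then every weight and every mass is zero. *)
have [[p0 p00]|nz] := pselect (exists p : edge G, weight mu p = 0).
  have w0 (p : edge G) : weight mu p = 0 by exact: (weight_eq0 GT _ p00).
  exists (fun=> 0); split=> [p|Es Ns _ _ _].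
    by rewrite w0 mul0r mule_ge0 ?lee_fin ?(ltW L0)// mass_ge0.
  rewrite big1; last by move=> p _; rewrite mass_null//; exact: measurable_dev.
  rewrite mule_ge0 ?lee_fin ?mulr_ge0 ?addr_ge0 ?(ltW L0)//.
  by apply: sume_ge0 => f _; exact: mass_ge0.
have wt0 (p : edge G) : weight mu p != 0 by apply/eqP => p0; apply: nz; exists p.
have [u' u'P] := average_ex u wt0.
have u'0 p : u' (arc G p 0) = edge_avg u p false := u'P p false.
have u'1 p : u' (arc G p 1) = edge_avg u p true := u'P p true.
have wavg (p : edge G) b : weight mu p * edge_avg u p b = \sum_(e <- lifts p) weight mu' e * u (lift_end b e).
  by rewrite /edge_avg mulrA divff// mul1r.
pose osc (e : edge G') := `|u (arc G' e 0) - u (arc G' e 1)|.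
exists u'; split=> [p|Es Ns uE uN EN].
  rewrite mass_proj// ge0_sume_distrr; last by move=> e _; exact: mass_ge0.
  apply: (@le_trans _ _ (\sum_(e <- lifts p) (weight mu' e * osc e)%:E)%E); last first.
    by apply: lee_sum => e _; rewrite -lenE; exact: u1.
  rewrite sumEFin lee_fin u'0 u'1 -[X in X * _]ger0_norm ?weight_ge0// -normrM.
  rewrite mulrBr !wavg -sumrB; apply: le_trans (ler_norm_sum _ _ _) _.
  apply: ler_sum => e _; rewrite -mulrBr normrM ger0_norm ?weight_ge0//.
  rewrite ler_wpM2l ?weight_ge0// /osc /lift_end.
  by case: (po e); rewrite //= distrC.
pose Es' := flatten [seq lifts p | p <- Es]; pose Ns' := flatten [seq lifts p | p <- Ns].
have uE' : uniq Es' by exact: lifts_flatten_uniq.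
have uN' : uniq Ns' by exact: lifts_flatten_uniq.
have EN' (e f : E') : e \in Es' -> near n e f -> f \in Ns'.
  by rewrite !lifts_flattenP => /EN + /pe_near; apply.
have cmp p (e : E') : e \in lifts p ->
    ((weight mu' e * `|u (arc G' e 0) - u' (arc G p 0)|)%:E <=
     (n.+1%:R * C' ^+ n)%:E * \sum_(f <- nbh GT' n e) (len G)%:E * mass (G := G') Q g f)%E.
  move=> /liftsP ep; pose T := \sum_(f <- nbh GT' n e) osc f.
  (* The value of [u'] is a weighted mean of values of [u] at ends of lifts of [p], and all these
     lifts are within [n] edges of [e]. *)
  have dl : `|u (arc G' e 0) - u' (arc G p 0)| <= n.+1%:R * T.
    rewrite -(ler_pM2l (_ : 0 < weight mu p)); last by rewrite lt_def wt0 weight_ge0.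
    rewrite u'0 -[X in X * `|_|]ger0_norm ?weight_ge0// -normrM mulrBr wavg weight_proj.
    rewrite !mulr_suml -sumrB; apply: le_trans (ler_norm_sum _ _ _) _.
    rewrite big_seq [leRHS]big_seq; apply: ler_sum => f /liftsP fp.
    rewrite -mulrBr normrM ger0_norm ?weight_ge0// ler_wpM2l ?weight_ge0//.
    apply: (@osc_near u n e f false).
      by move=> h eh; apply/nbhP.
    by apply: pi_fiber; rewrite ep.
  rewrite ge0_sume_distrr; last first.
    by move=> f _; rewrite mule_ge0 ?lee_fin ?(ltW L0)// mass_ge0.
  apply: (@le_trans _ _ (\sum_(f <- nbh GT' n e) (n.+1%:R * C' ^+ n)%:E * (weight mu' f * osc f)%:E)%E); last first.
    apply: lee_sum => f _; apply: lee_wpmul2l; first by rewrite lee_fin mulr_ge0// exprn_ge0.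
    by rewrite -lenE; exact: u1.
  under eq_bigr do rewrite -EFinM.
  rewrite sumEFin lee_fin.
  apply: le_trans (ler_wpM2l (weight_ge0 _ _) dl) _.
  rewrite mulrCA mulr_sumr mulr_sumr big_seq [leRHS]big_seq; apply: ler_sum => f /nbhP ef.
  rewrite -mulrA ler_wpM2l// mulrA ler_wpM2r ?normr_ge0//.
  exact: weight_near GT' _ _ _ ef.
have N0 : (0 <= \sum_(f <- Ns) mass (G := G) (pi \o Q) g f)%E.
  by apply: sume_ge0 => f _; exact: mass_ge0.
have NE : (\sum_(f <- Ns) mass (G := G) (pi \o Q) g f = \sum_(f <- Ns') mass (G := G') Q g f)%E.
  by rewrite -sum_lifts; apply: eq_bigr => f _; rewrite mass_proj.
have step p : (mass (G := G) (pi \o Q) (dev (u' (arc G p 0))) p <=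
    \sum_(e <- lifts p) (mass (G := G') Q (dev (u (arc G' e 0))) e +
     (n.+1%:R * C' ^+ n)%:E * \sum_(f <- nbh GT' n e) (len G)%:E * mass (G := G') Q g f))%E.
  rewrite mass_proj//; [|exact: measurable_dev|by move=> z; exact: dev_ge0].
  apply: lee_sum_mem => e ep.
  apply: le_trans (mass_dev (G := G') GT' QP _ (u (arc G' e 0)) _) _.
  by apply: leeD => //; exact: cmp.
apply: le_trans (lee_sum _ (fun p _ => step p)) _.
rewrite sum_lifts big_split /= mulrDl EFinD.
rewrite ge0_muleDl ?lee_fin ?mulr_ge0 ?exprn_ge0 ?(ltW L0)//.
rewrite NE; apply: leeD.
  by rewrite -lenE; exact: u2.
rewrite -ge0_sume_distrr; last first.
  by move=> e _; apply: sume_ge0 => f _; rewrite mule_ge0 ?lee_fin ?(ltW L0)// mass_ge0.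
rewrite -mulrA [X in (_ <= X * _)%E]EFinM -muleA.
apply: lee_wpmul2l; first by rewrite lee_fin mulr_ge0 ?exprn_ge0.
(* Each edge lies in at most [B' ^ n] of the neighbourhoods summed over. *)
apply: le_trans (_ : (B' ^ n)%:R%:E * \sum_(f <- Ns') (len G)%:E * mass (G := G') Q g f <= _)%E.
  apply: (@sum_overlap R E') => //.
  - by move=> e; exact: nbh_uniq.
  - by move=> e f eE /nbhP ef; exact: EN' ef.
  - by move=> e f /nbhP ef; apply/nbhP; exact: near_sym.
  - by move=> e; exact: nbh_size.
  - by move=> e; rewrite mule_ge0 ?lee_fin ?(ltW L0)// mass_ge0.
rewrite -ge0_sume_distrr; last by move=> f _; exact: mass_ge0.
by rewrite muleA EFinM.
Qed.

End ProjectionStep.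

End Mass.

(** * Lip f as an upper gradient *)

Section Slope.
Variables (R : realType) (Y : pmetricType R) (f : Y -> R) (L : R).
Hypothesis L0 : 0 <= L.
Hypothesis fL : forall x y, `|f x - f y| <= L * mdist x y.

Definition quot (x y : Y) : R := `|f x - f y| / mdist x y.

(** A measurable version of [Lip] at radius 1/(n+1). Adjoining 0 settles the case where no other
    point is that close, in accordance with the maximum in [Lip]. *)
Definition slope (n : nat) (x : Y) : \bar R :=
  ereal_sup ([set 0%E] `|` [set (quot x y)%:E | y in [set y | 0 < mdist x y < n.+1%:R^-1]]).

Lemma slope_ge0 n x : (0 <= slope n x)%E.
Proof. by apply: ereal_sup_ubound; left. Qed.

Lemma slope_le n x : (slope n x <= L%:E)%E.
Proof.
apply: ge_ereal_sup => _ [->|[y /andP[xy _] <-]]; rewrite lee_fin//.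
by rewrite /quot ler_pdivrMr.
Qed.

Lemma slope_fin n x : slope n x \is a fin_num.
Proof. by apply/fin_numPlt; rewrite (lt_le_trans _ (slope_ge0 n x))// (le_lt_trans (slope_le n x))// ltry. Qed.

Lemma slopeP n x y : mdist x y < n.+1%:R^-1 -> `|f x - f y| <= fine (slope n x) * mdist x y.
Proof.
move=> xy; have [->|xny] := eqVneq x y; first by rewrite subrr normr0 mdistxx mulr0.
have d0 : 0 < mdist x y by rewrite mdist_gt0.
rewrite -ler_pdivrMr// -lee_fin fineK ?slope_fin//.
by apply: ereal_sup_ubound; right; exists y => //=; rewrite d0 xy.
Qed.

Lemma slope_decr x : {homo (slope^~ x) : n m / (n <= m)%N >-> (m <= n)%E}.
Proof.
move=> n m nm; apply: ge_ereal_sup => _ [->|[y /andP[xy1 xy2] <-]]; first exact: slope_ge0.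
apply: ereal_sup_ubound; right; exists y => //=; rewrite xy1 (lt_le_trans xy2)//.
by rewrite lef_pV2 ?posrE ?ler_nat.
Qed.

Lemma Lip_slope x : Lip f x = ereal_inf (range (slope^~ x)).
Proof.
apply/eqP; rewrite eq_le /Lip /limf_esup; apply/andP; split.
  apply: le_ereal_inf_tmp => _ [n _ <-]; rewrite ge_max slope_ge0 /=.
  pose V := [set y | 0 < mdist x y < n.+1%:R^-1].
  apply: (@le_trans _ _ (ereal_sup [set (quot x y)%:E | y in V])); last first.
    by apply: ge_ereal_sup => _ [y Vy <-]; apply: ereal_sup_ubound; right; exists y.
  apply: ereal_inf_lbound; exists V => //.
  apply/nbhs_ballP; exists n.+1%:R^-1 => /=; first by rewrite invr_gt0.
  by move=> y; rewrite ballEmdist /= => xy yx; rewrite /V /= mdist_gt0 eq_sym yx.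
set I := ereal_inf _.
have h (V : set Y) : x^' V -> (I <= maxe 0 (ereal_sup [set (quot x y)%:E | y in V]))%E.
  move=> /nbhs_ballP[r /= r0 rV].
  pose n := Num.truncn r^-1.
  have nr : n.+1%:R^-1 < r by rewrite invf_plt ?posrE//; exact: truncnS_gt.
  apply: (@le_trans _ _ (slope n x)); first by apply: ereal_inf_lbound; exists n.
  apply: ge_ereal_sup => _ [->|[y /andP[xy1 xy2] <-]]; first by rewrite le_max lexx.
  rewrite le_max; apply/orP; right; apply: ereal_sup_ubound; exists y => //.
  apply: rV; first by rewrite ballEmdist /=; exact: lt_trans nr.
  by move: xy1; rewrite mdist_gt0 eq_sym.
(* The maximum with 0 has to move outside the infimum: if [I] is positive, the bound [h] holds
   without it. *)
have [I0|I0] := leP I 0%E; first by rewrite le_max I0.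
rewrite le_max; apply/orP; right; apply: le_ereal_inf_tmp => _ [V /h hV <-].
by move: hV; rewrite le_max leNgt I0.
Qed.

Lemma slope_cvg x : slope n x @[n --> \oo] --> Lip f x.
Proof. by rewrite Lip_slope; apply: ereal_nonincreasing_cvgn; exact: slope_decr. Qed.

Lemma Lip_ge0 x : (0 <= Lip f x)%E.
Proof. by rewrite /Lip le_max lexx. Qed.

(** Lower semicontinuity: a point [y] that witnesses a quotient above [a] at [x] does so at all
    points near [x]. *)
Lemma measurable_slope n : measurable_fun setT (slope n : borel Y -> \bar R).
Proof.
apply: (@measurability _ _ (borel Y) (\bar R) setT _ (@ErealGenOInfty.G R)).
  exact: ErealGenOInfty.measurableE.
move=> _ [_ [a ->] <-]; rewrite setTI; apply: borel_open.
rewrite openE => x /=; rewrite in_itv /= andbT => /ereal_sup_gt[_ [->|[y /andP[xy0 xyn] <-]]].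
  by move=> a0; apply: nearW => z; rewrite /= in_itv /= andbT; exact: lt_le_trans (slope_ge0 n z).
rewrite lte_fin /quot ltr_pdivlMr// => aq.
(* The margin by which the quotient at [x] exceeds [a]. Moving [x] by a distance d consumes at most
   [(L + |a|) d] of it; the other two bounds in [r] keep [z] away from [y] and within the radius
   1/(n+1). *)
pose eta := `|f x - f y| - a * mdist x y.
have La : 0 < L + `|a| + 1 by rewrite ltr_wpDl// addr_ge0.
pose r := Num.min (mdist x y) (Num.min (n.+1%:R^-1 - mdist x y) (eta / (L + `|a| + 1))).
have r0 : 0 < r.
  by rewrite /r !lt_min xy0 subr_gt0 xyn /= divr_gt0// /eta subr_gt0.
apply/nbhs_ballP; exists r => //= z; rewrite ballEmdist /= !lt_min => /and3P[z1 z2 z3].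
rewrite in_itv /= andbT.
have t1 := metric_triangle x z y; have t2 := metric_triangle z x y.
rewrite (metric_sym z x) in t2.
have p1 : 0 < mdist z y by lra.
have p2 : mdist z y < n.+1%:R^-1 by apply: le_lt_trans t2 _; rewrite -ltrBrDr.
apply: (@lt_le_trans _ _ (quot z y)%:E); last first.
  by apply: ereal_sup_ubound; right; exists y => //=; rewrite p1.
rewrite lte_fin /quot ltr_pdivlMr//.
have d1 : `|f x - f y| <= `|f x - f z| + `|f z - f y| by exact: ler_distD.
have d2 := fL x z.
have d3 : `|mdist z y - mdist x y| <= mdist x z by rewrite ler_norml; lra.
have d4 : a * (mdist z y - mdist x y) <= `|a| * mdist x z.
  apply: le_trans (ler_norm _) _; rewrite normrM.
  by apply: ler_wpM2l.
move: z3; rewrite ltr_pdivlMr// => z3.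
have d5 := mdist_ge0 x z.
by rewrite /eta in z3; lra.
Qed.

Lemma measurable_Lip : measurable_fun setT (Lip f : borel Y -> \bar R).
Proof.
apply: (emeasurable_fun_cvg (fun n => slope n : borel Y -> \bar R)).
  exact: measurable_slope.
by move=> x _; exact: slope_cvg.
Qed.

Section AlongArcs.
Variables (X : pmetricType R) (G : graph R X).
Variable mu : {measure set (borel X) -> \bar R}.
Hypothesis GP : is_metric_graph G.
Hypothesis muU : uniform_on_arcs G mu.
Variable q : X -> Y.
Hypothesis q1 : forall x y, mdist (q x) (q y) <= mdist x y.

Lemma measurable_q : measurable_fun setT (q : borel X -> borel Y).
Proof. by apply: (@lipschitz_borel R X Y 1) => x y; rewrite mul1r. Qed.

Lemma arc_slope_small n e s t : 0 <= s -> s < t -> t <= 1 ->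
  len G * (t - s) < n.+1%:R^-1 ->
  ((weight mu e * `|f (q (arc G e s)) - f (q (arc G e t))| / len G)%:E <=
    \int[mu]_(z in oarc e s t) slope n (q z))%E.
Proof.
move=> s0 st t1 small; have l0 := len_gt0 GP.
set D := `|f _ - f _|; pose c := D / (len G * (t - s)).
have lts : 0 < len G * (t - s) by rewrite mulr_gt0// subr_gt0.
have mA : measurable (oarc (G := G) e s t) by exact: measurable_oarc.
have -> : weight mu e * D / len G = c * (weight mu e * (t - s)).
  by rewrite /c; field; rewrite !gt_eqF// subr_gt0.
rewrite EFinM -(muU.1 e s t s0 (ltW st) t1) -integral_cst//.
apply: ge0_le_integral => //.
- by move=> z _; rewrite /= lee_fin /c divr_ge0 ?normr_ge0 ?(ltW lts).
- by apply: measurable_funTS; apply: measurableT_comp (measurable_slope n) measurable_q.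
move=> z0 [w /=]; rewrite in_itv /= => /andP[sw wt] <- {z0}; set z := arc G e w.
have ds : mdist (q z) (q (arc G e s)) <= len G * (w - s).
  apply: le_trans (q1 _ _) _; apply: le_trans (mdist_arc GP e _ _) _; [lra|lra|].
  by rewrite ger0_norm// subr_ge0 ltW.
have dt : mdist (q z) (q (arc G e t)) <= len G * (t - w).
  apply: le_trans (q1 _ _) _; apply: le_trans (mdist_arc GP e _ _) _; [lra|lra|].
  by rewrite distrC ger0_norm// subr_ge0 ltW.
have ws : len G * (w - s) <= len G * (t - s) by rewrite ler_pM2l//; lra.
have tw : len G * (t - w) <= len G * (t - s) by rewrite ler_pM2l//; lra.
rewrite -[leRHS]fineK ?slope_fin// lee_fin /c ler_pdivrMr//.
set k := fine _; have k0 : 0 <= k by rewrite /k fine_ge0// slope_ge0.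
have hs : `|f (q z) - f (q (arc G e s))| <= k * (len G * (w - s)).
  apply: le_trans (slopeP (n := n) (le_lt_trans ds (le_lt_trans ws small))) _.
  by rewrite ler_wpM2l.
have ht : `|f (q z) - f (q (arc G e t))| <= k * (len G * (t - w)).
  apply: le_trans (slopeP (n := n) (le_lt_trans dt (le_lt_trans tw small))) _.
  by rewrite ler_wpM2l.
apply: le_trans (ler_distD (f (q z)) _ _) _; rewrite distrC.
by lra.
Qed.

Lemma arc_slope n e s t : 0 <= s -> s <= t -> t <= 1 ->
  ((weight mu e * `|f (q (arc G e s)) - f (q (arc G e t))| / len G)%:E <=
    \int[mu]_(z in oarc e s t) slope n (q z))%E.
Proof.
have l0 := len_gt0 GP.
suff key N : forall s t, 0 <= s -> s <= t -> t <= 1 -> len G * (t - s) < N%:R * n.+1%:R^-1 ->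
  ((weight mu e * `|f (q (arc G e s)) - f (q (arc G e t))| / len G)%:E <=
    \int[mu]_(z in oarc e s t) slope n (q z))%E.
  move=> s0 st t1; apply: (key (Num.truncn (len G * (t - s) * n.+1%:R)).+1) => //.
  by rewrite -ltr_pdivrMr ?invr_gt0// invrK truncnS_gt.
elim: N => [|N IH] {}s {}t s0 st t1 small.
  have h : 0 <= len G * (t - s) by rewrite mulr_ge0 ?subr_ge0// ltW.
  by move: small; rewrite mul0r ltNge h.
have [tE|ts] := eqVneq s t.
  rewrite tE subrr normr0 mulr0 mul0r; apply: integral_ge0 => z _; exact: slope_ge0.
have {}st : s < t by rewrite lt_neqAle ts.
case: N IH small => [_|N IH small]; first by rewrite mul1r; exact: arc_slope_small.
(* The arc is cut into N+2 equal pieces: the first is short enough for [arc_slope_small], the other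
   N+1 together fall under the induction hypothesis. *)
have [dl [dl0 dlE dlS]] : exists dl : R, [/\ 0 < dl, t - s = dl * N.+2%:R & t - s = dl * N.+1%:R + dl].
  have E : t - s = (t - s) / N.+2%:R * N.+2%:R by rewrite divfK// pnatr_eq0.
  exists ((t - s) / N.+2%:R); split=> //; first by rewrite divr_gt0// subr_gt0.
  by rewrite [LHS]E -[N.+2%:R in X in _ * X = _]natr1 mulrDr mulr1.
have d1 : 0 < dl * N.+1%:R by rewrite mulr_gt0.
move: small; rewrite dlE mulrA [ltRHS]mulrC ltr_pM2r ?ltr0n// => small.
pose r := s + dl.
have rE : t - r = dl * N.+1%:R by rewrite /r opprD addrA dlS addrK.
have sr : s < r by rewrite /r ltrDl.
have rt : r < t by rewrite -subr_gt0 rE.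
have h1 : ((weight mu e * `|f (q (arc G e s)) - f (q (arc G e r))| / len G)%:E <=
    \int[mu]_(z in oarc e s r) slope n (q z))%E.
  apply: arc_slope_small => //; first by lra.
  by rewrite /r addrAC subrr add0r.
have h2 : ((weight mu e * `|f (q (arc G e r)) - f (q (arc G e t))| / len G)%:E <=
    \int[mu]_(z in oarc e r t) slope n (q z))%E.
  apply: IH; [lra|lra|lra|].
  by rewrite rE mulrA [ltRHS]mulrC ltr_pM2r// ltr0n.
apply: (@le_trans _ _ (\int[mu]_(z in oarc e s r) slope n (q z) +
   \int[mu]_(z in oarc e r t) slope n (q z)))%E.
  apply: le_trans (leeD h1 h2); rewrite -EFinD lee_fin -mulrDl -mulrDr.
  rewrite ler_pM2r ?invr_gt0// ler_wpM2l ?weight_ge0//; exact: ler_distD.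
have m1 : measurable (oarc (G := G) e s r) by apply: measurable_oarc => //; lra.
have m2 : measurable (oarc (G := G) e r t) by apply: measurable_oarc => //; lra.
have mf (D : set (borel X)) : measurable_fun D (fun z => slope n (q z)).
  by apply: measurable_funTS; apply: measurableT_comp (measurable_slope n) measurable_q.
rewrite -ge0_integral_setU//; last 2 first.
- by move=> z _; exact: slope_ge0.
- rewrite disj_set2E; apply/eqP; rewrite -subset0.
  move=> z [[w /=]]; rewrite in_itv /= => wP <- [w' /=]; rewrite in_itv /= => w'P.
  have w'I : 0 <= w' <= 1 by lra.
  have wI : 0 < w < 1 by lra.
  by move=> E; have [_ E'] := arc_interior_eq GP wI w'I (esym E); lra.
apply: ge0_subset_integral => //.
- exact: measurableU.
- exact: measurable_oarc.
- by move=> z _; exact: slope_ge0.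
- move=> z [[w /=]|[w /=]]; rewrite in_itv /= => wP <-; exists w => //=; rewrite in_itv /=; lra.
Qed.

(* Lip f is an upper gradient along arcs: slope n is one for every n, because
   |f a - f b| / |a - b| is at most the slope at any point between a and b. *)
Lemma arc_Lip e s t : 0 <= s -> s <= t -> t <= 1 ->
  ((weight mu e * `|f (q (arc G e s)) - f (q (arc G e t))|)%:E <=
    (len G)%:E * \int[mu]_(z in oarc e s t) Lip f (q z))%E.
Proof.
move=> s0 st t1; have l0 := len_gt0 GP.
rewrite muleC -lee_pdivrMr// -EFinM.
have mA : measurable (oarc (G := G) e s t) by exact: measurable_oarc.
have fin : (mu (oarc e s t) < +oo)%E by rewrite muU.1// ltry.
have mcomp (h : borel Y -> \bar R) : measurable_fun setT h ->
    measurable_fun (oarc (G := G) e s t) (fun z => h (q z)).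
  by move=> mh; apply: measurable_funTS; exact: measurableT_comp mh measurable_q.
(* The Lipschitz constant dominates all slopes and is integrable over an arc of finite measure; this
   permits letting [n] tend to infinity. *)
have iL : mu.-integrable (oarc (G := G) e s t) (EFin \o cst L).
  apply: measurable_bounded_integrable => //.
  by exists L; split; [exact: num_real|move=> M LM z _ /=; rewrite ger0_norm// ltW].
have bound : \forall z \ae mu, forall n, oarc (G := G) e s t z ->
    (`|slope n (q z)| <= (EFin \o cst L) z)%E.
  by apply: aeW => z n _; rewrite gee0_abs ?slope_ge0// slope_le.
have cvx : \forall z \ae mu, oarc (G := G) e s t z ->
    slope n (q z) @[n --> \oo] --> Lip f (q z).
  by apply: aeW => z _; exact: slope_cvg.
have [_ _ cv] := dominated_convergence mA (fun n => mcomp _ (measurable_slope n))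
  (mcomp _ measurable_Lip) cvx iL bound.
apply: cvge_to_ge cv _; apply: nearW => n; exact: arc_slope.
Qed.

End AlongArcs.

End Slope.

(** Start of the recursion, at the finest level: [F] serves as its own vertex function. *)
Lemma approximable_top (R : realType) (X : pmetricType R) (G : graph R X)
    (mu : {measure set (borel X) -> \bar R}) (B : nat) (C : R)
    (F : borel X -> R) (g : borel X -> \bar R) n :
  tame G mu B C -> measurable_fun setT F -> measurable_fun setT g ->
  (forall z, (0 <= g z)%E) ->
  (forall (e : edge G) s t, 0 <= s -> s <= t -> t <= 1 ->
    ((weight mu e * `|F (arc G e s) - F (arc G e t)|)%:E <=
      (len G)%:E * \int[mu]_(z in oarc e s t) g z)%E) ->
  approximable mu F g n 1 G mu (fun x : borel X => x).
Proof.
move=> GT mF mg g0 ug; have GP := tame_graph GT; have L0 := len_gt0 GP; exists F.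
split=> [e|Es Ns uE uN EN]; first exact: (ug e 0 1 (lexx _) ler01 (lexx _)).
have step (e : edge G) : (mass (G := G) mu (fun x : borel X => x) (dev F (F (arc G e 0))) e <=
    (len G)%:E * mass (G := G) mu (fun x : borel X => x) g e)%E.
  rewrite /mass preimage_id; set c := F _; set J := integral _ _ g.
  have mI : measurable (icell (G := G) e) by exact: measurable_icell.
  have J0 : (0 <= J)%E by exact: integral_ge0.
  have md : measurable_fun (icell (G := G) e) (dev F c).
    by apply: measurable_funTS; exact: measurable_dev.
  have [w0|wn0] := eqVneq (weight mu e) 0.
    rewrite null_set_integral//; first by rewrite mule_ge0// lee_fin ltW.
    by rewrite (mu_icell (tame_arc GT)) w0.
  have wp : 0 < weight mu e by rewrite lt_def wn0 weight_ge0.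
  (* Bounds the deviation at every point of the edge, by the gradient inequality on the arc from the
     start of the edge to that point. *)
  pose K : \bar R := ((weight mu e)^-1%:E * ((len G)%:E * J))%E.
  have -> : ((len G)%:E * J = K * mu (icell e))%E.
    by rewrite (mu_icell (tame_arc GT)) /K [RHS]muleC muleA -EFinM divff// mul1e.
  rewrite -integral_cst//; apply: ge0_le_integral => //.
    by move=> z _; exact: dev_ge0.
  move=> z [w /=]; rewrite in_itv /= => wP <-.
  have w01 : 0 <= w <= 1 by rewrite !ltW//; case/andP: wP.
  rewrite /K lee_pdivlMl// /dev -EFinM distrC.
  have w0 : 0 <= w by case/andP: w01.
  have w1 : w <= 1 by case/andP: w01.
  apply: le_trans (ug e 0 w (lexx _) w0 w1) _; apply: lee_wpmul2l; first by rewrite lee_fin ltW.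
  apply: ge0_subset_integral => //; first by exact: measurable_oarc.
    exact: measurable_funTS.
  move=> y [v /=]; rewrite in_itv /= => /andP[v0 vw] <-; exists v => //=.
  by rewrite in_itv /= v0 (lt_le_trans vw).
apply: le_trans (lee_sum _ (fun e _ => step e)) _.
rewrite mul1r -ge0_sume_distrr; last by move=> e _; exact: mass_ge0.
apply: lee_wpmul2l; first by rewrite lee_fin ltW.
apply: (@sum_subset R {classic edge G}) => // [e eE|e]; last exact: mass_ge0.
by apply: (EN e) => //; exact: near_refl.
Qed.

Lemma diam_le (R : realType) (X : metricType R) (A : set X) r x y :
  (diam A <= r%:E)%E -> A x -> A y -> mdist x y <= r.
Proof.
move=> h Ax Ay; rewrite -lee_fin; apply: le_trans h; apply: ereal_sup_ubound.
by exists (x, y).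
Qed.

(** * Path lifting along open projections *)

Section OpenProjection.
Variables (R : realType) (X X' : pmetricType R) (G : graph R X) (G' : graph R X').
Variables (mu : {measure set (borel X) -> \bar R}) (mu' : {measure set (borel X') -> \bar R}).
Variables (B B' : nat) (C C' : R) (pi : X' -> X).
Variables (pe : edge G' -> edge G) (po : edge G' -> bool).
Hypothesis GT : tame G mu B C.
Hypothesis GT' : tame G' mu' B' C'.
Hypothesis lenE : len G' = len G.
Hypothesis piE : forall e t, 0 <= t <= 1 ->
  pi (arc G' e t) = arc G (pe e) (if po e then 1 - t else t).
Hypothesis pi_vertex : forall v, vertex G' v -> vertex G (pi v).
Hypothesis noloop : forall p : edge G, arc G p 0 <> arc G p 1.
Hypothesis pi_open : forall U : set X', open U -> open (pi @` U).
Let GP := tame_graph GT.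
Let GP' := tame_graph GT'.
Let L0 := len_gt0 GP.

Lemma proj_lipschitz x y : mdist (pi x) (pi y) <= mdist x y.
Proof.
apply: (lipschitz_from_graph GP') => e t t' t01 t'01; rewrite !piE// lenE.
apply: le_trans (mdist_arc GP _ _ _) _; [by case: (po e); lra|by case: (po e); lra|].
case: (po e) => //; rewrite (_ : 1 - t - (1 - t') = t' - t) ?[`|t' - t|]distrC//.
by ring.
Qed.

(** A path shorter than one edge leaves [e] through an end and cannot reach another vertex
    afterwards. *)
Lemma near_vertex_incident u e x : vertex G' u -> icell (G := G') e x ->
  mdist x u < len G' -> incident u e.
Proof.
move=> uv [t /=]; rewrite in_itv /= => t01 <- d.
have vend f s : 0 <= s <= 1 -> u = arc G' f s -> exists c : bool, s = c%:R.
  move=> s01 uE; case: (unit_cases s01) => // sI; exfalso.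
  by apply: (arc_interior GP' sI (e := f)); rewrite -uE.
have t01' : 0 <= t <= 1 by rewrite !ltW//; case/andP: t01.
case: (mdist_normal GP' d erefl t01') => [[s [s01 uE _]]|[c [l ll]]].
  by have [c cE] := vend _ _ s01 uE; rewrite uE cE; exact: incident_end.
case=> k [f [c' [s [wk s01 uE h]]]].
have [c'' c''E] := vend _ _ s01 uE.
have lt1 : k%:R + `|s - c'%:R| < 1.
  rewrite -(ltr_pM2l L0) mulr1 -lenE; apply: le_lt_trans ll; apply: le_trans h _.
  by rewrite gerBl mulr_ge0// lenE ltW.
have k0 : k = 0%N.
  apply/eqP; rewrite -leqn0 -ltnS -(ltr_nat R); apply: le_lt_trans lt1.
  by rewrite lerDl.
have cc : c'' = c'.
  move: lt1; rewrite k0 add0r c''E.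
  by case: (c''); case: (c') => //=; rewrite ?subr0 ?sub0r ?normrN normr1 ltxx.
rewrite uE c''E cc; move: wk; rewrite k0 => wk.
have -> : arc G' f c'%:R = arc G' e c%:R by inversion wk.
exact: incident_end.
Qed.

(** Over an interior point of [p], [u] lies inside a lift of [p], which can be followed. Over an end
    of [p], the point is to find a lift of [p] at [u]; this is where openness enters. *)
Lemma lift_segment u p t t' : 0 <= t <= 1 -> 0 <= t' <= 1 -> pi u = arc G p t ->
  exists2 w, pi w = arc G p t' & mdist u w <= len G' * `|t - t'|.
Proof.
move=> t01 t'01 uE.
have go e s : pe e = p -> 0 <= s <= 1 -> u = arc G' e s -> (if po e then 1 - s else s) = t ->
    exists2 w, pi w = arc G p t' & mdist u w <= len G' * `|t - t'|.
  move=> ep s01 -> tE; exists (arc G' e (if po e then 1 - t' else t')).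
    rewrite piE; last by case: (po e); lra.
    by rewrite ep; case: (po e) => //; rewrite subKr.
  apply: le_trans (mdist_arc GP' _ s01 _) _; first by case: (po e); lra.
  rewrite -tE; case: (po e) => //.
  by rewrite (_ : 1 - s - t' = - (s - (1 - t')))?normrN//; ring.
case: (unit_cases t01) => [tI|[b bE]].
  have pu : icell (G := G) p (pi u) by rewrite uE; exists t => //=; rewrite in_itv.
  have [e ep [s /=]] := icell_pi GT GT' piE pi_vertex pu.
  rewrite in_itv /= => sI usE; have s01 : 0 <= s <= 1 by rewrite !ltW//; case/andP: sI.
  apply: (go e s) => //.
  have E : arc G p t = arc G p (if po e then 1 - s else s) by rewrite -uE -usE piE// ep.
  have s'01 : 0 <= (if po e then 1 - s else s) <= 1 by case: (po e); lra.
  by have [_ ->] := arc_interior_eq GP tI s'01 E.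
have uv : vertex G' u.
  case: (arc_cover GP' u) => // -[e [s [sI usE]]]; exfalso.
  have s01 : 0 <= s <= 1 by rewrite !ltW//; case/andP: sI.
  have sI' : 0 < (if po e then 1 - s else s) < 1 by case: (po e); lra.
  by apply: (arc_interior GP sI' (e := pe e)); rewrite -piE// -usE uE bE; exact: vertex_end.
(* A point of p close to its end pi u lifts, by openness, to a point close to
   u; the edge containing this lift ends at u. *)
have [e ep inc] : exists2 e, pe e = p & incident u e.
  have oU := pi_open (open_mball u (len G')).
  have : nbhs (pi u) (pi @` ball u (len G')).
    apply: open_nbhs_nbhs; split=> //; exists u => //.
    by rewrite ballEmdist /= mdistxx lenE.
  move=> /nbhs_ballP[r /= r0 rU].
  (* Small enough for the point at parameter distance [a] from the end to lie inside the edge and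
     within [r] of the end. *)
  pose a : R := Num.min 2^-1 (r / (2 * len G)).
  have a0 : 0 < a by rewrite /a lt_min invr_gt0 ltr0n divr_gt0 ?mulr_gt0.
  have a1 : a < 1 by rewrite /a gt_min invf_lt1 ?ltr1n// ltr0n.
  pose c : R := if b then 1 - a else a.
  have cI : 0 < c < 1 by rewrite /c; case: (b); lra.
  have bc : `|b%:R - c| = a.
    rewrite /c; case: (b) => /=; last by rewrite sub0r normrN gtr0_norm.
    by rewrite opprB addrC subrK gtr0_norm.
  have [z] : (pi @` ball u (len G')) (arc G p c).
    apply: rU; rewrite ballEmdist /= uE bE.
    apply: le_lt_trans (mdist_arc GP _ (end_in _ _) _) _; first by rewrite !ltW//; case/andP: cI.
    rewrite bc; apply: (@le_lt_trans _ _ (len G * (r / (2 * len G)))).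
      by rewrite ler_pM2l// /a ge_min lexx orbT.
    have -> : len G * (r / (2 * len G)) = r / 2 by field; rewrite gt_eqF.
    by lra.
  rewrite ballEmdist /= => uz zE.
  have pz : icell (G := G) p (pi z) by rewrite zE; exists c => //=; rewrite in_itv.
  have [e ep ez] := icell_pi GT GT' piE pi_vertex pz.
  by exists e => //; apply: near_vertex_incident ez _ => //; rewrite metric_sym.
have [c uc] := incidentP inc.
apply: (go e c%:R) => //; first exact: end_in.
(* As [p] is not a loop, the end of [e] at [u] is the one over the end [b] of [p]. *)
move: uE; rewrite uc piE ?end_in// ep bE.
case: (po e) (c) (b) {bE uc} => [] [] [] //=; rewrite ?subr0 ?subrr => // h;
  by [case: (noloop h)|case: (noloop (esym h))].
Qed.

Lemma lift_chain u x y l : pi u = x -> chain G x y l ->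
  exists2 w, pi w = y & mdist u w <= l.
Proof.
move=> ux c; elim: c u ux => [x0 u ux|p t t' z k t01 t'01 _ IH u ux].
  by exists u => //; rewrite mdistxx.
have [w wE uw] := lift_segment t01 t'01 ux.
have [w' w'E ww'] := IH w wE; exists w' => //.
by apply: le_trans (metric_triangle _ w _) _; rewrite -lenE; exact: lerD.
Qed.

(** An almost shortest chain between the images, lifted from [u], ends in the fibre of [w], whose
    diameter is at most [D]. *)
Lemma mdist_proj (D : R) (u w : X') :
  (forall x y, pi x = pi y -> mdist x y <= D) ->
  mdist u w <= mdist (pi u) (pi w) + D.
Proof.
move=> fib; apply/ler_addgt0Pr => eps eps0.
have /(chain_mdist GP)[l c lr] : mdist (pi u) (pi w) < mdist (pi u) (pi w) + eps by lra.
have [w' w'E uw'] := lift_chain erefl c.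
apply: le_trans (metric_triangle _ w' _) _; have := fib _ _ w'E.
by lra.
Qed.

End OpenProjection.

(** * The levels of the system *)

Section Tower.
Variables (R : realType) (M : nat) (m : nat -> nat).
Hypothesis hm : forall i, (1 <= i)%N -> (3 <= m i <= M)%N.
Variables (T : target) (S : qsystem R m T) (C delta : R).
Hypothesis C0 : 0 < C.
Hypothesis delta0 : 0 < delta.
Hypothesis hS : admissible_with S C delta.
Local Notation s := (scale R m).

Lemma scale0 : s 0 = 1.
Proof. by rewrite /scale big_nil. Qed.

Lemma scaleS i : s i.+1 = s i / (m i.+1)%:R.
Proof. by rewrite /scale big_nat_recr. Qed.

Lemma m_ge3 i : (3 <= m i.+1)%N.
Proof. by have /andP[] := hm (ltn0Sn i). Qed.

Lemma m_leM i : (m i.+1 <= M)%N.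
Proof. by have /andP[] := hm (ltn0Sn i). Qed.

Lemma m_gt0 i : 0 < (m i.+1)%:R :> R.
Proof. by rewrite ltr0n (leq_trans _ (m_ge3 i)). Qed.

Lemma scale_gt0 i : 0 < s i.
Proof. by elim: i => [|i IH]; rewrite ?scale0 ?scaleS ?divr_gt0 ?m_gt0. Qed.

Lemma scale_half i : 2 * s i.+1 <= s i.
Proof.
rewrite scaleS mulrCA ger_pMr ?scale_gt0// ler_pdivrMr ?m_gt0// mul1r.
by rewrite ler_nat (leq_trans _ (m_ge3 i)).
Qed.

Lemma scale_leM i : s i <= M%:R * s i.+1.
Proof.
rewrite scaleS mulrCA ler_peMr ?(ltW (scale_gt0 _))// ler_pdivlMr ?m_gt0// mul1r.
by rewrite ler_nat m_leM.
Qed.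

Definition weight_ratio : R := Num.max 1 C.
(** An edge has two ends, each of which meets at most [C] edges. *)
Definition adjacency_bound : nat := 2 * Num.truncn C.

Lemma weight_ratio_ge1 : 1 <= weight_ratio. Proof. by rewrite /weight_ratio le_max lexx. Qed.

Section Level.
Variables (i k : nat).
Hypothesis ki : (k <= i)%N.

Lemma level_uniform : uniform_on_arcs (gr S i k) (meas S i k).
Proof. by apply: arclength_uniform; [exact: graphP|exact: mu_arclength]. Qed.

Lemma level_incident v : vertex (gr S i k) v -> exists l : seq {classic edge (gr S i k)},
  (size l <= Num.truncn C)%N /\ forall e : {classic edge (gr S i k)}, incident v e -> e \in l.
Proof.
move=> vv; have [n nC card] := adm_degree hS ki vv.
pose A : set {classic (edge (gr S i k) * bool)} := edge_ends (gr S i k) v.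
have Afin : finite_set A by apply/finite_set_leP; exists n.
pose l := finmap.enum_fset (fset_set A).
exists [seq (p.1 : {classic edge (gr S i k)}) | p <- l].
split.
  have card' : (A #<= `I_n)%card := card.
  rewrite size_map; apply: leq_trans (geq_card_fset_set card') _.
  by rewrite -ltnS -(ltr_nat R); apply: le_lt_trans nC (truncnS_gt _).
move=> e /incidentP[b vb].
pose eb : {classic (edge (gr S i k) * bool)} := (e, b).
have ebA : eb \in A by rewrite inE /A /edge_ends /= vb; case: (b).
have ebl : eb \in l by have := in_fset_set Afin eb; rewrite ebA => h; exact: h.
exact: (map_f (fun p : {classic (edge (gr S i k) * bool)} =>
  (p.1 : {classic edge (gr S i k)})) ebl).
Qed.

Lemma level_tame : tame (gr S i k) (meas S i k) adjacency_bound weight_ratio.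
Proof.
split.
- exact: graphP.
- exact: level_uniform.
- move=> e; have GP := graphP S ki.
  have [l0 [sz0 l0P]] := level_incident (vertex_end GP e false).
  have [l1 [sz1 l1P]] := level_incident (vertex_end GP e true).
  exists (l0 ++ l1); split.
    by rewrite size_cat /adjacency_bound mul2n -addnn leq_add.
  move=> f [v /incidentP[b ->] fv]; rewrite mem_cat; apply/orP.
  by case: b fv => fv; [right; exact: l1P|left; exact: l0P].
- move=> e f ef; have := adm_adjacent hS ki ef.
  have GP := graphP S ki.
  rewrite !(mu_cell GP level_uniform) -EFinM lee_fin => /le_trans; apply.
  by rewrite ler_wpM2r ?weight_ge0// /weight_ratio le_max lexx orbT.
- exact: weight_ratio_ge1.
Qed.

Local Notation Sub := (subdivide (gr S i k) (m i.+1)).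

Lemma level_m_gt0 : (0 < m i.+1)%N.
Proof. exact: leq_trans (m_ge3 i). Qed.

Lemma level_sub_tame : tame Sub (meas S i k) (adjacency_bound * m i.+1) weight_ratio.
Proof. exact: (sub_tame level_m_gt0 level_tame). Qed.

Lemma len_sub : len (gr S i.+1 k) = len Sub.
Proof. by rewrite (len_scale S (leqW ki)) /= (len_scale S ki) scaleS. Qed.

Lemma sub_noloops (p : edge Sub) : arc Sub p 0 <> arc Sub p 1.
Proof. apply: (sub_noloop level_m_gt0 level_tame); exact: leq_trans (m_ge3 i). Qed.

(** The third alternative of [simplicial], collapse to a vertex, is excluded by the height: it is
    isometric on edges and factors through the projection. *)
Lemma proj_edges : exists (proj_edge : edge (gr S i.+1 k) -> edge Sub) (proj_flip : edge (gr S i.+1 k) -> bool),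
  forall e t, 0 <= t <= 1 ->
    projn (arc (gr S i.+1 k) e t) = arc Sub (proj_edge e) (if proj_flip e then 1 - t else t).
Proof.
have [_ sE] := adm_pi_simplicial hS ki.
have ki1 := leqW ki; have GP := graphP S ki1.
have /choice[h hP] : forall e, exists pb : edge Sub * bool, forall t, 0 <= t <= 1 ->
    projn (arc (gr S i.+1 k) e t) = arc Sub pb.1 (if pb.2 then 1 - t else t).
  move=> e; case: (sE e) => [[p pP]|[p pP]|[v _ vP]].
  - by exists (p, false).
  - by exists (p, true).
  exfalso; have h01 : 0 < (2^-1 : R) < 1 by lra.
  have h01' : 0 <= (2^-1 : R) <= 1 by lra.
  have z01 : 0 <= (0 : R) <= 1 by lra.
  have : mdist (arc (gr S i.+1 k) e 0) (arc (gr S i.+1 k) e 2^-1) = 0.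
    rewrite -(h_isometric ki1 (arc_cell e z01) (arc_cell e h01')).
    by rewrite -!(adm_h_pi hS ki) !vP// mdistxx.
  move=> /mdist_positivity E; apply: (arc_interior GP h01 (e := e)).
  by rewrite -E; exact: (vertex_end GP e false).
by exists (fun e => (h e).1), (fun e => (h e).2).
Qed.

Definition proj_edge := sval (cid proj_edges).
Definition proj_flip := sval (cid (svalP (cid proj_edges))).

Lemma projE e t : 0 <= t <= 1 ->
  projn (arc (gr S i.+1 k) e t) = arc Sub (proj_edge e) (if proj_flip e then 1 - t else t).
Proof. exact: (svalP (cid (svalP (cid proj_edges)))). Qed.

Lemma proj_vertex v : vertex (gr S i.+1 k) v -> vertex Sub (projn v).
Proof. by have [+ _] := adm_pi_simplicial hS ki; exact. Qed.

End Level.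

(** A fibre has diameter at most [C * s i <= C * M * s i.+1], which is below [truncn (C * M) + 1]
    edges; [mdist_near] adds one. *)
Definition near_fiber : nat := (Num.truncn (C * M%:R)).+2.

Section Step.
Variables (i k : nat).
Hypothesis ki : (k <= i)%N.
Let ki1 : (k <= i.+1)%N := leqW ki.
Let GT' := level_tame ki1.
Let ST := level_sub_tame ki.

Lemma projn_fiber (x y : Xsp S i.+1 k) : projn x = projn y -> mdist x y <= C * s i.
Proof. by move=> xy; apply: (diam_le (adm_pi_fiber hS ki (projn y))). Qed.

Lemma projn_fiber_near (e f : edge (gr S i.+1 k)) : proj_edge ki e = proj_edge ki f -> near near_fiber e f.
Proof.
move=> ef; have over h : projn (arc (gr S i.+1 k) h (proj_flip ki h)%:R) =
    arc (subdivide (gr S i k) (m i.+1)) (proj_edge ki h) 0.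
  by rewrite (projE ki) ?end_in//; case: (proj_flip ki h); rewrite /= ?subrr.
have c h (b : bool) : cell h (arc (gr S i.+1 k) h b%:R) by apply: arc_cell; exact: end_in.
apply: (mdist_near GT' (c e (proj_flip ki e)) (c f (proj_flip ki f))).
apply: le_lt_trans (projn_fiber _) _; first by rewrite !over ef.
rewrite (len_scale S ki1); apply: (@le_lt_trans _ _ (C * (M%:R * s i.+1))).
  by rewrite ler_pM2l// scale_leM.
by rewrite mulrA ltr_pM2r ?scale_gt0// truncnS_gt.
Qed.

Lemma projn_lipschitz (x y : Xsp S i.+1 k) : mdist (projn x) (projn y) <= mdist x y.
Proof. exact: (proj_lipschitz ST GT' (len_sub ki) (projE ki)). Qed.

Lemma projn_mdist (x y : Xsp S i.+1 k) :
  mdist x y <= mdist (projn x) (projn y) + C * s i.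
Proof.
apply: (mdist_proj ST GT' (len_sub ki) (projE ki) (@proj_vertex _ _ ki)
  (sub_noloops ki) (@adm_pi_open _ _ _ _ _ _ hS _ _ ki)).
exact: projn_fiber.
Qed.

Lemma projn_measurable : measurable_fun setT
  (@projn _ _ _ S i k : borel (Xsp S i.+1 k) -> borel (Xsp S i k)).
Proof.
by apply: (@lipschitz_borel R _ _ 1) => x y; rewrite mul1r; exact: projn_lipschitz.
Qed.

Section Compose.
Variables (d : measure_display) (Om : measurableType d) (P : {measure set Om -> \bar R}).
Variable Q : Om -> Xsp S i.+1 k.
Hypothesis QP : pushes P (meas S i.+1 k) Q.

Lemma pushes_projn : pushes P (meas S i k) (@projn _ _ _ S i k \o Q).
Proof.
split; first exact: measurableT_comp projn_measurable QP.1.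
move=> A mA; rewrite comp_preimage -(adm_pi_measure hS ki mA) QP.2//.
by rewrite -[X in measurable X]setTI; exact: projn_measurable.
Qed.

(** The increase of the constant in [approximable_proj] for [n = near_fiber]. *)
Definition step_cost : R :=
  near_fiber.+1%:R * weight_ratio ^+ near_fiber * (adjacency_bound ^ near_fiber)%:R.

Lemma step_cost_ge0 : 0 <= step_cost.
Proof. apply: mulr_ge0 => //; apply: mulr_ge0 => //; apply: exprn_ge0.
exact: le_trans ler01 weight_ratio_ge1. Qed.

Variables (F : Om -> R) (g : Om -> \bar R).
Hypothesis mF : measurable_fun setT F.
Hypothesis mg : measurable_fun setT g.
Hypothesis g0 : forall z, (0 <= g z)%E.

(** With K the step cost, K + 2 becomes 2K + 2 after averaging and 1 + (2K + 2)/m after undoing the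
    subdivision, which is at most K + 2 because m >= 3. *)
Lemma approximable_step :
  approximable P F g near_fiber (step_cost + 2) (gr S i.+1 k) (meas S i.+1 k) Q ->
  approximable P F g near_fiber (step_cost + 2) (gr S i k) (meas S i k) (@projn _ _ _ S i k \o Q).
Proof.
have K0 := step_cost_ge0.
move=> /(approximable_proj mF mg g0 ST GT' QP pushes_projn projn_measurable (len_sub ki)
  (projE ki) (@proj_vertex _ _ ki) (sub_noloops ki)
  (@adm_star _ _ _ _ _ _ hS _ _ ki) projn_fiber_near) h.
have {}h := h (addr_ge0 K0 (ler0n _ _)).
have {h} := approximable_sub mF mg g0 (level_m_gt0 i) (level_tame ki) pushes_projn _ h.
move=> /(_ (addr_ge0 (addr_ge0 K0 (ler0n _ _)) K0)).
apply: approximable_le => //; first by rewrite (len_scale S ki) ltW// scale_gt0.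
have m3 : 3 <= (m i.+1)%:R :> R by rewrite (ler_nat R 3) m_ge3.
rewrite -/step_cost.
suff : (step_cost + 2 + step_cost) / (m i.+1)%:R <= step_cost + 1 by lra.
rewrite ler_pdivrMr ?m_gt0//; apply: (@le_trans _ _ ((step_cost + 1) * 3)); first by lra.
by rewrite ler_wpM2l// addr_ge0.
Qed.

End Compose.

End Step.

Fixpoint pcomp (n a k : nat) : Xsp S (n + a) k -> Xsp S a k :=
  match n with
  | 0 => fun x => x
  | n'.+1 => fun x => pcomp (projn x)
  end.

Section Iterate.
Variables (a k : nat).
Hypothesis ka : (k <= a)%N.
Let kn n : (k <= n + a)%N := leq_trans ka (leq_addl n a).

Lemma pcomp_lipschitz n (x y : Xsp S (n + a) k) : mdist (pcomp x) (pcomp y) <= mdist x y.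
Proof.
elim: n x y => //= n IH x y; apply: le_trans (IH _ _) _.
exact: (projn_lipschitz (kn n)).
Qed.

(** One projection from level b+1 to b costs [C * s b], at most [2 * C * (s b - s b.+1)] as scales
    at least halve; in this form the errors telescope. *)
Lemma pcomp_mdist n (x y : Xsp S (n + a) k) :
  mdist x y <= mdist (pcomp x) (pcomp y) + 2 * C * (s a - s (n + a)).
Proof.
elim: n x y => [|n IH] x y; first by rewrite subrr mulr0 addr0.
apply: le_trans (projn_mdist (kn n) _ _) _.
have h := IH (projn x) (projn y).
rewrite -[(n.+1 + a)%N]/(n + a).+1.
have : C * (2 * s (n + a).+1) <= C * s (n + a) by rewrite ler_pM2l// scale_half.
by lra.
Qed.

Lemma pushes_pcomp n d (Om : measurableType d) (P : {measure set Om -> \bar R})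
    (Q : Om -> Xsp S (n + a) k) :
  pushes P (meas S (n + a) k) Q -> pushes P (meas S a k) (@pcomp n a k \o Q).
Proof.
elim: n Q => [//|n IH] Q QP.
by have := IH _ (pushes_projn (kn n) QP).
Qed.

Lemma approximable_pcomp n d (Om : measurableType d) (P : {measure set Om -> \bar R})
    (Q : Om -> Xsp S (n + a) k) (F : Om -> R) (g : Om -> \bar R) :
  measurable_fun setT F -> measurable_fun setT g -> (forall z, 0 <= g z)%E ->
  pushes P (meas S (n + a) k) Q ->
  approximable P F g near_fiber (step_cost + 2) (gr S (n + a) k) (meas S (n + a) k) Q ->
  approximable P F g near_fiber (step_cost + 2) (gr S a k) (meas S a k) (@pcomp n a k \o Q).
Proof.
move=> mF mg g0; elim: n Q => [//|n IH] Q QP h.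
have h' := approximable_step (kn n) QP mF mg g0 h.
exact: (IH _ (pushes_projn (kn n) QP) h').
Qed.

End Iterate.

(** * Quotient maps at a fixed scale *)

Section Quotients.
Variables (i l : nat).
Let li n : (n + l <= i)%N -> (l <= i)%N := leq_trans (leq_addl n l).

Lemma quotn_lipschitz k (x y : Xsp S i k) : (k < i)%N ->
  mdist (quotn x) (quotn y) <= mdist x y.
Proof.
move=> ki; have [_ sE] := adm_q_simplicial hS ki.
have GP := graphP S (ltnW ki); have GP1 := graphP S ki.
have lenE : len (gr S i k) = len (gr S i k.+1).
  by rewrite (len_scale S (ltnW ki)) (len_scale S ki).
apply: (lipschitz_from_graph GP) => e t t' t01 t'01.
case: (sE e) => [[p pP]|[p pP]|[v _ vP]].
- by rewrite !pP// lenE; exact: mdist_arc.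
- rewrite !pP// lenE; apply: le_trans (mdist_arc GP1 _ _ _) _; [lra|lra|].
  by rewrite (_ : 1 - t - (1 - t') = t' - t) ?[`|t' - t|]distrC//; ring.
- by rewrite !vP// mdistxx mulr_ge0// ltW// (len_gt0 GP).
Qed.

Lemma qcomp_lipschitz n (x y : Xsp S i l) : (n + l <= i)%N ->
  mdist (qcomp n x) (qcomp n y) <= mdist x y.
Proof.
elim: n => //= n IH ni; apply: le_trans (quotn_lipschitz _ _ ni) _.
by apply: IH; exact: ltnW.
Qed.

Lemma qcomp_surj n : (n + l <= i)%N -> forall y : Xsp S i (n + l), exists x, qcomp n x = y.
Proof.
elim: n => [_ y|n IH ni y]; first by exists y.
have [x _ <-] := adm_q_surj hS ni (I : [set: Xsp S i (n + l).+1] y).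
by have [z <-] := IH (ltnW ni) x; exists z.
Qed.

Lemma qcomp_measurable n : (n + l <= i)%N -> measurable_fun setT
  (@qcomp _ _ _ S i l n : borel (Xsp S i l) -> borel (Xsp S i (n + l))).
Proof.
by move=> ni; apply: (@lipschitz_borel R _ _ 1) => x y; rewrite mul1r; exact: qcomp_lipschitz.
Qed.

Lemma qcomp_measure n : (n + l <= i)%N ->
  forall A : set (borel (Xsp S i (n + l))), measurable A ->
  meas S i l (@qcomp _ _ _ S i l n @^-1` A) = meas S i (n + l) A.
Proof.
elim: n => [//|n IH] ni A mA; rewrite -(adm_q_measure hS ni mA).
rewrite /pushforward -IH ?(ltnW ni)//.
rewrite -[X in measurable X]setTI.
have : measurable_fun setT (@quotn _ _ _ S i (n + l) : borel _ -> borel _).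
  by apply: (@lipschitz_borel R _ _ 1) => x y; rewrite mul1r; exact: quotn_lipschitz.
by apply.
Qed.

(* Hypothesis (10) bounds the preimages of small balls only; cutting paths
   into short pieces extends the bound to all pairs of points. *)
Lemma qcomp_mdist_nat n (N : nat) (x y : Xsp S i l) : (n + l <= i)%N ->
  mdist (qcomp n x) (qcomp n y) < N%:R * (delta * s l / 2) ->
  mdist x y <= N%:R * (C * s l).
Proof.
move=> ni; have GP := graphP S ni.
have e0 : 0 < delta * s l / 2 by rewrite divr_gt0// mulr_gt0// scale_gt0.
suff key c : chain (gr S i (n + l)) (qcomp n x) (qcomp n y) c ->
    c < N%:R * (delta * s l / 2) -> mdist x y <= N%:R * (C * s l).
  by move=> /(chain_mdist GP)[c ch cl]; exact: key cl.
elim: N c x y => [|N IH] c x y ch cl.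
  by have := chain_ge0 GP ch; rewrite mul0r in cl; lra.
(* Halving [delta * s l] puts the radius strictly inside the range allowed in [adm_q_fiber]. *)
have small (u w : Xsp S i l) : mdist (qcomp n u) (qcomp n w) < delta * s l / 2 -> mdist u w <= C * s l.
  move=> uw; have rP : 0 < delta * s l / 2 < delta * s l by lra.
  apply: (diam_le (adm_q_fiber hS ni (qcomp n u) rP)); rewrite /= ballEmdist /= ?mdistxx//.
have [c1|c1] := ltP c (delta * s l / 2).
  apply: le_trans (small _ _ (le_lt_trans (mdist_chain GP ch) c1)) _.
  by rewrite ler_peMl ?ler1n// mulr_ge0// ltW// scale_gt0.
have N0 : 0 < N.+1%:R :> R by rewrite ltr0n.
(* A fraction 1/(N+1) of the path is cut off: short enough for [small], while the rest suits the
   induction. Surjectivity lifts the cutting point. *)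
pose a := c / N.+1%:R.
have aE : a * N.+1%:R = c by rewrite /a divfK// gt_eqF.
have ae : a < delta * s l / 2 by rewrite /a ltr_pdivrMr// mulrC.
have c0 : 0 <= c by lra.
have a0 : 0 <= a by rewrite divr_ge0.
have ac : c - a = a * N%:R by rewrite -aE -natr1 mulrDr mulr1 addrK.
have aca : 0 <= a <= c by rewrite a0 -subr_ge0 ac mulr_ge0.
have [z [ch1 ch2]] := chain_split GP ch aca.
have [w wz] := qcomp_surj ni z; rewrite -wz in ch1 ch2.
have d1 := small _ _ (le_lt_trans (mdist_chain GP ch1) ae).
apply: le_trans (metric_triangle _ w _) _; rewrite -natr1 mulrDl mul1r addrC.
apply: lerD => //.
have Np : (0 < N)%N.
  by case: (N) cl => //; rewrite mul1r ltNge c1.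
apply: (IH (c - a)) => //.
by rewrite ac mulrC ltr_pM2l// ltr0n.
Qed.

End Quotients.

End Tower.

(** * Doubling and Poincare inequality on a ball *)

Section MeanOscillation.
Variables (R : realType) (X : pmetricType R) (mu : {measure set (borel X) -> \bar R}).
Implicit Types (x : X) (r tau D K : R).

(** An unnormalised form with a free constant [c] in place of the mean, which is easier to transport
    between spaces; [controlled_mean] recovers the Poincaré inequality. *)
Definition controlled x r tau D K :=
  (mu (ball x (tau * r)) <= D%:E * mu (ball x r))%E /\
  forall (f : X -> R) (L : R), 0 <= L -> (forall y z, `|f y - f z| <= L * mdist y z) ->
    exists c : R, (\int[mu]_(y in ball x r : set (borel X)) `|f y - c|%:E <=
      (K * r)%:E * \int[mu]_(y in ball x (tau * r) : set (borel X)) Lip f y)%E.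

Lemma controlled_le x r tau D K D' K' : 0 <= r -> D <= D' -> K <= K' ->
  controlled x r tau D K -> controlled x r tau D' K'.
Proof.
move=> r0 DD KK [h1 h2]; split.
  by apply: le_trans h1 _; apply: lee_wpmul2r => //; rewrite lee_fin.
move=> f L L0 fL; have [c h] := h2 f L L0 fL; exists c; apply: le_trans h _.
apply: lee_wpmul2r; first by apply: integral_ge0 => y _; exact: Lip_ge0.
by rewrite lee_fin ler_wpM2r.
Qed.

Lemma ball_subset x r r' : r <= r' -> ball x r `<=` ball x r'.
Proof. by move=> rr y; rewrite !ballEmdist /= => /lt_le_trans; apply. Qed.

Lemma lipschitz_measurable (f : X -> R) L :
  (forall y z, `|f y - f z| <= L * mdist y z) ->
  measurable_fun setT (f : borel X -> R).
Proof.
move=> fL; have cf : continuous (f : X -> R^o).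
  apply: (@lipschitz_continuous R X R^o L) => y z.
  by rewrite [leLHS]/mdist /= distrC; exact: fL.
apply: (@measurability _ _ (borel X) R setT f (@RGenOInfty.G R)).
  exact: RGenOInfty.measurableE.
move=> _ [_ [a ->] <-]; rewrite setTI; apply: borel_open.
apply: (@open_comp X R^o) => [y _|]; first exact: cf.
exact: interval_open.
Qed.

Lemma integral_dev_le (D : set (borel X)) (f : X -> R) (c c' : R) :
  measurable D -> measurable_fun setT (f : borel X -> R) ->
  (\int[mu]_(y in D) `|f y - c|%:E <=
   \int[mu]_(y in D) `|f y - c'|%:E + `|c' - c|%:E * mu D)%E.
Proof.
move=> mD mf.
have md a : measurable_fun D (fun y : borel X => `|f y - a|%:E).
  exact: (measurable_funTS (measurable_dev mf a)).
rewrite -integral_cst// -ge0_integralD//; last by move=> y _; rewrite lee_fin.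
apply: ge0_le_integral => //; first exact: emeasurable_funD.
move=> y _; rewrite /= -EFinD lee_fin.
by rewrite (_ : f y - c = (f y - c') + (c' - c)) ?ler_normD//; ring.
Qed.

Lemma mean_dev_le (D : set (borel X)) (f : X -> R) (c : R) (b : R) :
  measurable D -> 0 < b -> mu D = b%:E -> mu.-integrable D (fun y => (f y)%:E) ->
  (`|fine (mean mu D (fun y => (f y)%:E)) - c|%:E * b%:E <=
    \int[mu]_(y in D) `|f y - c|%:E)%E.
Proof.
move=> mD b0 bE intf; have If := integrable_fin_num mD intf.
have intc : mu.-integrable D (fun y => (cst c y)%:E).
  apply: (@measurable_bounded_integrable _ (borel X) R mu (cst c) D) => //.
    by rewrite bE ltry.
  by exists `|c|; split; [exact: num_real|move=> M0 cM z _; exact: ltW].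
apply: le_trans (_ : `|\int[mu]_(y in D) ((f y)%:E - (cst c y)%:E)| <= _)%E; last first.
  apply: le_trans (le_abse_integral _ mD _) _ => //.
  by apply: (measurable_int mu); exact: integrableB.
rewrite integralB_EFin// [X in (_ - X)%E](integral_cst mu mD c%:E) bE /mean bE /=.
set I := integral _ _ _ in If *.
rewrite -(fineK If) -EFinM -EFinD /= lee_fin.
rewrite -[X in _ * X <= _](gtr0_norm b0) -normrM /=.
by rewrite (_ : (b^-1 * fine I - c) * b = fine I - c * b)//; field; rewrite gt_eqF.
Qed.

(** The mean is at least half as good as any other constant, whence the 2; normalising by the
    measure of the dilated ball instead of the ball costs [D]. *)
Lemma controlled_mean x r tau D K (f : X -> R) (fB : R) :
  0 < r -> 1 <= tau -> 0 <= D -> 0 <= K ->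
  controlled x r tau D K -> metric_lipschitz f ->
  fB = fine (mean mu (ball x r) (fun y => (f y)%:E)) ->
  (mean mu (ball x r) (fun y => `|f y - fB|%:E) <=
    (2 * K * D * r)%:E * mean mu (ball x (tau * r)) (Lip f))%E.
Proof.
move=> r0 tau1 D0 K0 [dbl pi] [L0 fL0] fBE.
pose L := Num.max 0 L0.
have L_ge0 : 0 <= L by rewrite /L le_max lexx.
have fL y z : `|f y - f z| <= L * mdist y z.
  by apply: le_trans (fL0 y z) _; rewrite ler_wpM2r ?mdist_ge0// /L le_max lexx orbT.
have [c hc] := pi f L L_ge0 fL.
have mB rho : measurable (ball x rho : set (borel X)) by exact: borel_ball.
have J0 rho : (0 <= \int[mu]_(y in ball x rho : set (borel X)) Lip f y)%E.
  by apply: integral_ge0 => y _; exact: Lip_ge0.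
have KD0 : 0 <= 2 * K * D * r by rewrite !mulr_ge0// ltW.
have Rge0 : (0 <= (2 * K * D * r)%:E * mean mu (ball x (tau * r)) (Lip f))%E.
  by apply: mule_ge0; [rewrite lee_fin|apply: mule_ge0 => //; rewrite lee_fin invr_ge0 fine_ge0].
(* [fine] is 0 for null and for infinite measure; in both cases the left-hand mean is 0 by the
   convention on inverses. *)
have [b0|bn0] := eqVneq (fine (mu (ball x r))) 0.
  by rewrite {1}/mean b0 invr0 mul0e.
set b := fine (mu (ball x r)) in bn0.
have bfin : mu (ball x r) \is a fin_num.
  by move: bn0; rewrite /b; case: (mu (ball x r)) => //=; rewrite eqxx.
have bE : mu (ball x r) = b%:E by rewrite fineK.
have b_gt0 : 0 < b by rewrite lt_def bn0 fine_ge0.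
set B' : set (borel X) := ball x (tau * r).
have BB' : ball x r `<=` B' by apply: ball_subset; rewrite ler_peMl// ltW.
have b'fin : mu B' \is a fin_num.
  by rewrite ge0_fin_numE//; apply: le_lt_trans dbl _; rewrite bE -EFinM ltry.
set b' := fine (mu B'); have b'E : mu B' = b'%:E by rewrite fineK.
have bb' : b <= b'.
  by rewrite -lee_fin -bE -b'E; apply: le_measure; rewrite ?inE//; exact: mB.
have b'0 : 0 < b' by exact: lt_le_trans bb'.
have b'D : b' <= D * b by rewrite -lee_fin EFinM -bE -b'E.
have mf := lipschitz_measurable fL.
have intf : mu.-integrable (ball x r : set (borel X)) (fun y => (f y)%:E).
  apply: (@measurable_bounded_integrable _ (borel X) R mu f) => //.
  - by rewrite bE ltry.
  - exact: measurable_funTS.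
  exists (`|f x| + L * r); split; first exact: num_real.
  move=> M0 hM y; rewrite ballEmdist /= => xy; apply: ltW; apply: le_lt_trans hM.
  rewrite (_ : f y = f x + (f y - f x)); last by ring.
  apply: le_trans (ler_normD _ _) _; rewrite lerD2l distrC.
  by apply: le_trans (fL _ _) _; rewrite ler_wpM2l// ltW.
have hm := mean_dev_le c (mB r) b_gt0 bE intf.
have h2 := integral_dev_le fB c (mB r) mf.
set I := (\int[mu]_(y in ball x r : set (borel X)) `|f y - c|%:E)%E in hc hm h2.
have h3 : (\int[mu]_(y in ball x r : set (borel X)) `|f y - fB|%:E <= 2%:E * I)%E.
  apply: le_trans h2 _; rewrite bE (_ : 2 = 1 + 1 :> R)// EFinD.
  rewrite ge0_muleDl// mul1e; apply: leeD => //.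
  by rewrite distrC fBE.
rewrite {1}/mean -/b.
apply: (@le_trans _ _ ((b^-1)%:E * (2%:E * ((K * r)%:E * \int[mu]_(y in B') Lip f y))))%E.
  apply: lee_wpmul2l; first by rewrite lee_fin invr_ge0 ltW.
  by apply: le_trans h3 _; apply: lee_wpmul2l.
rewrite /mean -/B' -/b' !muleA -!EFinM; apply: lee_wpmul2r; first exact: J0.
rewrite lee_fin.
rewrite (_ : b^-1 * 2 * (K * r) = 2 * K * r / b); last by ring.
rewrite (_ : 2 * K * D * r / b' = 2 * K * r * (D / b')); last by ring.
rewrite ler_wpM2l ?mulr_ge0 ?(ltW r0)//.
by rewrite ler_pdivlMr// mulrC ler_pdivrMr.
Qed.

End MeanOscillation.

Lemma push_integral (R : realType) d (Om : measurableType d)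
    (P : {measure set Om -> \bar R}) (X : pmetricType R)
    (mu : {measure set (borel X) -> \bar R}) (Q : Om -> X)
    (D : set (borel X)) (h : borel X -> \bar R) :
  pushes P mu Q -> measurable D -> measurable_fun setT h -> (forall y, 0 <= h y)%E ->
  (\int[mu]_(y in D) h y = \int[P]_(z in Q @^-1` D) h (Q z))%E.
Proof.
move=> [mQ QP] mD mh h0.
rewrite -(ge0_integral_pushforward mQ P mD); last 2 first.
- exact: measurable_funTS.
- by move=> y _; exact: h0.
by apply: eq_measure_integral => A mA _; rewrite /= /pushforward QP.
Qed.

Section SinglePoint.
Variables (R : realType) (X : pmetricType R) (mu : {measure set (borel X) -> \bar R}).

Lemma controlled_single (x : X) (r tau : R) : (forall y, y = x) -> 0 < r -> 1 <= tau ->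
  controlled mu x r tau 1 0.
Proof.
move=> hx r0 tau1; have ballT rho : 0 < rho -> ball x rho = [set: X].
  by move=> rho0; apply/seteqP; split=> // y _; rewrite (hx y); exact: ballxx.
split; first by rewrite !ballT ?mul1e// mulr_gt0// (lt_le_trans ltr01).
move=> f L L0 fL; exists (f x); rewrite mul0r mul0e integral0_eq//.
by move=> y _; rewrite (hx y) subrr normr0.
Qed.

End SinglePoint.

Lemma measure_bigsetU_le (R : realType) d (Om : measurableType d)
    (P : {measure set Om -> \bar R}) (I : Type) (s : seq I) (A : I -> set Om) :
  (forall i, measurable (A i)) ->
  (P (\big[setU/set0]_(i <- s) A i) <= \sum_(i <- s) P (A i))%E.
Proof.
move=> mA; elim: s => [|i s IH]; first by rewrite !big_nil measure0.
rewrite !big_cons; apply: le_trans (measureU2 _ (mA i) _) _.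
  exact: bigsetU_measurable.
by apply: leeD.
Qed.

(* Balls of X of radius comparable to the edges of G are described by the edges
   of G through X <- Y -> Z: both maps shrink distances by at most a factor and
   the length of an edge. *)
Section Transfer.
Variables (R : realType) (X Y Z : pmetricType R) (G : graph R Z).
Variables (muX : {measure set (borel X) -> \bar R}) (muY : {measure set (borel Y) -> \bar R}).
Variables (muZ : {measure set (borel Z) -> \bar R}) (B : nat) (C : R).
Variables (q : Y -> X) (P : Y -> Z) (A : R).
Local Notation s := (len G).
Hypothesis GT : tame G muZ B C.
Hypothesis q1 : forall u w, mdist (q u) (q w) <= mdist u w.
Hypothesis P1 : forall u w, mdist (P u) (P w) <= mdist u w.
Hypothesis A1 : 1 <= A.
Hypothesis qA : forall u w, mdist u w <= A * (mdist (q u) (q w) + s).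
Hypothesis PA : forall u w, mdist u w <= A * (mdist (P u) (P w) + s).
Hypothesis qP : pushes muY muX (q : borel Y -> X).
Hypothesis PP : pushes muY muZ (P : borel Y -> Z).
Hypothesis Zcells : forall z : Z, exists e : edge G, cell e z.
Let GP := tame_graph GT.
Let L0 := len_gt0 GP.
Let A0 : 0 < A. Proof. exact: lt_le_trans A1. Qed.
Let C0 : 0 <= C. Proof. exact: le_trans ler01 (tame_ge1 GT). Qed.

Variables (x : X) (y0 : Y) (e0 : edge G).
Hypothesis y0x : q y0 = x.
Hypothesis y0e : cell e0 (P y0).

Local Notation E := {classic edge G}.

Lemma cover_ball rho (N : nat) u : A * (rho + s) <= N%:R * s -> mdist x (q u) < rho ->
  exists2 f : edge G, near N.+1 e0 f & cell f (P u).
Proof.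
move=> rN xu; have [f fu] := Zcells (P u); exists f => //.
apply: (mdist_near GT y0e fu); apply: le_lt_trans (P1 _ _) _.
apply: le_lt_trans (qA _ _) _; apply: lt_le_trans rN.
by rewrite ltr_pM2l// y0x ltrD2r.
Qed.

(** [near_mdist] gives [k + 1] edge lengths in [Z], and the additive error in [PA] one more. *)
Lemma mdist_of_near k f u : near k e0 f -> cell f (P u) ->
  mdist x (q u) <= A * (k.+2%:R * s).
Proof.
move=> e0f fu; rewrite -y0x; apply: le_trans (q1 _ _) _; apply: le_trans (PA _ _) _.
rewrite ler_pM2l// -natr1 mulrDl mul1r lerD2r; exact: near_mdist GT _ _ _ _ _ e0f y0e fu.
Qed.

Lemma weight_from_base k f : near k e0 f -> weight muZ f <= C ^+ k * weight muZ e0.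
Proof. by move=> h; apply: (weight_near GT); exact: near_sym. Qed.

Lemma ball_measure_le rho N : A * (rho + s) <= N%:R * s ->
  (muX (ball x rho) <= ((B ^ N.+1)%:R * C ^+ N.+1 * weight muZ e0)%:E)%E.
Proof.
move=> rN; pose D := \big[setU/set0]_(f <- nbh GT N.+1 e0) cell (G := G) f.
have mc (f : E) : measurable (cell (G := G) f : set (borel Z)).
  by rewrite cellE; exact: measurable_carc.
have mD : measurable (D : set (borel Z)) by apply: bigsetU_measurable => f _; exact: mc.
rewrite -qP.2; last exact: borel_ball.
apply: (@le_trans _ _ (muZ D)).
  rewrite -PP.2//; apply: le_measure; rewrite ?inE.
  - by apply: (measurable_pre qP); exact: borel_ball.
  - exact: (measurable_pre PP).
  move=> u; rewrite /= ballEmdist /= => /(cover_ball rN)[f e0f fu].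
  by rewrite /D -bigcup_seq; exists f => //=; apply/nbhP.
apply: le_trans (measure_bigsetU_le _ _ mc) _.
apply: (@le_trans _ _ (\sum_(f <- nbh GT N.+1 e0) (C ^+ N.+1 * weight muZ e0)%:E)%E).
  apply: lee_sum_mem => f /nbhP e0f; rewrite (mu_cell GP (tame_arc GT)) lee_fin.
  exact: weight_from_base.
rewrite sum_const; last by rewrite lee_fin mulr_ge0 ?exprn_ge0// weight_ge0.
rewrite -mulrA [leRHS]EFinM; apply: lee_wpmul2r.
  by rewrite lee_fin mulr_ge0 ?exprn_ge0// weight_ge0.
by rewrite lee_fin ler_nat nbh_size.
Qed.

Lemma ball_measure_ge r : A * (2 * s) < r -> ((weight muZ e0)%:E <= muX (ball x r))%E.
Proof.
move=> sr; rewrite -(mu_icell (tame_arc GT)) -PP.2; last exact: measurable_icell.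
rewrite -qP.2; last exact: borel_ball.
apply: le_measure; rewrite ?inE.
- by apply: (measurable_pre PP); exact: measurable_icell.
- by apply: (measurable_pre qP); exact: borel_ball.
move=> u /= eu; rewrite ballEmdist /=; apply: le_lt_trans sr.
apply: (@mdist_of_near 0 e0 u) => //; apply: oarc_cell eu; rewrite ?lexx//.
Qed.

(** The constant is the value of [u] at the start of [e0]. On each edge meeting the ball, [f \o q]
    is first compared with [u] at the start of that edge (term [kappa]), and this value with [c]
    along a chain of at most [N + 2] edges through the discrete gradient. *)
Lemma transfer_oscillation (n N : nat) (kappa r tau : R) (f : X -> R) (L : R) :
  0 <= kappa -> 0 <= L -> (forall y z, `|f y - f z| <= L * mdist y z) ->
  approximable muY (f \o q : borel Y -> R) (fun z : borel Y => Lip f (q z)) n kappa G muZ P ->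
  A * (r + s) <= N%:R * s -> A * ((n + N).+3%:R * s) < tau * r ->
  exists c : R, (\int[muX]_(y in ball x r : set (borel X)) `|f y - c|%:E <=
    ((kappa + (B ^ N.+1)%:R * (N.+2%:R * C ^+ N.+1 * C ^+ N.+1)) * s)%:E *
    \int[muX]_(y in ball x (tau * r) : set (borel X)) Lip f y)%E.
Proof.
move=> k0 Lge0 fL [u [u1 u2]] rN tauN; exists (u (arc G e0 0)); set c := u _.
have mf := lipschitz_measurable fL.
have mF : measurable_fun setT (f \o q : borel Y -> R) by exact: measurableT_comp mf qP.1.
have mg : measurable_fun setT (fun z : borel Y => Lip f (q z)).
  exact: (measurableT_comp (measurable_Lip Lge0 fL) qP.1).
have g0 (z : borel Y) : (0 <= Lip f (q z))%E by exact: Lip_ge0.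
have mB rho : measurable (ball x rho : set (borel X)) by exact: borel_ball.
pose Es : seq E := nbh GT N.+1 e0; pose Ns : seq E := nbh GT (n + N.+1) e0.
pose D0 : set (borel Z) := \big[setU/set0]_(h <- Es) cell (G := G) h.
pose D1 : set (borel Z) := \big[setU/set0]_(h <- Ns) icell (G := G) h.
have mc (h : E) : measurable (cell (G := G) h : set (borel Z)).
  by rewrite cellE; exact: measurable_carc.
have mi (h : E) : measurable (icell (G := G) h : set (borel Z)) by exact: measurable_icell.
have mD0 : measurable D0 by exact: bigsetU_measurable.
have mD1 : measurable D1 by exact: bigsetU_measurable.
pose ends (h : E) : set (borel Z) := [set arc G h 0] `|` [set arc G h 1].
have mends h : measurable (ends h) by apply: measurableU; exact: borel_set1.
(* The ball is covered by closed edges whereas masses refer to open ones; the difference consists of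
   end points, a null set. *)
pose N0 : set (borel Z) := \big[setU/set0]_(h <- Es) ends h.
have mN0 : measurable N0 by exact: bigsetU_measurable.
have N00 : muZ N0 = 0%E.
  apply/eqP; rewrite -measure_le0; apply: le_trans (measure_bigsetU_le _ _ mends) _.
  rewrite big1// => h _; apply: null_set_setU.
  - exact: borel_set1.
  - exact: borel_set1.
  - exact: ((tame_arc GT).2 h 0 (end_in R false)).
  - exact: ((tame_arc GT).2 h 1 (end_in R true)).
have d0 a (z : borel Y) : (0 <= dev (f \o q : borel Y -> R) a z)%E by exact: dev_ge0.
have step1 : (\int[muX]_(y in ball x r : set (borel X)) `|f y - c|%:E <=
    \sum_(h <- Es) mass (G := G) muY P (dev (f \o q : borel Y -> R) c) h)%E.
  rewrite (push_integral (h := fun y => `|f y - c|%:E) qP (mB r)); last 2 first.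
  - exact: (measurable_dev mf c).
  - by move=> y; rewrite lee_fin.
  rewrite -(integral_bigcells GT PP (A := D0)).
  - apply: ge0_subset_integral.
    + by apply: (measurable_pre qP); exact: mB.
    + exact: (measurable_pre PP).
    + exact: (measurable_funTS (measurable_dev mF c)).
    + by move=> z _; exact: d0.
    move=> z; rewrite /= ballEmdist /= => /(cover_ball rN)[h e0h hz].
    by rewrite /D0 -bigcup_seq; exists h => //=; apply/nbhP.
  - exact: nbh_uniq.
  - exact: mD0.
  - exact: measurable_dev.
  - exact: d0.
  - move=> h hE z hz; rewrite /D0 -bigcup_seq; exists h => //.
    by apply: oarc_cell hz; rewrite ?lexx.
  - exists N0; first by split.
    move=> z; rewrite /D0 /N0 -!bigcup_seq => -[h hE hz] nz; exists h => //.
    have [t t01 zE] := cell_arc hz; exists t => //=.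
    case: (unit_cases t01) => [|[b bE]]; first by rewrite in_itv.
    by exfalso; apply: nz; exists h => //; rewrite zE bE; case: (b); [right|left].
have T (h : E) : h \in Es -> ((weight muZ h * `|u (arc G h 0) - c|)%:E <=
    (N.+2%:R * C ^+ N.+1 * C ^+ N.+1)%:E *
    \sum_(h' <- Es) s%:E * mass (G := G) muY P (fun z : borel Y => Lip f (q z)) h')%E.
  move=> /nbhP e0h; rewrite ge0_sume_distrr; last first.
    by move=> h' _; rewrite mule_ge0 ?lee_fin ?(ltW L0)// mass_ge0.
  pose osc (h' : E) := `|u (arc G h' 0) - u (arc G h' 1)|.
  apply: (@le_trans _ _ (\sum_(h' <- Es)
      (N.+2%:R * C ^+ N.+1 * C ^+ N.+1)%:E * (weight muZ h' * osc h')%:E)%E); last first.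
    apply: lee_sum => h' _; apply: lee_wpmul2l; last exact: u1.
    by rewrite lee_fin !mulr_ge0 ?exprn_ge0.
  under eq_bigr do rewrite -EFinM.
  rewrite sumEFin lee_fin.
  have dl : `|u (arc G h 0) - c| <= N.+2%:R * \sum_(h' <- Es) osc h'.
    rewrite distrC; apply: (@osc_near _ _ _ u N.+1 e0 h false false Es) => //.
    by move=> h' e0h'; apply/nbhP.
  apply: le_trans (ler_wpM2l (weight_ge0 _ _) dl) _.
  rewrite mulrCA !mulr_sumr big_seq [leRHS]big_seq; apply: ler_sum => h' /nbhP e0h'.
  (* The weights of [h] and [h'] are compared through [e0], hence two powers of [C]. *)
  rewrite -!mulrA ler_wpM2l// !mulrA ler_wpM2r// ?normr_ge0//.
  apply: le_trans (weight_from_base e0h) _; rewrite -mulrA ler_wpM2l ?exprn_ge0//.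
  exact: weight_near GT _ _ _ e0h'.
apply: le_trans step1 _.
apply: (@le_trans _ _ (\sum_(h <- Es)
   (mass (G := G) muY P (dev (f \o q : borel Y -> R) (u (arc G h 0))) h +
    (weight muZ h * `|u (arc G h 0) - c|)%:E))%E).
  by apply: lee_sum => h _; exact: (mass_dev mF GT PP).
rewrite big_split /=.
set g : borel Y -> \bar R := fun z => Lip f (q z).
have sub : {subset Es <= Ns}.
  by move=> h /nbhP e0h; apply/nbhP; apply: near_le e0h; rewrite leq_addl.
have mg0 (h : E) : (0 <= mass (G := G) muY P g h)%E by exact: mass_ge0.
have S0 : (0 <= \sum_(h <- Ns) mass (G := G) muY P g h)%E by apply: sume_ge0 => h _.
have K0 : 0 <= N.+2%:R * C ^+ N.+1 * C ^+ N.+1 by rewrite !mulr_ge0 ?exprn_ge0.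
set K := N.+2%:R * C ^+ N.+1 * C ^+ N.+1 in T K0 *.
have part2 : (\sum_(h <- Es) (weight muZ h * `|u (arc G h 0) - c|)%:E <=
    ((B ^ N.+1)%:R * K * s)%:E *
    \sum_(h <- Ns) mass (G := G) muY P g h)%E.
  apply: le_trans (lee_sum_mem T) _; rewrite sum_const; last first.
    rewrite mule_ge0 ?lee_fin//; apply: sume_ge0 => h _.
    by rewrite mule_ge0 ?lee_fin ?(ltW L0).
  rewrite -mulrA [X in (_ <= X * _)%E]EFinM -muleA; apply: lee_pmul.
  - by rewrite lee_fin.
  - rewrite mule_ge0 ?lee_fin//; apply: sume_ge0 => h _.
    by rewrite mule_ge0 ?lee_fin ?(ltW L0).
  - by rewrite lee_fin ler_nat nbh_size.
  rewrite [X in (_ <= X * _)%E]EFinM -muleA; apply: lee_wpmul2l; first by rewrite lee_fin.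
  rewrite -ge0_sume_distrr//; apply: lee_wpmul2l; first by rewrite lee_fin ltW.
  by apply: (@sum_subset R E) => //; exact: nbh_uniq.
have part1 : (\sum_(h <- Es) mass (G := G) muY P (dev (f \o q : borel Y -> R) (u (arc G h 0))) h <=
    (kappa * s)%:E * \sum_(h <- Ns) mass (G := G) muY P g h)%E.
  apply: u2; [exact: nbh_uniq|exact: nbh_uniq|].
  move=> h h' /nbhP e0h hh'; apply/nbhP; exact: near_add e0h hh'.
apply: le_trans (leeD part1 part2) _.
have ks0 : 0 <= kappa * s by rewrite mulr_ge0// ltW.
have BK0 : 0 <= (B ^ N.+1)%:R * K * s by apply: mulr_ge0; [apply: mulr_ge0 => //|exact: ltW].
rewrite -ge0_muleDl; [|by rewrite lee_fin|by rewrite lee_fin].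
rewrite -EFinD -mulrDl.
apply: lee_wpmul2l; first by rewrite lee_fin mulrDl addr_ge0.
rewrite (push_integral qP (mB _) (measurable_Lip Lge0 fL)); last by move=> y; exact: Lip_ge0.
rewrite -(integral_bigcells GT PP (A := D1)).
- apply: ge0_subset_integral.
  + exact: (measurable_pre PP).
  + by apply: (measurable_pre qP); exact: mB.
  + exact: measurable_funTS.
  + by move=> z _; exact: g0.
  move=> z; rewrite /= /D1 -bigcup_seq => -[h /= /nbhP e0h hz]; rewrite ballEmdist /=.
  apply: le_lt_trans tauN; rewrite -addnS; apply: mdist_of_near e0h _.
  by apply: oarc_cell hz; rewrite ?lexx.
- exact: nbh_uniq.
- exact: mD1.
- exact: mg.
- exact: g0.
- by move=> h hE z hz; rewrite /D1 -bigcup_seq; exists h.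
- exists set0; first by split; [exact: measurable0|exact: measure0].
  by move=> z; rewrite /D1 -bigcup_seq => -[h hE hz] _; exists h.
Qed.

End Transfer.

(** * Balls whose radius is a bounded number of edge lengths *)

Section GraphScale.
Variables (R : realType) (X : pmetricType R) (G : graph R X).
Variables (mu : {measure set (borel X) -> \bar R}) (B : nat) (C : R).
Hypothesis GT : tame G mu B C.
Local Notation s := (len G).
Let GP := tame_graph GT.
Let L0 := len_gt0 GP.
Let C1 := tame_ge1 GT.
Let C0 : 0 <= C. Proof. exact: le_trans ler01 C1. Qed.

Lemma walk_mdist n v w : walk G n v w -> mdist v w <= n%:R * s.
Proof.
elim=> [u|k e b y _ IH]; first by rewrite mdistxx mul0r.
apply: le_trans (metric_triangle _ (arc G e (~~ b)%:R) _) _.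
rewrite -natr1 mulrDl mul1r addrC; apply: lerD => //.
apply: le_trans (mdist_arc GP _ (end_in R b) (end_in R (~~ b))) _.
by rewrite ler_piMr ?(ltW L0)//; case: (b); rewrite /= ?subr0 ?sub0r ?normrN normr1.
Qed.

Section Paths.
Variables (f : X -> R) (L : R) (x : X) (rho : R).
Hypothesis Lge0 : 0 <= L.
Hypothesis fL : forall y z, `|f y - f z| <= L * mdist y z.
Let J := (\int[mu]_(y in ball x rho : set (borel X)) Lip f y)%E.

Let J0 : (0 <= J)%E.
Proof. by apply: integral_ge0 => y _; exact: Lip_ge0. Qed.

Lemma segment_oscillation e t t' : 0 <= t <= 1 -> 0 <= t' <= 1 ->
  mdist x (arc G e t) + s * `|t - t'| < rho ->
  ((weight mu e * `|f (arc G e t) - f (arc G e t')|)%:E <= s%:E * J)%E.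
Proof.
move=> t01 t'01 h.
have key a b : 0 <= a -> a <= b -> b <= 1 -> (forall u, a < u < b -> `|t - u| <= `|t - t'|) ->
    ((weight mu e * `|f (arc G e a) - f (arc G e b)|)%:E <= s%:E * J)%E.
  move=> a0 ab b1 near_t.
  apply: le_trans (@arc_Lip _ _ f L Lge0 fL _ G mu GP (tame_arc GT) (fun y => y)
    (fun _ _ => lexx _) e a b a0 ab b1) _.
  apply: lee_wpmul2l; first by rewrite lee_fin ltW.
  apply: ge0_subset_integral.
  - exact: measurable_oarc.
  - exact: borel_ball.
  - by apply: measurable_funTS; exact: measurable_Lip Lge0 fL.
  - by move=> y _; exact: Lip_ge0.
  move=> y [u /=]; rewrite in_itv /= => uP <-; rewrite ballEmdist /=.
  apply: le_lt_trans h; apply: le_trans (metric_triangle _ (arc G e t) _) _.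
  rewrite lerD2l; apply: le_trans (mdist_arc GP _ t01 _) _; first by lra.
  by rewrite ler_pM2l//; exact: near_t.
have [tt'|t't] := leP t t'.
  apply: key => //; [lra|lra|move=> u uP].
  by rewrite !ler0_norm; lra.
rewrite distrC; apply: key => //; [lra|exact: ltW|lra|move=> u uP].
by rewrite !ger0_norm; lra.
Qed.

(** The weight of the starting edge is exchanged for that of the edge being crossed, at the price of
    one factor [C] per step. *)
Lemma walk_oscillation n v w (e : edge G) : walk G n v w -> incident v e ->
  mdist x v + n%:R * s < rho ->
  ((weight mu e * `|f v - f w|)%:E <= (n%:R * C ^+ n * s)%:E * J)%E.
Proof.
move=> wk; elim: wk e => {v w} [u|k g b y wk IH] e ve.
  by rewrite subrr normr0 mulr0 !mul0r mul0e.
rewrite -natr1 mulrDl mul1r => h.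
set v := arc G g b%:R in ve h *; set u := arc G g (~~ b)%:R in wk IH *.
have bb : `|b%:R - (~~ b)%:R| = 1 :> R.
  by case: (b); rewrite /= ?subr0 ?sub0r ?normrN normr1.
have h1 : ((weight mu g * `|f v - f u|)%:E <= s%:E * J)%E.
  apply: segment_oscillation; [exact: end_in|exact: end_in|].
  have : 0 <= k%:R * s by rewrite mulr_ge0// ltW.
  by rewrite bb mulr1; rewrite /v in h; lra.
have h2 : ((weight mu g * `|f u - f y|)%:E <= (k%:R * C ^+ k * s)%:E * J)%E.
  apply: IH; first exact: incident_end.
  have := mdist_arc GP g (end_in R b) (end_in R (~~ b)); rewrite bb mulr1 -/v -/u.
  by have := metric_triangle x v u; lra.
have eg : weight mu e <= C * weight mu g.
  by apply: (tame_adjacent GT); exists v => //; exact: incident_end.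
apply: (@le_trans _ _ (C%:E * ((weight mu g * `|f v - f u|)%:E + (weight mu g * `|f u - f y|)%:E))%E).
  rewrite -EFinD -EFinM lee_fin -mulrDr mulrA; apply: ler_pM => //; first exact: weight_ge0.
  exact: ler_distD.
apply: le_trans (lee_wpmul2l _ (leeD h1 h2)) _; first by rewrite lee_fin.
have s0 := ltW L0; have Ck : 1 <= C ^+ k by apply: exprn_ege1.
rewrite -ge0_muleDl ?lee_fin ?mulr_ge0 ?exprn_ge0// muleA -EFinD -EFinM.
apply: lee_wpmul2r => //; rewrite lee_fin exprS.
rewrite (_ : (_ + 1) * _ * s = C * (C ^+ k * s + k%:R * C ^+ k * s)); last by ring.
by rewrite ler_wpM2l// lerD2r ler_peMl.
Qed.

End Paths.

Variables (e0 : edge G) (t0 : R).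
Hypothesis t01 : 0 <= t0 <= 1.
Local Notation x := (arc G e0 t0).

(** In normal form the path is a part of [e0], fewer than [N] full edges and a part of a last edge.
    Being shorter than [r], it stays in the ball over which [Lip f] is integrated. *)
Lemma path_oscillation (f : X -> R) L (N : nat) r rho y : 0 <= L ->
  (forall y z, `|f y - f z| <= L * mdist y z) ->
  r <= N%:R * s -> r <= rho -> mdist x y < r ->
  ((weight mu e0 * `|f x - f y|)%:E <= (N.+2%:R * C ^+ N.+1 * s)%:E *
    \int[mu]_(y in ball x rho : set (borel X)) Lip f y)%E.
Proof.
move=> Lge0 fL rN rr xy; have s0 := ltW L0.
set J := integral _ _ _.
have J0 : (0 <= J)%E by apply: integral_ge0 => z _; exact: Lip_ge0.
have CN n : (n <= N)%N -> C ^+ n <= C ^+ N.+1.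
  by move=> nN; rewrite ler_weXn2l// ltnW.
have C1N : 1 <= C ^+ N.+1 by apply: exprn_ege1.
case: (mdist_normal GP xy erefl t01) => [[t' [t'01 -> h]]|[b [l lr [n [g [b' [t [wk tP -> h]]]]]]]].
  apply: le_trans (segment_oscillation (x := x) (rho := rho) Lge0 fL t01 t'01 _) _.
    by rewrite mdistxx add0r; exact: lt_le_trans rr.
  apply: lee_wpmul2r => //; rewrite lee_fin ler_peMl// mulr_ege1// ler1n//.
set v := arc G e0 b%:R in wk; set w := arc G g b'%:R in wk.
have p1 : 0 <= s * `|t0 - b%:R| by rewrite mulr_ge0.
have p2 : 0 <= s * `|t - b'%:R| by rewrite mulr_ge0.
have xv : mdist x v <= s * `|t0 - b%:R| by apply: mdist_arc => //; exact: end_in.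
have vw := walk_mdist wk.
have xw := metric_triangle x v w.
rewrite mulrDr (mulrC s n%:R) in h.
have nN : (n < N)%N.
  rewrite -(ltr_nat R) -(ltr_pM2r L0); lra.
have h1 : ((weight mu e0 * `|f x - f v|)%:E <= s%:E * J)%E.
  apply: (segment_oscillation Lge0 fL t01 (end_in R b)).
  have : 0 <= n%:R * s by rewrite mulr_ge0.
  by rewrite mdistxx; lra.
have h2 : ((weight mu e0 * `|f v - f w|)%:E <= (n%:R * C ^+ n * s)%:E * J)%E.
  by apply: (walk_oscillation Lge0 fL wk); [exact: incident_end|lra].
have h3 : ((weight mu g * `|f w - f (arc G g t)|)%:E <= s%:E * J)%E.
  by apply: (segment_oscillation Lge0 fL (end_in R b') tP); rewrite distrC -/w; lra.
have w3 : weight mu e0 <= C ^+ N.+1 * weight mu g.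
  apply: (weight_near GT); apply: near_le (_ : (n.+1 <= N.+1)%N) _; first by rewrite ltnS ltnW.
  exact: walk_near wk (incident_end e0 b) (incident_end g b').
have d : `|f x - f (arc G g t)| <= `|f x - f v| + `|f v - f w| + `|f w - f (arc G g t)|.
  by apply: le_trans (ler_distD (f w) _ _) _; rewrite lerD2r ler_distD.
apply: (@le_trans _ _ ((weight mu e0 * `|f x - f v|)%:E + (weight mu e0 * `|f v - f w|)%:E
  + (C ^+ N.+1)%:E * (weight mu g * `|f w - f (arc G g t)|)%:E)%E).
  rewrite -EFinM -!EFinD lee_fin; apply: le_trans (ler_wpM2l (weight_ge0 mu e0) d) _.
  by rewrite !mulrDr lerD2l mulrA ler_wpM2r.
apply: le_trans (leeD (leeD h1 h2) (lee_wpmul2l _ h3)) _; first by rewrite lee_fin exprn_ge0.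
rewrite muleA -EFinM -!ge0_muleDl ?lee_fin ?addr_ge0 ?mulr_ge0 ?exprn_ge0//.
apply: lee_wpmul2r => //; rewrite -!EFinD lee_fin -[X in X + _ + _]mul1r -!mulrDl.
rewrite ler_wpM2r// -addn2 natrD.
apply: (@le_trans _ _ (C ^+ N.+1 + n%:R * C ^+ N.+1 + C ^+ N.+1)).
  by rewrite lerD2r; apply: lerD => //; rewrite ler_wpM2l// CN// ltnW.
have nN' : n%:R <= N%:R :> R by rewrite ler_nat ltnW.
have := ler_wpM2r (exprn_ge0 N.+1 C0) nN'.
by lra.
Qed.

(** The bound must be linear in [rho] for small balls too: the ball meets [e0] in an arc around
    [t0], and otherwise enters edges through their ends, in arcs of parameter length at most
    [rho / s]. *)
Lemma graph_ball_le (N : nat) rho : 0 < rho -> rho <= N%:R * s ->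
  (mu (ball x rho) <= (2 * ((B ^ N.+1)%:R * C ^+ N.+1 + 1) * weight mu e0 * (rho / s))%:E)%E.
Proof.
move=> rho0 rN; have s0 := ltW L0; pose a := rho / s.
have a0 : 0 < a by exact: divr_gt0.
have aE : s * a = rho by rewrite /a mulrC divfK// gt_eqF.
pose lo u : R := Num.max 0 u; pose hi u : R := Num.min 1 u.
pose ends (g : {classic edge G}) : set (borel X) :=
  carc (G := G) g 0 (hi a) `|` carc (G := G) g (lo (1 - a)) 1.
pose mid : set (borel X) := carc (G := G) e0 (lo (t0 - a)) (hi (t0 + a)).
pose D : set (borel X) := \big[setU/set0]_(g <- nbh GT N.+1 e0) ends g.
have lo0 u : 0 <= lo u by rewrite /lo le_max lexx.
have hi1 u : hi u <= 1 by rewrite /hi ge_min lexx.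
have m1 (g : edge G) : measurable (carc (G := G) g 0 (hi a)) by exact: measurable_carc.
have m2 (g : edge G) : measurable (carc (G := G) g (lo (1 - a)) 1) by exact: measurable_carc.
have mE g : measurable (ends g) by exact: measurableU.
have mM : measurable mid by exact: measurable_carc.
have mD : measurable D by apply: bigsetU_measurable => g _.
have cover : ball x rho `<=` mid `|` D.
  move=> y; rewrite ballEmdist /= => xy.
  have inE u v t : 0 <= t <= 1 -> u <= t -> t <= v -> (`[lo u, hi v]%classic : set R) t.
    by move=> /andP[? ?] ? ?; rewrite /= in_itv /= /lo /hi ge_max le_min; apply/and3P; split => //; apply/andP.
  case: (mdist_normal GP xy erefl t01) => [[t' [t'01 -> h]]|[b [l lr [n [g [b' [t [wk tP -> h]]]]]]]].
    left; exists t' => //; rewrite -aE ltr_pM2l// ltr_norml in h.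
    by apply: inE => //; lra.
  have p1 : 0 <= s * `|t0 - b%:R| by rewrite mulr_ge0.
  have p2 : 0 <= s * `|t - b'%:R| by rewrite mulr_ge0.
  have p3 : 0 <= n%:R * s by rewrite mulr_ge0.
  rewrite mulrDr (mulrC s n%:R) in h.
  have nN : (n < N)%N by rewrite -(ltr_nat R) -(ltr_pM2r L0); lra.
  right; rewrite /D -bigcup_seq; exists g => /=.
    apply/nbhP; apply: near_le (_ : (n.+1 <= N.+1)%N) _; first by rewrite ltnS ltnW.
    exact: walk_near wk (incident_end e0 b) (incident_end g b').
  have : `|t - b'%:R| < a by rewrite -(ltr_pM2l L0) aE; lra.
  rewrite (dist_end b' tP); case: b' {wk h p2} => ta; [right|left]; exists t => //=.
    rewrite in_itv /= /lo ge_max (andP tP).1 (andP tP).2 /= andbT; lra.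
  rewrite in_itv /= /hi le_min (andP tP).1 (andP tP).2 /=; lra.
have muM : (mu mid <= (weight mu e0 * (2 * a))%:E)%E.
  rewrite /mid (mu_carc GP (tame_arc GT))//; last first.
    by rewrite /lo /hi ge_max !le_min; move: t01 => /andP[? ?]; apply/andP; split; apply/andP; split; lra.
  rewrite lee_fin ler_wpM2l ?weight_ge0//.
  have : t0 - a <= lo (t0 - a) by rewrite /lo le_max lexx orbT.
  have : hi (t0 + a) <= t0 + a by rewrite /hi ge_min lexx orbT.
  by lra.
have muE (g : edge G) : (mu (ends g) <= (weight mu g * (2 * a))%:E)%E.
  apply: le_trans (measureU2 _ (m1 g) (m2 g)) _.
  have loE : 1 - a <= lo (1 - a) by rewrite /lo le_max lexx orbT.
  have hiE : hi a <= a by rewrite /hi ge_min lexx orbT.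
  have h1 : (mu (carc (G := G) g 0 (hi a)) <= (weight mu g * a)%:E)%E.
    rewrite (mu_carc GP (tame_arc GT))//; last by rewrite /hi le_min; apply/andP; split; lra.
    by rewrite lee_fin subr0 ler_wpM2l ?weight_ge0.
  have h2 : (mu (carc (G := G) g (lo (1 - a)%R) 1) <= (weight mu g * a)%:E)%E.
    rewrite (mu_carc GP (tame_arc GT))//; last by rewrite /lo ge_max; apply/andP; split; lra.
    by rewrite lee_fin ler_wpM2l ?weight_ge0//; lra.
  apply: le_trans (leeD h1 h2) _.
  by rewrite -EFinD lee_fin -mulrDr mulr2n mulrDl mul1r.
have cw0 : 0 <= C ^+ N.+1 * weight mu e0 * (2 * a).
  apply: mulr_ge0; first by rewrite mulr_ge0 ?exprn_ge0 ?weight_ge0.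
  by rewrite mulr_ge0// ltW.
have muD : (mu D <= ((B ^ N.+1)%:R * (C ^+ N.+1 * weight mu e0 * (2 * a)))%:E)%E.
  apply: le_trans (measure_bigsetU_le _ _ mE) _.
  apply: (@le_trans _ _ (\sum_(g <- nbh GT N.+1 e0) (C ^+ N.+1 * weight mu e0 * (2 * a))%:E)%E).
    apply: lee_sum_mem => g /nbhP e0g; apply: le_trans (muE g) _.
    rewrite lee_fin ler_wpM2r//; first by lra.
    by apply: (weight_near GT); exact: near_sym.
  rewrite sum_const; last by rewrite lee_fin.
  rewrite [leRHS]EFinM; apply: lee_wpmul2r; first by rewrite lee_fin.
  by rewrite lee_fin ler_nat nbh_size.
apply: (@le_trans _ _ (mu (mid `|` D))).
  by apply: le_measure; rewrite ?inE//; [exact: borel_ball|exact: measurableU].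
apply: le_trans (measureU2 _ mM mD) _; apply: le_trans (leeD muM muD) _.
rewrite -EFinD lee_fin -/a le_eqVlt; apply/orP; left; apply/eqP; ring.
Qed.

(** An arc of parameter length [a <= 1/2] starting at [t0] towards the farther end stays on [e0],
    and it is short enough to stay in the ball. *)
Lemma graph_ball_ge (N : nat) r : 0 < r -> (0 < N)%N -> r <= N%:R * s ->
  ((weight mu e0 * (r / (2 * N%:R * s)))%:E <= mu (ball x r))%E.
Proof.
move=> r0 N0 rN; have N1 : 1 <= N%:R :> R by rewrite ler1n.
have d0 : 0 < 2 * N%:R * s by rewrite !mulr_gt0// ltr0n.
set a := r / _; have a0 : 0 < a by exact: divr_gt0.
have a2 : a <= 2^-1 by rewrite /a ler_pdivrMr//; lra.
have sa : s * a < r.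
  have E : r = a * (2 * N%:R * s) by rewrite /a divfK// gt_eqF.
  have : 0 < s * a by rewrite mulr_gt0.
  move=> sa0; rewrite [ltRHS]E (_ : a * _ = 2 * N%:R * (s * a)); last by ring.
  by rewrite ltr_pMl//; lra.
have key u v : 0 <= u -> v <= 1 -> v - u = a -> u <= t0 <= v ->
    ((weight mu e0 * a)%:E <= mu (ball x r))%E.
  move=> u0 v1 uv t0uv; rewrite -uv -(mu_carc GP (tame_arc GT))//; last by lra.
  apply: le_measure; rewrite ?inE; [exact: measurable_carc|exact: borel_ball|].
  move=> y [w /=]; rewrite in_itv /= => wP <-; rewrite ballEmdist /=.
  apply: le_lt_trans sa; apply: le_trans (mdist_arc GP _ t01 _) _; first by lra.
  by rewrite ler_pM2l// ler_norml; lra.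
have [t2|t2] := leP t0 2^-1; [apply: (key t0 (t0 + a))|apply: (key (t0 - a) t0)];
  rewrite ?(andP t01).1 ?(andP t01).2//; lra.
Qed.

(** At this scale the oscillation is bounded even pointwise, by a multiple of [s / weight]; the
    measure of the ball contributes [weight * r / s], leaving the factor [r]. *)
Lemma controlled_graph (N N' : nat) r tau : 0 < r -> (0 < N)%N -> 1 <= tau ->
  r <= N%:R * s -> tau * r <= N'%:R * s ->
  controlled mu x r tau
    (4 * ((B ^ N'.+1)%:R * C ^+ N'.+1 + 1) * tau * N%:R)
    (2 * ((B ^ N.+1)%:R * C ^+ N.+1 + 1) * (N.+2%:R * C ^+ N.+1)).
Proof.
move=> r0 N0 tau1 rN rN'; have s0 := ltW L0; have tau0 : 0 < tau by lra.
have NR : 0 < N%:R :> R by rewrite ltr0n.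
have rr : r <= tau * r by rewrite ler_peMl// ltW.
split.
  apply: le_trans (graph_ball_le _ rN') _; first exact: mulr_gt0.
  have /(lee_wpmul2l _) h := graph_ball_ge r0 N0 rN.
  set D := 4 * _ * _ * _; have D0 : 0 <= D.
    by rewrite /D !mulr_ge0 ?addr_ge0 ?mulr_ge0 ?exprn_ge0// ltW.
  apply: le_trans (h D%:E _); last by rewrite lee_fin.
  rewrite -EFinM lee_fin le_eqVlt; apply/orP; left; apply/eqP; rewrite /D.
  by field; rewrite !gt_eqF.
move=> f L Lge0 fL; exists (f x); set J := (X in (_ * X)%E).
have J0 : (0 <= J)%E by apply: integral_ge0 => y _; exact: Lip_ge0.
have mB : measurable (ball x r : set (borel X)) by exact: borel_ball.
have ub := graph_ball_le r0 rN.
have mf := lipschitz_measurable fL.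
set K1 := 2 * _ in ub *; set K2 := N.+2%:R * _.
have K10 : 0 <= K1 by rewrite /K1 mulr_ge0 ?addr_ge0 ?mulr_ge0 ?exprn_ge0.
have K20 : 0 <= K2 by rewrite /K2 mulr_ge0 ?exprn_ge0.
have [w0|wn0] := eqVneq (weight mu e0) 0.
  rewrite null_set_integral//; last 2 first.
  - exact: (measurable_funTS (measurable_dev mf (f x))).
  - by apply/eqP; rewrite -measure_le0; apply: le_trans ub _; rewrite w0 mulr0 mul0r.
  by apply: mule_ge0 => //; rewrite lee_fin; apply: mulr_ge0; [exact: mulr_ge0|exact: ltW].
have wp : 0 < weight mu e0 by rewrite lt_def wn0 weight_ge0.
pose c : \bar R := (((weight mu e0)^-1)%:E * ((K2 * s)%:E * J))%E.
have c0 : (0 <= c)%E.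
  apply: mule_ge0; first by rewrite lee_fin invr_ge0 ltW.
  by apply: mule_ge0 => //; rewrite lee_fin; exact: mulr_ge0.
apply: (@le_trans _ _ (\int[mu]_(y in ball x r : set (borel X)) cst c y)%E).
  apply: ge0_le_integral => //.
  - exact: (measurable_funTS (measurable_dev mf (f x))).
  move=> y; rewrite ballEmdist /= => xy; rewrite /c lee_pdivlMl// -EFinM distrC.
  exact: path_oscillation Lge0 fL rN rr xy.
rewrite integral_cst//; apply: le_trans (lee_wpmul2l c0 ub) _.
rewrite /c muleA -EFinM muleAC -EFinM.
apply: lee_wpmul2r => //; rewrite lee_fin le_eqVlt; apply/orP; left; apply/eqP.
by field; rewrite !gt_eqF.
Qed.

End GraphScale.

(** * All scales *)

(** An edge has at least two points, its start and its middle, so every point of the graph is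
    distinct from some other one and [on_arc] applies. *)
Lemma cells_of_edge (R : realType) (X : pmetricType R) (G : graph R X) :
  is_metric_graph G -> edge G -> forall z : X, exists f : edge G, cell f z.
Proof.
move=> GP e z.
have [y yz] : exists y, y <> z.
  have h01 : 0 < (2^-1 : R) < 1 by lra.
  have [z0|nz0] := pselect (arc G e 0 = z); last by exists (arc G e 0).
  exists (arc G e 2^-1) => E; apply: (arc_interior GP h01 (e := e)); rewrite E -z0.
  exact: (vertex_end GP e false).
have [f [t [t01 ->]]] := on_arc GP yz.
by exists f; exact: arc_cell.
Qed.

Section AllScales.
Variables (R : realType) (M : nat) (m : nat -> nat).
Hypothesis hm : forall i, (1 <= i)%N -> (3 <= m i <= M)%N.
Variables (T : target) (S : qsystem R m T) (C delta : R).
Hypothesis C0 : 0 < C.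
Hypothesis delta0 : 0 < delta.
Hypothesis hS : admissible_with S C delta.
Local Notation s := (scale R m).
Let s0 i : 0 < s i := scale_gt0 R hm i.

(** [2 * C] comes from the telescoped fibre bounds, [2 * C / delta] from cutting paths into pieces
    of length [delta * s j / 2], each costing [C * s j]. *)
Definition distortion : R := Num.max 1 (Num.max (2 * C) (2 * C / delta)).
Local Notation A := distortion.

Lemma distortion_ge1 : 1 <= A. Proof. by rewrite /A le_max lexx. Qed.
Let A1 := distortion_ge1.

Lemma qcomp_distortion n1 j i (u w : Xsp S i j) : (n1 + j <= i)%N ->
  mdist u w <= A * (mdist (qcomp n1 u) (qcomp n1 w) + s j).
Proof.
move=> ji; have d0 : 0 < delta * s j / 2 by rewrite divr_gt0// mulr_gt0.
set d := mdist (qcomp _ _) _; have dge0 : 0 <= d by exact: mdist_ge0.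
have dd0 : 0 <= d / (delta * s j / 2) by rewrite divr_ge0// ltW.
have /(qcomp_mdist_nat hm C0 delta0 hS ji) h :
    d < (Num.truncn (d / (delta * s j / 2))).+1%:R * (delta * s j / 2).
  by rewrite -ltr_pdivrMr// truncnS_gt.
apply: le_trans h _.
apply: (@le_trans _ _ ((d / (delta * s j / 2) + 1) * (C * s j))).
  by rewrite ler_wpM2r ?mulr_ge0 ?(ltW C0) ?(ltW (s0 j))// -natr1 lerD2r truncn_le.
have -> : (d / (delta * s j / 2) + 1) * (C * s j) = 2 * C / delta * d + C * s j.
  by field; rewrite !gt_eqF.
rewrite mulrDr; apply: lerD; rewrite ler_wpM2r ?(ltW (s0 j))//.
  by rewrite /A !le_max lexx !orbT.
apply: (@le_trans _ _ (2 * C)); last by rewrite /A !le_max lexx !orbT.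
by have := C0; lra.
Qed.

(** For a variable [n1] the codomain of [qcomp n1] is not convertible to its domain; an equation
    between distances avoids the transport. *)
Lemma mdist_qcomp0 n1 j i (u w : Xsp S i j) : n1 = 0%N ->
  mdist (qcomp n1 u) (qcomp n1 w) = mdist u w.
Proof. by move=> ->. Qed.

Lemma pcomp_distortion n2 l j (u w : Xsp S (n2 + l) j) : (j <= l)%N ->
  mdist u w <= A * (mdist (pcomp u) (pcomp w) + s l).
Proof.
move=> jl; apply: le_trans (pcomp_mdist hm C0 hS jl _ _) _.
have h1 : mdist (pcomp u) (pcomp w) <= A * mdist (pcomp u) (pcomp w).
  by rewrite ler_peMl// mdist_ge0.
have h2 : 2 * C * s l <= A * s l.
  by rewrite ler_wpM2r ?(ltW (s0 l))// /A !le_max lexx !orbT.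
have h3 : 0 <= 2 * C * s (n2 + l) by rewrite !mulr_ge0 ?(ltW C0) ?(ltW (s0 _)).
by rewrite mulrDr; lra.
Qed.

(** Serves to show that the coarse graph has edges at all. *)
Lemma lower_edge n2 l j : (j <= l)%N -> edge (gr S (n2 + l) j) -> edge (gr S l j).
Proof.
move=> jl; elim: n2 => //= n2 IH e.
exact: IH (proj_edge hS (leq_trans jl (leq_addl n2 l)) e).1.
Qed.

(* Radii between threshold * s_l and threshold * M * s_l are treated on the
   level l; the widths are the numbers of edges needed to cross a ball and its
   dilation. *)
Definition threshold : R := 3 * A.
Definition width : nat := (Num.truncn (A * (threshold * M%:R + 1))).+1.
Definition dilation : R := A * (near_fiber M C + width).+3%:R + 1.
Definition dilated_width : nat := (Num.truncn (A * (dilation * (threshold * M%:R) + 1))).+1.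

Local Notation K := threshold.
Local Notation tau := dilation.
Local Notation B := (adjacency_bound C).
Local Notation c := (weight_ratio C).

Lemma threshold_ge : 3 <= K. Proof. by rewrite /K ler_peMr. Qed.

Lemma dilation_ge2 : 2 <= tau.
Proof.
have : A * 1 <= A * (near_fiber M C + width).+3%:R.
  by rewrite ler_wpM2l// ?ler1n//; exact: le_trans A1.
by rewrite /tau; have := A1; lra.
Qed.

(* The alternative expresses j = min(l, n1 + j). *)
Lemma controlled_coarse n1 j n2 l (x : Xsp S (n2 + l) (n1 + j)) r :
  (j <= l)%N -> (n1 + j <= n2 + l)%N -> n1 = 0%N \/ j = l ->
  (exists y, y <> x) -> K * s l <= r -> r <= K * M%:R * s l ->
  controlled (meas S (n2 + l) (n1 + j)) x r tau
    ((B ^ dilated_width.+1)%:R * c ^+ dilated_width.+1)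
    (step_cost M C + 2 +
     (B ^ width.+1)%:R * (width.+2%:R * c ^+ width.+1 * c ^+ width.+1)).
Proof.
move=> jl ki n1j [x' x'x] Kr rK.
have ji : (j <= n2 + l)%N := leq_trans jl (leq_addl n2 l).
have tau2 := dilation_ge2; have K3 := threshold_ge.
have sl := s0 l; have c1 : 1 <= c := weight_ratio_ge1 C; have c0 : 0 <= c := le_trans ler01 c1.
have A0 : 0 < A := lt_le_trans ltr01 A1.
have rs : s l <= r by apply: le_trans Kr; rewrite ler_peMl ?(ltW sl)//; lra.
have r0 : 0 < r := lt_le_trans sl rs.
pose q := @qcomp _ _ _ S (n2 + l) j n1; pose P := @pcomp _ _ _ S n2 l j.
pose G := gr S l j; have lenG : len G = s l := len_scale S jl.
have GT := level_tame hS jl; have GT' := level_tame hS ji.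
have q1 u w : mdist (q u) (q w) <= mdist u w := qcomp_lipschitz hS u w ki.
have P1 u w : mdist (P u) (P w) <= mdist u w := pcomp_lipschitz hm hS jl u w.
(* Either [q] is the identity, or [j = l] and the error of its distortion is of the size of an edge
   of [G]. *)
have qA u w : mdist u w <= A * (mdist (q u) (q w) + len G).
  rewrite lenG; have [n10|jE] := n1j.
    rewrite /q mdist_qcomp0//; apply: le_trans (_ : A * mdist u w <= _).
      by rewrite ler_peMl// mdist_ge0.
    by rewrite ler_pM2l// lerDl ltW.
  have <- : s j = s l by rewrite jE.
  exact: qcomp_distortion.
have PA u w : mdist u w <= A * (mdist (P u) (P w) + len G).
  by rewrite lenG; exact: pcomp_distortion.
have qP : pushes (meas S (n2 + l) j) (meas S (n2 + l) (n1 + j)) (q : borel _ -> _).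
  split; first exact: (qcomp_measurable hS ki).
  by move=> U mU; exact: (qcomp_measure hS ki mU).
have idP : pushes (meas S (n2 + l) j) (meas S (n2 + l) j)
    (id : borel (Xsp S (n2 + l) j) -> Xsp S (n2 + l) j).
  by split; [exact: measurable_id|].
have PP : pushes (meas S (n2 + l) j) (meas S l j) (P : borel _ -> _).
  exact: (pushes_pcomp hm hS jl idP).
have [y0 y0x] := qcomp_surj hS ki x; have [y' y'x] := qcomp_surj hS ki x'.
have [e _] : exists e : edge (gr S (n2 + l) j), True.
  have y'y : y' <> y0 by move=> E; apply: x'x; rewrite -y'x E.
  by have [e _] := on_arc (graphP S ji) y'y; exists e.
have Zcells := cells_of_edge (graphP S jl) (lower_edge jl e).
have [e0 y0e] := Zcells (P y0).
have up a : A * (a + 1) <= (Num.truncn (A * (a + 1))).+1%:R.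
  by apply: ltW; exact: truncnS_gt.
have KM0 : 0 <= K * M%:R by rewrite mulr_ge0//; lra.
split.
  apply: le_trans (ball_measure_le GT P1 A1 qA qP PP Zcells y0x y0e (N := dilated_width) _) _.
    rewrite lenG; apply: (@le_trans _ _ (A * (tau * (K * M%:R) + 1) * s l)); last first.
      by rewrite ler_pM2r//; exact: up.
    rewrite -[leRHS]mulrA ler_pM2l// [leRHS]mulrDl mul1r lerD2r.
    by rewrite -[leRHS]mulrA ler_wpM2l//; lra.
  rewrite EFinM; apply: lee_wpmul2l; first by rewrite lee_fin mulr_ge0 ?exprn_ge0.
  apply: (ball_measure_ge GT q1 A1 PA qP PP y0x y0e); rewrite lenG.
  (* The threshold 3 A exceeds the 2 A that ensure that the ball contains the preimage of an open
     edge. *)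
  apply: lt_le_trans Kr; rewrite mulrA ltr_pM2r// /K mulrC ltr_pM2r//; lra.
move=> f L L0 fL.
have mf := lipschitz_measurable fL.
have mF : measurable_fun setT (f \o q : borel _ -> R) by exact: measurableT_comp mf qP.1.
have mg : measurable_fun setT (fun z : borel (Xsp S (n2 + l) j) => Lip f (q z)).
  exact: (measurableT_comp (measurable_Lip L0 fL) qP.1).
have g0 (z : borel (Xsp S (n2 + l) j)) : (0 <= Lip f (q z))%E by exact: Lip_ge0.
(* The constant 1 of the finest level is enlarged to the invariant value [step_cost + 2] before
   descending to level [l]. *)
have top := approximable_top (near_fiber M C) GT' mF mg g0
  (arc_Lip L0 fL (tame_graph GT') (tame_arc GT') q1).
have sc0 := step_cost_ge0 M C.
have k0 : 0 <= step_cost M C + 2 by lra.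
have k1 : 1 <= step_cost M C + 2 by lra.
have {}top := approximable_le g0 (ltW (len_gt0 (tame_graph GT'))) k1 top.
have {}top := approximable_pcomp hm C0 hS jl mF mg g0 idP top.
have rN : A * (r + len G) <= width%:R * len G.
  rewrite lenG; apply: (@le_trans _ _ (A * (K * M%:R + 1) * s l)); last first.
    by rewrite ler_pM2r//; exact: up.
  by rewrite -[leRHS]mulrA ler_pM2l// [leRHS]mulrDl mul1r lerD2r.
(* This determines [dilation]: since [s l <= r], its first term covers all edges entering the
   estimate, and the added 1 makes the inequality strict. *)
have tauN : A * ((near_fiber M C + width).+3%:R * len G) < tau * r.
  rewrite lenG mulrA; apply: (@lt_le_trans _ _ (tau * s l)); last by rewrite ler_wpM2l//; lra.
  by rewrite ltr_pM2r// /tau ltrDl.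
have [c' hc] := transfer_oscillation GT q1 P1 A1 qA PA qP PP Zcells y0x y0e k0 L0 fL top rN tauN.
exists c'; apply: le_trans hc _; apply: lee_wpmul2r.
  by apply: integral_ge0 => y _; exact: Lip_ge0.
have cn n : 0 <= c ^+ n by exact: exprn_ge0.
rewrite lee_fin lenG; apply: ler_wpM2l => //; apply: addr_ge0 => //.
by apply: mulr_ge0 => //; apply: mulr_ge0 => //; exact: mulr_ge0.
Qed.

Definition fine_width : nat := (Num.truncn K).+1.
Definition dilated_fine_width : nat := (Num.truncn (tau * K)).+1.

Lemma controlled_fine i k (x : Xsp S i k) r :
  (k <= i)%N -> (exists y, y <> x) -> 0 < r -> r <= K * s i ->
  controlled (meas S i k) x r tau
    (4 * ((B ^ dilated_fine_width.+1)%:R * c ^+ dilated_fine_width.+1 + 1) * tau *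
      fine_width%:R)
    (2 * ((B ^ fine_width.+1)%:R * c ^+ fine_width.+1 + 1) *
      (fine_width.+2%:R * c ^+ fine_width.+1)).
Proof.
move=> ki [y yx] r0 rK; have GT := level_tame hS ki.
have [e [t [t01 ->]]] := on_arc (tame_graph GT) yx.
have tau2 := dilation_ge2; have si := s0 i.
apply: (controlled_graph GT e t01) => //; first by lra.
- rewrite (len_scale S ki); apply: le_trans rK _.
  by rewrite ler_pM2r//; apply: ltW; exact: truncnS_gt.
- rewrite (len_scale S ki); apply: (@le_trans _ _ (tau * K * s i)).
    by rewrite -mulrA ler_pM2l//; lra.
  by rewrite ler_pM2r//; apply: ltW; exact: truncnS_gt.
Qed.

Lemma controlled_all : exists D K' : R, [/\ 0 <= D, 0 <= K' &
  forall i k, (k <= i)%N -> forall (x : Xsp S i k) r, 0 < r < 1 ->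
    controlled (meas S i k) x r tau D K'].
Proof.
have c1 : 1 <= c := weight_ratio_ge1 C; have c0 : 0 <= c := le_trans ler01 c1.
have tau2 := dilation_ge2; have K3 := threshold_ge.
set Dc := (B ^ dilated_width.+1)%:R * c ^+ dilated_width.+1.
set Kc := step_cost M C + 2 +
     (B ^ width.+1)%:R * (width.+2%:R * c ^+ width.+1 * c ^+ width.+1).
set Df := 4 * ((B ^ dilated_fine_width.+1)%:R * c ^+ dilated_fine_width.+1 + 1) * tau *
      fine_width%:R.
set Kf := 2 * ((B ^ fine_width.+1)%:R * c ^+ fine_width.+1 + 1) *
      (fine_width.+2%:R * c ^+ fine_width.+1).
exists (Num.max 1 (Num.max Dc Df)), (Num.max 0 (Num.max Kc Kf)).
split; [by rewrite le_max ler01|by rewrite le_max lexx|].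
move=> i k ki x r /andP[r0 r1].
have [[y yx]|nx] := pselect (exists y, y <> x); last first.
  apply: controlled_le (controlled_single _ _ r0 _); rewrite ?le_max ?lexx ?(ltW r0)//.
    by move=> y; apply: contrapT => yx; apply: nx; exists y.
  by lra.
have [rf|rc] := leP r (K * s i).
  apply: controlled_le (controlled_fine ki (ex_intro _ y yx) r0 rf);
    by rewrite ?le_max ?lexx ?orbT ?(ltW r0).
(* The least such [l] is the coarsest admissible level. It is not 0 because [r < 1 < K], and its
   minimality gives the upper bound [K * M * s l] for [r]. *)
have ex : exists l, (K * s l <= r)%R by exists i; exact: ltW.
case: (ex_minnP ex) => -[|l] lr lmin.
  by move: lr; rewrite scale0 mulr1; lra.
have li : (l.+1 <= i)%N by apply: lmin; exact: ltW.
have rl : r <= K * M%:R * s l.+1.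
  have : ~~ (K * s l <= r) by apply/negP => /lmin; rewrite ltnn.
  rewrite -ltNge => /ltW h; apply: le_trans h _.
  by rewrite -mulrA ler_wpM2l ?scale_leM//; lra.
(* Indices are rewritten as sums to match the types of [pcomp] and [qcomp]. *)
have [n2 E] : exists n2, i = (n2 + l.+1)%N by exists (i - l.+1)%N; rewrite subnK.
subst i.
have fin D1 K1 : D1 <= Num.max Dc Df -> K1 <= Num.max Kc Kf ->
    controlled (meas S (n2 + l.+1) k) x r tau D1 K1 ->
    controlled (meas S (n2 + l.+1) k) x r tau (Num.max 1 (Num.max Dc Df)) (Num.max 0 (Num.max Kc Kf)).
  by move=> h1 h2; apply: controlled_le; rewrite ?(ltW r0)// le_max (h1, h2) orbT.
apply: (fin Dc Kc); [by rewrite le_max lexx|by rewrite le_max lexx|].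
have [kl|lk] := leqP k l.+1.
  by apply: (@controlled_coarse 0 k n2 l.+1) => //; [left|exists y].
have [n1 E] : exists n1, k = (n1 + l.+1)%N by exists (k - l.+1)%N; rewrite subnK// ltnW.
subst k.
by apply: (@controlled_coarse n1 l.+1 n2 l.+1) => //; [right|exists y].
Qed.

End AllScales.

Theorem proposition3p10 (R : realType) (M : nat) (m : nat -> nat)
  (hm : forall i, (1 <= i)%N -> (3 <= m i <= M)%N)
  (T : target) (S : qsystem R m T) (hS : admissible S) :
  exists D CPI tau : R, 1 <= tau /\
    forall i k, (k <= i)%N -> forall (x : Xsp S i k) (r : R), 0 < r < 1 ->
      (meas S i k (ball x (2 * r)) <= D%:E * meas S i k (ball x r))%E /\
      forall f : Xsp S i k -> R, metric_lipschitz f ->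
        let fB := fine (mean (meas S i k) (ball x r) (fun y => (f y)%:E)) in
        (mean (meas S i k) (ball x r) (fun y => `|f y - fB|%:E) <=
         (CPI * r)%:E * mean (meas S i k) (ball x (tau * r)) (Lip f))%E.
Proof.
have [C [delta [C0 delta0 {}hS]]] := hS.
have [D [K [D0 K0 ctl]]] := controlled_all hm C0 delta0 hS.
have tau2 := dilation_ge2 M C delta.
exists D, (2 * K * D), (dilation M C delta); split; first by lra.
move=> i k ki x r r01; have h := ctl i k ki x r r01; have /andP[r0 _] := r01.
split.
  (* Doubling follows from the bound for the dilated ball, as the dilation is at least 2. *)
  apply: le_trans h.1; apply: le_measure; rewrite ?inE; try exact: borel_ball.
  by apply: ball_subset; rewrite ler_pM2r.
have tau1 : 1 <= dilation M C delta by lra.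
move=> f fL; exact: controlled_mean r0 tau1 D0 K0 h fL erefl.
Qed.
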